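(* Let $m\ge2$, let $(p_1,\dots,p_m)$ be random with an absolutely continuous distribution on the simplex $\mathfrak{S}_m=\{(p_1,\dots,p_m)\in(0,1)^m:\sum_{i=1}^m p_i=1\}$, and let $N\to\infty$ with $N$ deterministic. (i) Let $\beta\in\mathbb{R}$. For the $\beta$-linear divisor method, for each $i$, $$\Delta_i\xrightarrow{\mathrm d}\bar X_i:=\bigl(\beta-\tfrac12\bigr)(mp_i-1)+\widetilde U_0+p_i\sum_{k=1}^{m-2}\widetilde U_k,$$ where $\widetilde U_0,\dots,\widetilde U_{m-2}$ are uniform on $(-\frac12,\frac12)$, independent of each other and of $(p_1,\dots,p_m)$. Moreover, $(\Delta_1,\dots,\Delta_m)\xrightarrow{\mathrm d}(X_1,\dots,X_m)$ with $$X_i:=p_i\sum_{j=1}^m V_j-V_i+(\beta-1)(mp_i-1),$$ where $V_i:=U_i$ if $i\ne J$ and $V_i:=0$ if $i=J$; here $U_1,\dots,U_m$ are uniform on $(0,1)$, $J\in\{1,\dots,m\}$ satisfies $\mathbb{P}(J=j\mid p_1,\dots,p_m)=p_j$, the $U_i$ are independent of each other and of $(p_1,\dots,p_m)$, and, conditionally on $(p_1,\dots,p_m)$, the variables $U_1,\dots,U_m,J$ are independent. (ii) Let $\gamma\in\mathbb{R}$. For the $\gamma$-quota method, for each $i$, $$\Delta_i\xrightarrow{\mathrm d}Y_i:=\gamma\Bigl(p_i-\frac1m\Bigr)+\widetilde U_0+\frac1m\sum_{k=1}^{m-2}\widetilde U_k,$$ where $\widetilde U_0,\dots,\widetilde U_{m-2}$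 are uniform on $(-\frac12,\frac12)$, independent of each other and of $(p_1,\dots,p_m)$. Moreover, $(\Delta_1,\dots,\Delta_m)\xrightarrow{\mathrm d}(\bar Y_1,\dots,\bar Y_m)$ for some random variables $\bar Y_i$ such that the vector $(\bar Y_1-\gamma p_1,\dots,\bar Y_m-\gamma p_m)$ is exchangeable and independent of $(p_1,\dots,p_m)$, and $\bar Y_i$ has the same distribution as $Y_i$ for each $i$.
   Context: There are $m$ parties; party $i$ has proportion $p_i>0$ of the votes. $N$ (the house size) seats are distributed, party $i$ gets $s_i$ seats with $\sum_i s_i=N$, and the seat excess is $\Delta_i=s_i-Np_i$. For real $\alpha,x$, the $\alpha$-rounding $[x]_\alpha$ is an integer $n$ with $x-\alpha\le n\le x-\alpha+1$ (if $x-\alpha\in\mathbb{Z}$, both $x-\alpha$ and $x-\alpha+1$ are accepted values). The $\beta$-linear divisor method: $s_i=\max\{[p_i/D']_\beta,0\}$ where the real number $D'>0$ (and the choices of rounding in case of ties) are such that $\sum_i s_i=N$. The maximum with $0$ only matters if $\beta>1$; if $\beta\le 0$ the method is defined only for $N\ge m(\lfloor|\beta|\rfloor+1)$. The $\gamma$-quota method (for $N+\gamma>0$): $s_i=[(N+\gamma)p_i]_\alpha$ for all $i$, where the real number $\alpha$ (and the choices of rounding in case of ties) are such that $\sum_i s_i=N$. Ties are resolved at random. $\xrightarrow{\mathrm d}$ denotes convergence in distribution. Absolute continuity on $\mathfrak{S}_m$ is with respect to $(m-1)$-dimensional Lebesgue measure. *)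

(* Defs.v *)
From HB Require Import structures.
From mathcomp Require Export all_boot all_order all_algebra perm.
From mathcomp Require Export all_classical all_reals all_analysis.

Set Implicit Arguments.
Unset Strict Implicit.
Unset Printing Implicit Defensive.

Import Order.TTheory GRing.Theory Num.Theory.
Import numFieldNormedType.Exports.

Local Open Scope classical_set_scope.
Local Open Scope ring_scope.

(* [is_rounding alpha x n]: [n] is an accepted value of the alpha-rounding of
   [x]; when [x - alpha] is an integer there are two accepted values. *)
Definition is_rounding (R : realType) (alpha x : R) (n : int) : Prop :=
  x - alpha <= n%:~R <= x - alpha + 1.

(* Both outcomes below are relations: in case of ties several seat vectors
   are outcomes for the same proportions and house size. *)

Definition divisor_outcome (R : realType) (m : nat) (beta : R) (N : nat)
    (p : m.-tuple R) (s : 'I_m -> int) : Prop :=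
  (exists D : R, 0 < D /\
     forall i, exists n : int,
       is_rounding beta (tnth p i / D) n /\ s i = Num.max n 0) /\
  \sum_(i < m) s i = N%:Z.

Definition divisor_admissible (R : realType) (m : nat) (beta : R) (N : nat) :
    Prop :=
  beta <= 0 -> m%:Z * (Num.floor `|beta| + 1) <= N%:Z.

Definition quota_outcome (R : realType) (m : nat) (gamma : R) (N : nat)
    (p : m.-tuple R) (s : 'I_m -> int) : Prop :=
  (exists alpha : R,
     forall i, is_rounding alpha ((N%:R + gamma) * tnth p i) (s i)) /\
  \sum_(i < m) s i = N%:Z.

Definition quota_admissible (R : realType) (gamma : R) (N : nat) : Prop :=
  0 < N%:R + gamma.

Definition excess (R : realType) (m : nat) (N : nat) (p : m.-tuple R)
    (s : 'I_m -> int) (i : 'I_m) : R :=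
  (s i)%:~R - N%:R * tnth p i.

Definition simplex (R : realType) (m : nat) : set (m.-tuple R) :=
  [set p | (forall i, 0 < tnth p i < 1) /\ \sum_(i < m) tnth p i = 1].

(* On measurable sets this is k-dimensional Lebesgue measure, written as an
   iterated integral (Tonelli). *)
Fixpoint lebesgue_tuple (R : realType) (k : nat) : set (k.-tuple R) -> \bar R :=
  match k with
  | 0 => \d_[tuple]
  | k'.+1 => fun A =>
      (\int[lebesgue_measure]_(x in [set: R])
         lebesgue_tuple [set t : k'.-tuple R | A [tuple of x :: t]])%E
  end.

(* The point of the hyperplane of equation [\sum_i p_i = 1] whose first
   [m.-1] coordinates are [t]: the default value of [nth] is only reached at
   the last index. *)
Definition complete_tuple (R : realType) (m : nat) (t : m.-1.-tuple R) :
    m.-tuple R :=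
  [tuple nth (1 - \sum_(j < m.-1) tnth t j) t i | i < m].

(* (m-1)-dimensional Lebesgue measure on the simplex, in the chart given by
   the first [m.-1] coordinates.  It is the surface measure up to the constant
   factor [sqrt m], hence has the same null sets. *)
Definition simplex_lebesgue (R : realType) (m : nat) (A : set (m.-tuple R)) :
    \bar R :=
  lebesgue_tuple (complete_tuple (m := m) @^-1` (A `&` simplex (m := m))).

Section Probability.
Context {d : measure_display} {T : measurableType d} {R : realType}.
Variable P : probability T R.

Definition sigma_of {d'} {T' : measurableType d'} (X : T -> T') :
    set_system T :=
  preimage_set_system setT X measurable.

Definition mutually_independent (I : finType) (F : I -> set_system T) : Prop :=
  forall (K : {set I}) (A : I -> set T),
    (forall i, i \in K -> F i (A i)) ->
    P (\bigcap_(i in [set` K]) A i) = (\prod_(i in K) P (A i))%E.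

(* [g] is a version of the conditional probability of [A] given the
   sigma-algebra [G]. *)
Definition cond_prob (G : set_system T) (A : set T) (g : T -> R) : Prop :=
  [/\ (forall B : set R, measurable B -> G (g @^-1` B)),
      P.-integrable setT (EFin \o g) &
      forall B, G B -> (\int[P]_(w in B) (g w)%:E)%E = P (A `&` B)].

Definition cond_independent (G : set_system T) (I : finType)
    (F : I -> set_system T) : Prop :=
  forall (K : {set I}) (A : I -> set T) (g : I -> T -> R),
    (forall i, i \in K -> F i (A i) /\ cond_prob G (A i) (g i)) ->
    cond_prob G (\bigcap_(i in [set` K]) A i)
      (fun w => \prod_(i in K) g i w).

Definition uniform_on (a b : R) (X : {RV P >-> R}) : Prop :=
  exists ab : a < b, forall A : set R, measurable A ->
    distribution P X A = uniform_prob ab A.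

Definition exchangeable (m : nat) (Z : T -> m.-tuple R) : Prop :=
  forall (pi : {perm 'I_m}) (A : set (m.-tuple R)), measurable A ->
    P [set w | A [tuple tnth (Z w) (pi i) | i < m]] = P (Z @^-1` A).

Definition measurable_seats (m : nat) (s : T -> 'I_m -> int) : Prop :=
  forall (i : 'I_m) (n : int), measurable [set w | s w i = n].

End Probability.

Definition same_law {R : realType} {d1 d2 d : measure_display}
    {T1 : measurableType d1} {T2 : measurableType d2} {E : measurableType d}
    (P1 : probability T1 R) (X1 : T1 -> E)
    (P2 : probability T2 R) (X2 : T2 -> E) : Prop :=
  forall A : set E, measurable A -> P1 (X1 @^-1` A) = P2 (X2 @^-1` A).

Definition cvg_in_distribution {R : realType} {d1 d2 : measure_display}
    {T1 : measurableType d1} {T2 : measurableType d2} {E : topologicalType}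
    (P1 : probability T1 R) (X : nat -> T1 -> E)
    (P2 : probability T2 R) (Y : T2 -> E) : Prop :=
  forall f : E -> R, continuous f -> (exists M, forall x, `|f x| <= M) ->
    'E_P1[f \o X n]%E @[n --> \oo] --> 'E_P2[f \o Y]%E.

(* Random vectors are measurable maps to [m.-tuple R] (product sigma-algebra);
   they are read in ['rV[R]_m], which carries the topology. *)
Definition row_of_tuple (R : realType) (m : nat) (t : m.-tuple R) : 'rV[R]_m :=
  \row_i tnth t i.

Section Limits.
Context {d : measure_display} {T : measurableType d} {R : realType} {m : nat}.
Variable P : probability T R.

(* [Ut 0, ..., Ut (m - 2)] are uniform on (-1/2, 1/2), independent of each
   other and of [p]; the other terms of [Ut] are irrelevant. *)
Definition centered_uniforms (p : {RV P >-> m.-tuple R})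
    (Ut : nat -> {RV P >-> R}) : Prop :=
  (forall k, (k < m.-1)%N -> uniform_on (- 2^-1) 2^-1 (Ut k)) /\
  mutually_independent P (fun o : option 'I_m.-1 =>
    if o is Some k then sigma_of (Ut k) else sigma_of p).

Definition divisor_variables (p : {RV P >-> m.-tuple R})
    (U : 'I_m -> {RV P >-> R}) (J : T -> 'I_m) : Prop :=
  [/\ (forall i, uniform_on 0 1 (U i)),
      mutually_independent P (fun o : option 'I_m =>
        if o is Some i then sigma_of (U i) else sigma_of p),
      (forall j, measurable [set w | J w = j]),
      (forall j, cond_prob P (sigma_of p) [set w | J w = j]
                   (fun w => tnth (p w) j)) &
      cond_independent P (sigma_of p) (fun o : option 'I_m =>
        if o is Some i then sigma_of (U i)
        else preimage_set_system setT J setT)].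

Definition divisor_Xbar (beta : R) (p : T -> m.-tuple R) (Ut : nat -> T -> R)
    (i : 'I_m) (w : T) : R :=
  (beta - 2^-1) * (m%:R * tnth (p w) i - 1) + Ut 0%N w
  + tnth (p w) i * \sum_(1 <= k < m.-1) Ut k w.

Definition divisor_V (U : 'I_m -> T -> R) (J : T -> 'I_m) (i : 'I_m) (w : T) : R :=
  if i != J w then U i w else 0.

Definition divisor_X (beta : R) (p : T -> m.-tuple R) (U : 'I_m -> T -> R)
    (J : T -> 'I_m) (i : 'I_m) (w : T) : R :=
  tnth (p w) i * \sum_(j < m) divisor_V U J j w - divisor_V U J i w
  + (beta - 1) * (m%:R * tnth (p w) i - 1).

Definition quota_Y (gamma : R) (p : T -> m.-tuple R) (Ut : nat -> T -> R)
    (i : 'I_m) (w : T) : R :=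
  gamma * (tnth (p w) i - m%:R^-1) + Ut 0%N w
  + m%:R^-1 * \sum_(1 <= k < m.-1) Ut k w.

End Limits.

(* Main.v *)
Require Import Defs.
From HB Require Import structures.
From mathcomp Require Import measurable_realfun measurable_fun_approximation.
From mathcomp Require Import simple_functions ring lra zify.

Set Implicit Arguments.
Unset Strict Implicit.
Unset Printing Implicit Defensive.

Import Order.TTheory GRing.Theory Num.Theory.
Import numFieldNormedType.Exports.

Local Open Scope classical_set_scope.
Local Open Scope ring_scope.

(* Both methods round a vector y, affine in the proportions p, so that the error s - y lies
   in a translate tau q - [0,1]^m of the unit cube, with q = p for the divisor method and
   q = (1/m, ..., 1/m) for the quota method.  As the sum of the error is a constant c, the
   error lies in the projection along q of the cube to the hyperplane of sum c.  This
   projection is the disjoint union, up to null sets, of the projections of the m upper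
   faces, the j-th of which has volume q_j, and its integer translates tile the hyperplane.
   Since p is absolutely continuous, the fractional part of N p becomes uniform and
   independent of p, so the error is in the limit uniform on the projected cube: it leaves
   at a face j of probability q_j, from a uniform point of this face.

   For the equidistribution, let p move by O(1/N): integrating in addition over this
   displacement turns the sum over all seat vectors into an integral over the error, whose
   integrand converges pointwise, and Fatou's lemma bounds the lower limit of E F(error) from
   below by the expected limit, for F >= 0 continuous and p uniform on an open box.  The same
   bound for M - F gives equality, so the measures with density F(error) converge on boxes,
   hence setwise, hence against the density of p. *)

(** * Integration against Lebesgue measure on tuples *)

(** That the tiles cover the hyperplane and that ties are negligible both come out of a count of
    mass, through lower bounds only. [total_weight] counts strict outcomes, and uniqueness of a
    strict outcome leaves at most one nonzero term in it, so the weights of [F] and [M - F] together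
    are at most [M]. The limits given by Fatou's lemma add up to exactly [M], because the cell
    volumes [q j] have sum 1. Hence nothing can be lost, neither between the cells nor on ties.

    The complement is taken twice: for strict outcomes integrated over open boxes, where it gives
    convergence on a generating class, and for the actual outcomes under the law of [p], where it
    gives the limit itself. The obstacle in the divisor method is that the cells move with [p]. They
    are therefore described by strict inequalities in [q p], which survive a small displacement of
    [p]. *)

Section image_measure.
Context {R : realType} {d1 d2} {X : measurableType d1} {Y : measurableType d2}.
Variables (m : {measure set X -> \bar R}) (phi : X -> Y).
Hypothesis mphi : measurable_fun [set: X] phi.

Definition image_measure : {measure set Y -> \bar R} :=
  measure_function_pushforward__canonical__measure_function_Measure m mphi.

(** The measure [nu] only has to agree with the image on measurable sets, so that this change of
    variables also serves for measures built in another way, such as Lebesgue measure,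
    [cons_measure] or a product. *)
Lemma ge0_integral_image (nu : {measure set Y -> \bar R}) (f : Y -> \bar R) :
  (forall A, measurable A -> nu A = m (phi @^-1` A)) ->
  measurable_fun [set: Y] f -> (forall y, 0 <= f y)%E ->
  (\int[nu]_y f y = \int[m]_x f (phi x))%E.
Proof.
move=> nuE mf f0; rewrite (eq_measure_integral image_measure); last first.
  by move=> A mA _; exact: nuE.
by rewrite [LHS](ge0_integral_pushforward mphi).
Qed.

End image_measure.

Section cons_measure.
Context {R : realType} (n : nat).
Implicit Types mu : {sigma_finite_measure set (n.-tuple R) -> \bar R}.

Definition cons_pair (z : R * n.-tuple R) : n.+1.-tuple R := [tuple of z.1 :: z.2].

Lemma measurable_cons_pair : measurable_fun setT cons_pair.
Proof. exact: measurable_cons. Qed.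

Definition uncons (t : n.+1.-tuple R) : R * n.-tuple R := (thead t, [tuple of behead t]).

Lemma measurable_uncons : measurable_fun setT uncons.
Proof.
apply: measurable_fun_pair; last exact: measurable_behead.
exact: measurable_tnth.
Qed.

Lemma cons_pairK : cancel cons_pair uncons.
Proof. by case=> x t; congr pair => //; exact/val_inj. Qed.

Definition cons_measure mu : set (n.+1.-tuple R) -> \bar R :=
  pushforward (@lebesgue_measure R \x mu)%E cons_pair.

HB.instance Definition _ mu := Measure.copy (cons_measure mu)
  (image_measure (lebesgue_measure \x mu)%E measurable_cons_pair).

(** Products of two increasing exhaustions, transported by [uncons]. Sigma-finiteness is what
    Tonelli's theorem asks of [leb] at each step of its recursion. *)
Lemma cons_measure_sigma_finite mu : sigma_finite setT (cons_measure mu).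
Proof.
have /sigma_finiteP[F [TF ndF Foo]] := sigma_finiteT (@lebesgue_measure R).
have /sigma_finiteP[G [TG ndG Goo]] := sigma_finiteT mu.
exists (fun k => uncons @^-1` (F k `*` G k)).
  apply/esym; rewrite -subTset => t _; have [i _ Fi] : (\bigcup_i F i) (thead t) by rewrite -TF.
  have [j _ Gj] : (\bigcup_i G i) [tuple of behead t] by rewrite -TG.
  exists (maxn i j) => //; split => /=.
  - by move: Fi; exact/subsetPset/ndF/leq_maxl.
  - by move: Gj; exact/subsetPset/ndG/leq_maxr.
move=> k; have [mF Fk] := Foo k; have [mG Gk] := Goo k; split.
  by rewrite -[X in measurable X]setTI; apply: measurable_uncons => //; exact: measurableX.
rewrite /cons_measure /pushforward -comp_preimage.
rewrite (_ : _ \o _ = id); last by apply/funext => z; exact: cons_pairK.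
by rewrite product_measure1E// lte_mul_pinfty// ge0_fin_numE.
Qed.

HB.instance Definition _ mu :=
  Measure_isSigmaFinite.Build _ _ _ (cons_measure mu) (cons_measure_sigma_finite mu).

End cons_measure.

(** [lebesgue_tuple] is a bare set function; this copy carries the sigma-finite measure structure
    required for integration, and [leb_tupleE] identifies the two on measurable sets. *)
Fixpoint leb {R : realType} n : {sigma_finite_measure set (n.-tuple R) -> \bar R} :=
  match n with
  | 0 => \d_[tuple]
  | n'.+1 => cons_measure (leb n')
  end.

Section measurable_tuples.
Context {d d'} {T : measurableType d} {S : measurableType d'}.

Lemma measurable_mktuple n (f : 'I_n -> T -> S) :
  (forall i, measurable_fun [set: T] (f i)) ->
  measurable_fun [set: T] (fun x => [tuple f i x | i < n]).
Proof.
move=> mf; apply/measurable_fun_tnthP => i.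
by rewrite (_ : _ \o _ = f i)//; apply/funext => x /=; rewrite tnth_mktuple.
Qed.

Lemma measurable_tnth_comp n (f : T -> n.-tuple S) i :
  measurable_fun [set: T] f -> measurable_fun [set: T] (fun x => tnth (f x) i).
Proof. by move/measurable_fun_tnthP; apply. Qed.

End measurable_tuples.

Section tuple_insertion.
Context {S : Type} (n : nat).

(** Lets Tonelli's theorem single out an arbitrary coordinate, in particular that of an exit face,
    where [::] only gives access to the first. *)
Definition insert (j : 'I_n.+1) (x : S) (t : n.-tuple S) : n.+1.-tuple S :=
  [tuple oapp (tnth t) x (unlift j i) | i < n.+1].

Lemma tnth_insert_lift j x t k : tnth (insert j x t) (lift j k) = tnth t k.
Proof. by rewrite tnth_mktuple liftK. Qed.

Lemma tnth_insert j x t : tnth (insert j x t) j = x.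
Proof. by rewrite tnth_mktuple unlift_none. Qed.

Lemma insert0 x t : insert ord0 x t = [tuple of x :: t].
Proof.
apply: eq_from_tnth => i; case: (unliftP ord0 i) => [k|] ->.
  by rewrite tnth_insert_lift tnthS.
by rewrite tnth_insert.
Qed.

End tuple_insertion.

Lemma insert_lift0 {S : Type} n (j : 'I_n.+1) (x y : S) (t : n.-tuple S) :
  insert (lift ord0 j) x [tuple of y :: t] = [tuple of y :: insert j x t].
Proof.
apply: eq_from_tnth => i; case: (unliftP ord0 i) => [k|] ->.
  rewrite tnthS; case: (unliftP j k) => [l|] ->.
    rewrite tnth_insert_lift (_ : lift ord0 (lift j l) = lift (lift ord0 j) (lift ord0 l)).
      by rewrite tnth_insert_lift tnthS.
    by apply/val_inj; rewrite /= !bumpS.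
  by rewrite !tnth_insert.
rewrite [X in tnth (insert _ _ _) X](_ : ord0 = lift (lift ord0 j) ord0) ?tnth_insert_lift//.
exact/val_inj.
Qed.

Lemma measurable_insert {d d'} {T : measurableType d} {S : measurableType d'}
    n (j : 'I_n.+1) (f : T -> S) (g : T -> n.-tuple S) :
  measurable_fun [set: T] f -> measurable_fun [set: T] g ->
  measurable_fun [set: T] (fun x => insert j (f x) (g x)).
Proof.
move=> mf mg; apply: measurable_mktuple => i.
case: (unlift j i) => //= k; exact: measurable_tnth_comp.
Qed.

Section lebesgue_affine.
Context {R : realType}.
Local Open Scope ereal_scope.
Local Notation mu := (@lebesgue_measure R).

(** The image of Lebesgue measure under the reflection gives each interval []u, v]] its length,
    since the reflected interval is merely closed at the other end, and these values characterise
    Lebesgue measure. *)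
Lemma lebesgue_integral_reflect (a : R) (f : R -> \bar R) :
  measurable_fun [set: R] f -> (forall x, 0 <= f x) ->
  \int[mu]_x f (a - x)%R = \int[mu]_x f x.
Proof.
move=> mf f0; have ma : measurable_fun [set: measurableTypeR R]
    (fun x : R => (a - x)%R : measurableTypeR R).
  exact: (@measurable_funB _ R R).
apply/esym; apply: (ge0_integral_image (m := mu) ma) => // A mA.
 apply: (@lebesgue_measure_unique _ (image_measure mu ma)) => //.
move=> _ [[u v]] _ <- /=; rewrite /pushforward.
rewrite (_ : _ @^-1` _ = `[(a - v)%R, (a - u)%R[%classic); last first.
  apply/seteqP; split=> x /=; rewrite !in_itv/=.
    by move=> /andP[ux xv]; apply/andP; split; lra.
  by move=> /andP[ux xv]; apply/andP; split; lra.
rewrite !lebesgue_measure_itv/= !lte_fin ltrD2l ltrN2.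
by case: ifPn => // _; rewrite -!EFinB; congr EFin; lra.
Qed.

Lemma lebesgue_integral_scale (q : R) (f : R -> \bar R) : (0 < q)%R ->
  measurable_fun [set: R] f -> (forall x, 0 <= f x) ->
  \int[mu]_x f x = q%:E * \int[mu]_x f (q * x)%R.
Proof.
move=> q0 mf f0; have mq : measurable_fun [set: measurableTypeR R]
    (fun x : R => (q * x)%R : measurableTypeR R).
  exact: (@measurable_funM _ R R).
rewrite -(ge0_integral_image mq (nu := image_measure mu mq))//.
rewrite -[q]/((NngNum (ltW q0))%:num) -ge0_integral_mscale//.
apply: eq_measure_integral => A mA _.
apply: (@lebesgue_measure_unique _ (mscale (NngNum (ltW q0)) (image_measure mu mq))) => //.
move=> _ [[u v]] _ <- /=; rewrite /mscale/= /pushforward.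
rewrite (_ : _ @^-1` _ = `](u / q)%R, (v / q)%R]%classic); last first.
  apply/seteqP; split=> x /=; rewrite !in_itv/=; by rewrite ltr_pdivrMr// ler_pdivlMr// ![(x * q)%R]mulrC.
rewrite !lebesgue_measure_itv/= !lte_fin ltr_pM2r ?invr_gt0//.
case: ifPn => // _; last by rewrite mule0.
by rewrite -!EFinB -EFinM; congr EFin; field; rewrite gt_eqF.
Qed.

End lebesgue_affine.

Section leb_basic.
Context {R : realType}.
Local Open Scope ereal_scope.
Implicit Types n : nat.

Lemma measurable_tuple0 (A : set (0.-tuple R)) : measurable A.
Proof.
have [->//|/set0P[t At]] := eqVneq A set0.
rewrite (_ : A = setT)//; apply/seteqP; split => // u _.
by rewrite (tuple0 u) -(tuple0 t).
Qed.

Lemma measurable_cons_cst n (x : R) :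
  measurable_fun [set: n.-tuple R] (fun t : n.-tuple R => [tuple of x :: t]).
Proof. exact: (measurable_cons (f := cst x) (g := id)). Qed.

Lemma leb0_integral (f : 0.-tuple R -> \bar R) :
  \int[leb 0]_t f t = f [tuple].
Proof.
rewrite integral_dirac//= ?diracT ?mul1e//.
by move=> _ Y mY; exact: measurable_tuple0.
Qed.

Lemma leb_cons_integral n (f : n.+1.-tuple R -> \bar R) :
  measurable_fun [set: n.+1.-tuple R] f -> (forall t, 0 <= f t) ->
  \int[leb n.+1]_t f t = \int[lebesgue_measure]_x \int[leb n]_t f [tuple of x :: t].
Proof.
move=> mf f0.
rewrite (ge0_integral_image (m := (lebesgue_measure \x leb n))
  (@measurable_cons_pair R n))//.
rewrite fubini_tonelli1//.
by apply: measurableT_comp => //; exact: measurable_cons_pair.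
Qed.

Lemma measurable_integral_cons n (f : n.+1.-tuple R -> \bar R) :
  measurable_fun [set: n.+1.-tuple R] f -> (forall t, 0 <= f t) ->
  measurable_fun [set: R] (fun x : R => \int[leb n]_t f [tuple of x :: t]).
Proof.
move=> mf f0.
apply: (@measurable_fun_fubini_tonelli_F _ _ _ _ _ (leb n) (f \o @cons_pair R n)) => //=.
by apply: measurableT_comp => //; exact: measurable_cons_pair.
Qed.

Lemma tnth_cons n (x : R) (t : n.-tuple R) i :
  tnth [tuple of x :: t] i = oapp (tnth t) x (unlift ord0 i).
Proof.
by case: (unliftP ord0 i) => [k|] -> //=; rewrite tnthS.
Qed.

Definition tuple_sub n (a : 'I_n -> R) (t : n.-tuple R) : n.-tuple R :=
  [tuple (a i - tnth t i)%R | i < n].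

Lemma measurable_tuple_sub n a : measurable_fun [set: n.-tuple R] (@tuple_sub n a).
Proof.
apply: measurable_mktuple => i.
by apply: (@measurable_funB _ _ R) => //; exact: measurable_tnth.
Qed.

Lemma leb_reflect n (a : 'I_n -> R) (f : n.-tuple R -> \bar R) :
  measurable_fun [set: n.-tuple R] f -> (forall t, 0 <= f t) ->
  \int[leb n]_t f (tuple_sub a t) = \int[leb n]_t f t.
Proof.
elim: n a f => [|n IHn] a f mf f0.
  by rewrite !leb0_integral; congr f; exact: tuple0.
have ms := measurable_tuple_sub a.
rewrite !leb_cons_integral//; last exact: measurableT_comp.
rewrite -[RHS](lebesgue_integral_reflect (a ord0)); first last.
- by move=> x; exact: integral_ge0.
- exact: measurable_integral_cons.
apply: eq_integral => x _.
rewrite -[RHS](IHn (fun i => a (lift ord0 i))) //; last first.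
  apply: (measurableT_comp mf).
  exact: measurable_cons_cst.
apply: eq_integral => t _; congr f; apply: eq_from_tnth => i.
rewrite tnth_mktuple !tnth_cons; case: (unliftP ord0 i) => [k|] -> //=.
by rewrite tnth_mktuple.
Qed.

(** Induction on [n]: the [j]-th integral is brought in front of the tail by the induction
    hypothesis, then exchanged with the integral over the first coordinate. *)
Lemma leb_insert_integral n (j : 'I_n.+1) (f : n.+1.-tuple R -> \bar R) :
  measurable_fun [set: n.+1.-tuple R] f -> (forall t, 0 <= f t) ->
  \int[leb n.+1]_t f t =
  \int[lebesgue_measure]_x \int[leb n]_t f (insert j x t).
Proof.
elim: n j f => [|n IHn] j f mf f0.
  rewrite leb_cons_integral//; apply: eq_integral => x _.
  by apply: eq_integral => t _; rewrite ord1 insert0.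
case: (unliftP ord0 j) => [j'|] ->; last first.
  rewrite leb_cons_integral//; apply: eq_integral => x _.
  by apply: eq_integral => t _; rewrite insert0.
rewrite leb_cons_integral//.
transitivity (\int[lebesgue_measure]_y \int[lebesgue_measure]_x
    \int[leb n]_t f [tuple of y :: insert j' x t]).
  apply: eq_integral => y _; apply: IHn => //.
  by apply: (measurableT_comp mf); exact: measurable_cons_cst.
pose g (z : (measurableTypeR R * measurableTypeR R) * n.-tuple R) := f [tuple of z.1.1 :: insert j' z.1.2 z.2].
have mg : measurable_fun setT g.
  apply: (measurableT_comp mf); apply: measurable_cons.
    exact: measurableT_comp.
  apply: measurable_insert; last exact: measurable_snd.
  exact: measurableT_comp.
transitivity (\int[lebesgue_measure]_x \int[lebesgue_measure]_y
    \int[leb n]_t f [tuple of y :: insert j' x t]).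
  apply: (@fubini_tonelli _ _ _ _ _ (@lebesgue_measure R) (@lebesgue_measure R)
    (fun z => \int[leb n]_t g (z, t))).
    apply: (@measurable_fun_fubini_tonelli_F _ _ _ _ _ (leb n) g) => //.
    by move=> z; exact: f0.
  by move=> z; apply: integral_ge0 => t _; exact: f0.
apply: eq_integral => x _; rewrite leb_cons_integral//; last first.
  apply: (measurableT_comp mf).
  by apply: measurable_insert.
by apply: eq_integral => y _; apply: eq_integral => t _; rewrite insert_lift0.
Qed.

Lemma leb_tupleE n (A : set (n.-tuple R)) : measurable A ->
  lebesgue_tuple A = leb n A.
Proof.
elim: n A => [//|n IHn] A mA /=.
rewrite /cons_measure /pushforward.
apply: eq_integral => x _; rewrite IHn.
  by congr (leb n _); apply/seteqP; split=> t; rewrite /xsection/= inE.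
rewrite -[X in measurable X]setTI; exact: measurable_cons_cst.
Qed.

Lemma measurable_box n (B : 'I_n -> set R) : (forall i, measurable (B i)) ->
  measurable [set t : n.-tuple R | forall i, B i (tnth t i)].
Proof.
move=> mB; rewrite (_ : [set _ | _] =
   \bigcap_(i in [set: 'I_n]) ((@tnth _ R ^~ i) @^-1` B i)); last first.
  by apply/seteqP; split=> t /= h i; [move=> _|]; exact: h.
apply: fin_bigcap_measurable => // i _.
by rewrite -[X in measurable X]setTI; exact: measurable_tnth.
Qed.

Lemma leb_box n (B : 'I_n -> set R) : (forall i, measurable (B i)) ->
  leb n [set t | forall i, B i (tnth t i)] =
  \prod_(i < n) lebesgue_measure (B i).
Proof.
elim: n B => [|n IHn] B mB.
  rewrite big_ord0 (_ : [set t : 0.-tuple R | _] = setT); first exact: diracT.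
  by apply/seteqP; split => // t _ [].
rewrite big_ord_recl -IHn//.
rewrite -(@product_measure1E _ _ _ _ _ (@lebesgue_measure R) (leb n))//; last first.
  exact: (measurable_box (B := fun i => B (lift ord0 i))).
  exact: mB.
rewrite [LHS]/(leb n.+1 _) /= /cons_measure /pushforward; congr product_measure1; apply/seteqP; split=> -[x t] /=.
  move=> h; split=> [|i]; first by have := h ord0; rewrite tnth_cons unlift_none.
  by have := h (lift ord0 i); rewrite tnth_cons liftK.
by move=> [h0 h] i; rewrite tnth_cons; case: (unliftP ord0 i) => [k|] ->.
Qed.

End leb_basic.

Section box_unique.
Context {R : realType} (n : nat).
Definition boxes : set (set (n.-tuple R)) :=
  [set A | exists2 B : 'I_n -> set R, forall i, measurable (B i)
         & A = [set t | forall i, B i (tnth t i)]].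

Lemma boxes_setI : setI_closed boxes.
Proof.
move=> _ _ [B mB ->] [C mC ->]; exists (fun i => B i `&` C i).
  by move=> i; exact: measurableI.
apply/seteqP; split=> t /=; first by move=> [Bt Ct] i; split.
by move=> BCt; split=> i; have [] := BCt i.
Qed.

Lemma measurable_boxes : @measurable _ (n.-tuple R) = <<s boxes >>.
Proof.
apply/seteqP; split; last first.
  by apply: smallest_sub; [exact: sigma_algebra_measurable|move=> _ [B mB ->]; exact: measurable_box].
apply: smallest_sub; first exact: smallest_sigma_algebra.
rewrite -bigcup_seq => A [i _ [B mB <-]].
apply: sub_sigma_algebra; exists (fun k => if k == i then B else setT).
  by move=> k; case: ifP.
apply/seteqP; split=> t /=; first by move=> [_ Bt] k; case: eqP => // ->.
by move=> /(_ i); rewrite eqxx.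
Qed.

(** The boxes form a pi-system that generates the sigma-algebra; as [setT] is itself a box, finite
    total mass provides the exhaustion. *)
Lemma box_unique (m1 m2 : {measure set (n.-tuple R) -> \bar R}) :
  (m1 setT < +oo)%E ->
  (forall B : 'I_n -> set R, (forall i, measurable (B i)) ->
     m1 [set t | forall i, B i (tnth t i)] = m2 [set t | forall i, B i (tnth t i)]) ->
  forall A, measurable A -> m1 A = m2 A.
Proof.
move=> m1oo m12; apply: (measure_unique boxes (fun=> setT)) => //.
- exact: measurable_boxes.
- exact: boxes_setI.
- by move=> _; exists (fun=> setT) => //; apply/seteqP; split.
- by rewrite bigcup_const.
- by move=> _ [B mB ->]; exact: m12.
Qed.

End box_unique.

Section leb_swaps.
Context {R : realType}.
Local Open Scope ereal_scope.
Local Notation mu := (@lebesgue_measure R).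

(** A translation is the composite of two reflections. *)
Lemma lebesgue_integral_translate (b : R) (f : R -> \bar R) :
  measurable_fun [set: R] f -> (forall x, 0 <= f x) ->
  \int[mu]_x f (x + b)%R = \int[mu]_x f x.
Proof.
move=> mf f0; rewrite -[RHS](lebesgue_integral_reflect b)//.
rewrite -[RHS](lebesgue_integral_reflect 0%R)//; last first.
  by apply: (measurableT_comp mf); exact: (@measurable_funB _ R R).
by apply: eq_integral => x _; congr f; lra.
Qed.

Definition tuple_add n (b : 'I_n -> R) (t : n.-tuple R) : n.-tuple R :=
  [tuple (tnth t i + b i)%R | i < n].

Lemma measurable_tuple_add n b : measurable_fun [set: n.-tuple R] (@tuple_add n b).
Proof.
apply: measurable_mktuple => i.
by apply: (@measurable_funD _ _ R) => //; exact: measurable_tnth.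
Qed.

Lemma leb_translate n (b : 'I_n -> R) (f : n.-tuple R -> \bar R) :
  measurable_fun [set: n.-tuple R] f -> (forall t, 0 <= f t) ->
  \int[leb n]_t f (tuple_add b t) = \int[leb n]_t f t.
Proof.
move=> mf f0; rewrite -[RHS](leb_reflect b)//.
rewrite -[RHS](leb_reflect (fun=> 0%R))//; last first.
  by apply: (measurableT_comp mf); exact: measurable_tuple_sub.
apply: eq_integral => t _; congr f; apply: eq_from_tnth => i.
by rewrite !tnth_mktuple; lra.
Qed.

Lemma leb_swap n (f : R -> n.-tuple R -> \bar R) :
  measurable_fun [set: R * n.-tuple R] (fun z => f z.1 z.2) ->
  (forall x t, 0 <= f x t) ->
  \int[mu]_x \int[leb n]_t f x t = \int[leb n]_t \int[mu]_x f x t.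
Proof.
move=> mf f0.
exact: (@fubini_tonelli _ _ _ _ _ mu (leb n) (fun z => f z.1 z.2)).
Qed.

End leb_swaps.

(** * Lebesgue measure on a hyperplane, through its chart and through the exit faces *)

Section flow_box.
Context {R : realType} (n : nat).
Local Open Scope ereal_scope.
Local Notation mu := (@lebesgue_measure R).
Variables (q : 'I_n.+1 -> R) (c : R).
Hypothesis q1 : (\sum_i q i = 1)%R.

Definition ind01 (r : R) : \bar R := (\1_(`]0%R, 1%R[%classic : set R) r)%:E.

Lemma ind01_ge0 r : 0 <= ind01 r. Proof. by rewrite lee_fin. Qed.

Lemma measurable_ind01 : measurable_fun [set: R] ind01.
Proof. by apply/measurable_EFinP; exact: measurable_indic. Qed.

Lemma integral_ind01 : \int[mu]_r ind01 r = 1.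
Proof.
rewrite integral_indic// setIT.
apply: (etrans (lebesgue_measure_itv `]0%R, 1%R[)).
by rewrite /= lte_fin ltr01 oppr0 adde0.
Qed.

(* The point of the hyperplane [\sum_i e i = c] with first coordinates [a]. *)
Definition extend (a : n.-tuple R) : n.+1.-tuple R :=
  insert ord_max (c - \sum_i tnth a i)%R a.

Definition tsum k (t : k.-tuple R) : R := (\sum_i tnth t i)%R.

Lemma measurable_tsum k : measurable_fun [set: k.-tuple R] (@tsum k).
Proof.
by apply: (@measurable_sum _ _ R) => i; exact: measurable_tnth.
Qed.

(* The projection onto the hyperplane [\sum_i e i = c] along the flow direction [q]. *)
Definition slide (z : n.+1.-tuple R) : n.+1.-tuple R :=
  [tuple (tnth z i - (tsum z - c) * q i)%R | i < n.+1].

Lemma tnth_slide z i : tnth (slide z) i = (tnth z i - (tsum z - c) * q i)%R.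
Proof. exact: tnth_mktuple. Qed.

Lemma measurable_slide : measurable_fun [set: n.+1.-tuple R] slide.
Proof.
apply: measurable_mktuple => i; apply: (@measurable_funB _ _ R) => //.
  exact: measurable_tnth.
apply: (@measurable_funM _ _ R) => //; apply: (@measurable_funB _ _ R) => //.
exact: measurable_tsum.
Qed.

Lemma tsum_insert k (j : 'I_k.+1) (x : R) t : tsum (insert j x t) = (x + tsum t)%R.
Proof.
rewrite /tsum (bigD1_ord j)//= tnth_insert; congr (_ + _)%R.
by apply: eq_bigr => i _; rewrite tnth_insert_lift.
Qed.

Variable f : n.+1.-tuple R -> \bar R.
Hypothesis mf : measurable_fun [set: n.+1.-tuple R] f.
Hypothesis f0 : forall t, 0 <= f t.

Let flow z := ind01 (tsum z - c)%R * f (slide z).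

Let mflow : measurable_fun [set: n.+1.-tuple R] flow.
Proof.
apply: emeasurable_funM.
  apply: (measurableT_comp measurable_ind01).
  by apply: (@measurable_funB _ _ R) => //; exact: measurable_tsum.
exact: measurableT_comp measurable_slide.
Qed.

Let flow0 z : 0 <= flow z.
Proof. by rewrite mule_ge0// ind01_ge0. Qed.

(* Thicken the hyperplane along [q] by a unit of the sum: since [\sum_i q i = 1], Fubini
   and translation invariance show that this does not change the integral. *)
Lemma leb_extend_flow : \int[leb n]_a f (extend a) = \int[leb n.+1]_z flow z.
Proof.
rewrite (leb_insert_integral ord_max)// leb_swap//; last first.
  apply: (measurableT_comp mflow); exact: measurable_insert.
transitivity (\int[leb n]_a \int[mu]_r (ind01 r *
    f (slide (insert ord_max (r + (c - tsum a))%R a)))).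
  rewrite -[RHS]leb_swap; last 2 first.
  - apply: emeasurable_funM; first exact: (measurableT_comp measurable_ind01).
    apply: (measurableT_comp mf); apply: (measurableT_comp measurable_slide).
    apply: measurable_insert; last exact: measurable_snd.
    apply: (@measurable_funD _ _ R) => //.
    by apply: (@measurable_funB _ _ R) => //; exact: (measurableT_comp (@measurable_tsum _)).
  - by move=> x t; rewrite mule_ge0// ind01_ge0.
  (* The weight [ind01 r] has integral 1, so the extra variable [r] comes for free. *)
  transitivity (\int[mu]_r (ind01 r * \int[leb n]_a f (extend a))).
    rewrite ge0_integralZr//; [|exact: measurable_ind01|by move=> *; exact: ind01_ge0|exact: integral_ge0].
    by rewrite integral_ind01 mul1e.
  apply: eq_integral => r _.
  pose g a := f (slide (insert ord_max (r + (c - tsum a))%R a)).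
  have mg : measurable_fun [set: n.-tuple R] g.
    apply: (measurableT_comp mf); apply: (measurableT_comp measurable_slide).
    apply: measurable_insert => //.
    apply: (@measurable_funD _ _ R) => //.
    by apply: (@measurable_funB _ _ R) => //; exact: measurable_tsum.
  rewrite ge0_integralZl//; last exact: ind01_ge0.
  (* For fixed [r], translating [a] by [r * q] compensates [slide], which subtracts [r * q] from a
     point of sum [c + r]. *)
  congr (_ * _); rewrite -[RHS](leb_translate (fun i => r * q (lift ord_max i))%R mg); last by move=> t; exact: f0.
  apply: eq_integral => a _; rewrite /g; congr f.
  have tsA : tsum (tuple_add (fun i => r * q (lift ord_max i))%R a) =
      (tsum a + r * (1 - q ord_max))%R.
    rewrite -q1 (bigD1_ord ord_max)//= [(q _ + _)%R]addrC addrK mulr_sumr -big_split/=.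
    by apply: eq_bigr => i _; rewrite tnth_mktuple.
  apply: eq_from_tnth => i; rewrite tnth_slide tsum_insert /extend.
  case: (unliftP ord_max i) => [k|] ->.
    by rewrite !tnth_insert_lift tnth_mktuple; ring.
  by rewrite !tnth_insert tsA /tsum; ring.
apply: eq_integral => a _.
rewrite -[RHS](lebesgue_integral_translate (c - tsum a)%R)//; last first.
  apply: (measurableT_comp mflow).
  exact: measurable_insert.
apply: eq_integral => r _; rewrite /flow tsum_insert; congr (ind01 _ * _).
by ring.
Qed.

Variable j : 'I_n.+1.
Hypothesis qj : (0 < q j)%R.

(* The point of the hyperplane [\sum_i e i = c] on the line directed by [q] through [- V],
   where [V] is [U] with its [j]-th coordinate, which has no effect, replaced by [0]. *)
Definition flow_exit (U : n.+1.-tuple R) : n.+1.-tuple R :=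
  [tuple (q i * (c + (tsum U - tnth U j)) - (if i == j then 0 else tnth U i))%R | i < n.+1].

Lemma tnth_flow_exit U i : tnth (flow_exit U) i =
  (q i * (c + (tsum U - tnth U j)) - (if i == j then 0 else tnth U i))%R.
Proof. exact: tnth_mktuple. Qed.

Lemma measurable_flow_exit : measurable_fun [set: n.+1.-tuple R] flow_exit.
Proof.
apply: measurable_mktuple => i; apply: (@measurable_funB _ _ R).
  apply: (@measurable_funM _ _ R) => //; apply: (@measurable_funD _ _ R) => //.
  apply: (@measurable_funB _ _ R); first exact: measurable_tsum.
  exact: measurable_tnth.
by case: eqP => // _; exact: measurable_tnth.
Qed.

(** Substitute [z j = q j * t] and [z i = q i * t - V i] for [i != j]. The Jacobian is [q j], which
    is where the volume of a cell comes from. As [t] moves [z] along [q], the point [slide z]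
    depends on [V] only, while [tsum z - c] equals [t - tsum V - c] and, after a translation of [t],
    becomes the free coordinate [U j]. *)
Lemma flow_leb_exit : \int[leb n.+1]_z flow z =
  (q j)%:E * \int[leb n.+1]_U (ind01 (tnth U j) * f (flow_exit U)).
Proof.
have mH : measurable_fun [set: n.+1.-tuple R]
    (fun U => ind01 (tnth U j) * f (flow_exit U)).
  apply: emeasurable_funM.
    exact: (measurableT_comp measurable_ind01 (measurable_tnth _)).
  exact: measurableT_comp measurable_flow_exit.
have H0 U : 0 <= ind01 (tnth U j) * f (flow_exit U) by rewrite mule_ge0// ind01_ge0.
rewrite (leb_insert_integral j)// (lebesgue_integral_scale qj); last 2 first.
- pose h (z : R * n.-tuple R) := flow (insert j z.1 z.2).
  apply: (@measurable_fun_fubini_tonelli_F _ _ _ _ _ (leb n) h) => //.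
    by apply: (measurableT_comp mflow); exact: measurable_insert.
  by move=> z; exact: flow0.
- by move=> x; apply: integral_ge0 => t _; exact: flow0.
congr (_ * _).
transitivity (\int[mu]_t \int[leb n]_V flow (insert j (q j * t)%R
    (tuple_sub (fun k => q (lift j k) * t)%R V))).
  apply: eq_integral => t _.
  rewrite -[LHS](leb_reflect (fun k => q (lift j k) * t)%R)//.
  by apply: (measurableT_comp mflow); exact: measurable_insert.
rewrite leb_swap//; last first.
  apply: (measurableT_comp mflow); apply: measurable_insert.
    exact: (@measurable_funM _ _ R).
  apply: measurable_mktuple => i; apply: (@measurable_funB _ _ R).
    exact: (@measurable_funM _ _ R).
  exact: measurable_tnth_comp.
rewrite (leb_insert_integral j)//.
rewrite [RHS]leb_swap; last 2 first.
- by apply: (measurableT_comp mH); exact: measurable_insert.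
- by move=> *; exact: H0.
apply: eq_integral => V _.
rewrite -[RHS](lebesgue_integral_translate (- c - tsum V)%R); last 2 first.
- apply: (measurableT_comp mH).
  exact: measurable_insert.
- by move=> *; exact: H0.
apply: eq_integral => t _; rewrite /flow.
have tsS : tsum (tuple_sub (fun k => q (lift j k) * t)%R V) =
    (t * (1 - q j) - tsum V)%R.
  rewrite -q1 (bigD1_ord j)//= [(q _ + _)%R]addrC addrK mulr_sumr -sumrB.
  by apply: eq_bigr => i _; rewrite tnth_mktuple [(t * _)%R]mulrC.
rewrite !tnth_insert tsum_insert tsS; congr (ind01 _ * f _); first by ring.
apply: eq_from_tnth => i; rewrite tnth_slide tnth_flow_exit !tsum_insert !tnth_insert tsS.
case: (unliftP j i) => [k|] ->.
  by rewrite !tnth_insert_lift tnth_mktuple eq_sym (negbTE (neq_lift _ _)); ring.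
by rewrite !tnth_insert eqxx; ring.
Qed.

Lemma leb_extend_exit : \int[leb n]_a f (extend a) =
  (q j)%:E * \int[leb n.+1]_U (ind01 (tnth U j) * f (flow_exit U)).
Proof. by rewrite leb_extend_flow flow_leb_exit. Qed.

End flow_box.

(** * Outcomes as cells of a tiling *)

Section apportionment.
Context {R : realType} {I : finType}.
Implicit Types (q y e : I -> R) (s : I -> int).

(* With [tau = e j / q j] this reads [q i * tau - 1 < e i < q i * tau] for [i != j]: the
   vector [e] is on the [j]-th upper face of the cube [tau q - [0, 1]^I]. *)
Definition strict_cell q (j : I) e :=
  [forall i, (i != j) ==> (0 < q i * e j - q j * e i < q j)].

Lemma strict_cell_ratio q j e : 0 < q j -> strict_cell q j e ->
  forall i, i != j -> 0 < q i * (e j / q j) - e i < 1.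
Proof.
move=> qj /forallP cell i ij; have := cell i; rewrite ij /=.
rewrite -(ltr_pM2r (x := (q j)^-1)) ?invr_gt0// mul0r.
rewrite -[X in _ && X](ltr_pM2r (x := (q j)^-1)) ?invr_gt0// divff ?gt_eqF//.
by rewrite mulrBl -mulrA [q j * e i]mulrC mulfK ?gt_eqF.
Qed.

(* Common form of both methods.  The divisor method is [q = p], [y i = N p_i - (beta - 1)],
   [tau = 1 / D - N]; the quota method is [q i = 1 / m], [y i = (N + gamma) p_i] and
   [tau = m (1 - alpha)]. *)
Definition rounded q y (N : nat) s : Prop :=
  (exists tau : R, forall i, exists k : int,
     q i * tau - 1 <= k%:~R - y i <= q i * tau /\ (s i = k \/ s i = Num.max k 0))
  /\ \sum_i s i = N%:Z.

(** The outcomes without ties. Nonnegativity makes the truncation allowed in [rounded] harmless, and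
    places the seat vectors of sum [N] in a finite set. *)
Definition strictly_rounded q y (N : nat) s (j : I) : bool :=
  [&& \sum_i s i == N%:Z, [forall i, 0 <= s i]
    & strict_cell q j (fun i => (s i)%:~R - y i)].

(** For two distinct faces, [q j' * e j - q j * e j'] and its opposite would both be positive. *)
Lemma strict_cell_inj q j j' e : strict_cell q j e -> strict_cell q j' e -> j = j'.
Proof.
move=> /forallP/(_ j')/implyP + /forallP/(_ j)/implyP.
have [//|jj'] := eqVneq j j' => /(_ isT)/andP[+ _] /(_ isT)/andP[+ _].
by move=> h1 h2; exfalso; lra.
Qed.

Lemma eq_of_sum_le s s' : \sum_i s i = \sum_i s' i ->
  (forall i, s i <= s' i) -> s =1 s'.
Proof.
move=> ss' le_ss' i; apply/eqP; rewrite -subr_eq0; apply/eqP.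
have : \sum_i (s' i - s i) = 0 by rewrite sumrB ss' subrr.
move/eqP; rewrite psumr_eq0 => [/allP/(_ i)|k _]; last by rewrite subr_ge0.
by rewrite mem_index_enum => /(_ isT)/eqP; lia.
Qed.

(** Compares the parameter [tau] of any outcome with the ratio [t] at which the strict one leaves
    through its face: the larger parameter gives every party at least as many seats, and equal
    totals then force equality. All resolutions of ties are included on the side of [s']. *)
Lemma rounded_unique q y N s s' j : (forall i, 0 < q i) ->
  strictly_rounded q y N s j -> rounded q y N s' -> s' =1 s.
Proof.
move=> q0 /and3P[/eqP sN /forallP s0 /(strict_cell_ratio (q0 j)) cell] [[tau taus'] s'N].
set t := ((s j)%:~R - y j) / q j in cell.
have lower i : q i * t - 1 < (s i)%:~R - y i.
  have [->|ij] := eqVneq i j; last by have /andP[] := cell i ij; lra.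
  by rewrite /t mulrC divfK ?gt_eqF//; lra.
have upper i : (s i)%:~R - y i <= q i * t.
  have [->|ij] := eqVneq i j; last by have /andP[] := cell i ij; lra.
  by rewrite /t mulrC divfK ?gt_eqF//; lra.
(* In both cases one of the inequalities involved is strict: [t < tau] in the first, [lower] in the
   second. For integers this turns a strict bound by a number plus 1 into a bound by the number. *)
have [tt|tt] := ltP t tau; [move=> i; apply/esym; move: i|]; apply: eq_of_sum_le.
- by rewrite sN.
- move=> i; have [k [/andP[+ _] s'k]] := taus' i.
  have := upper i; have : q i * t < q i * tau by rewrite ltr_pM2l.
  move=> h1 h2 h3; have : (s i)%:~R < k%:~R + 1 :> R by lra.
  rewrite -[1]/(1%:~R) -intrD ltr_int => sk.
  by case: s'k => ->; rewrite ?le_max; apply/idP; lia.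
- by rewrite sN.
- move=> i; have [k [/andP[_ +] s'k]] := taus' i.
  have := lower i; have : q i * tau <= q i * t by rewrite ler_pM2l.
  move=> h1 h2 h3; have : k%:~R < (s i)%:~R + 1 :> R by lra.
  rewrite -[1]/(1%:~R) -intrD ltr_int => ks.
  (* Nonnegativity of [s] enters here: [s' i] may be [Num.max k 0], which [k <= s i] alone does not
     bound. *)
  have := s0 i; case: s'k => -> s0i; rewrite ?ge_max; apply/idP; lia.
Qed.

Lemma strictly_rounded_rounded q y N s j : (forall i, 0 < q i) ->
  strictly_rounded q y N s j -> rounded q y N s.
Proof.
move=> q0 /and3P[/eqP sN _ /(strict_cell_ratio (q0 j)) cell]; split => //.
exists (((s j)%:~R - y j) / q j) => i; exists (s i); split; last by left.
have [->|ij] := eqVneq i j; last by have /andP[] := cell i ij; lra.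
by rewrite mulrC divfK ?gt_eqF//; lra.
Qed.

Lemma strictly_rounded_inj q y N s s' j j' : (forall i, 0 < q i) ->
  strictly_rounded q y N s j -> strictly_rounded q y N s' j' ->
  s =1 s' /\ j = j'.
Proof.
move=> q0 sj sj'.
have ss' := rounded_unique q0 sj' (strictly_rounded_rounded q0 sj).
split=> //; case/and3P: sj => _ _; case/and3P: sj' => _ _.
rewrite (_ : (fun i => (s' i)%:~R - _) = fun i => (s i)%:~R - y i).
  by move=> /[swap]; exact: strict_cell_inj.
by apply/funext => i; rewrite ss'.
Qed.

End apportionment.

Section sequentially_continuous.
Context {R : realType} (k : nat).

Definition cvg_tuple (u : nat -> k.-tuple R) (p : k.-tuple R) :=
  forall i, tnth (u N) i @[N --> \oo] --> tnth p i.

(** Expressed by coordinatewise limits of sequences, so that tuples keep only their sigma-algebra;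
    the pointwise limits to which Fatou's lemma is applied are along sequences anyway. *)
Definition seq_continuous (f : k.-tuple R -> R) :=
  forall u p, cvg_tuple u p -> f (u N) @[N --> \oo] --> f p.

(** Rounding each coordinate down to a multiple of [1 / (N + 1)] before applying [f] gives a
    function that factors through a countable type, hence is measurable; these functions converge to
    [f] pointwise. *)
Lemma seq_continuous_measurable f : seq_continuous f ->
  measurable_fun [set: k.-tuple R] f.
Proof.
move=> cf.
pose fl N (t : k.-tuple R) : k.-tuple int := [tuple Num.floor (N.+1%:R * tnth t i) | i < k].
pose fr N (z : k.-tuple int) : k.-tuple R := [tuple (tnth z i)%:~R / N.+1%:R | i < k].
apply: (@measurable_fun_cvg _ _ _ _ (fun N t => f (fr N (fl N t)))).
  move=> N _ Y mY; rewrite setTI.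
  rewrite (_ : _ @^-1` Y = \bigcup_(z in [set: k.-tuple int])
     (if f (fr N z) \in Y then [set t | forall i, [set x | Num.floor (N.+1%:R * x) = tnth z i] (tnth t i)] else set0)).
    apply: countable_bigcupT_measurable; [exact: (@countableP _ [set: k.-tuple int])|].
    move=> z; case: ifP => // _; apply: (measurable_box (B := fun i => [set x | Num.floor (N.+1%:R * x) = tnth z i])) => i.
    rewrite (_ : [set x : R | _] = `[(tnth z i)%:~R / N.+1%:R, ((tnth z i) + 1)%:~R / N.+1%:R[%classic); first exact: measurable_itv.
    apply/seteqP; split=> x /=; rewrite in_itv/= ler_pdivrMr// ltr_pdivlMr// [x * _]mulrC.
      by move=> <-; exact: floor_itv.
    by move=> h; apply: floor_def.
  apply/seteqP; split=> t /=.
    move=> Yt; exists (fl N t) => //; rewrite mem_set//= => i.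
    by rewrite tnth_mktuple.
  move=> [z _]; case: ifPn => // /set_mem Yz zt.
  suff -> : fl N t = z by [].
  by apply: eq_from_tnth => i; rewrite tnth_mktuple; exact: zt.
move=> t _; apply: cf => i.
have H N : tnth t i - N.+1%:R^-1 <= tnth (fr N (fl N t)) i <= tnth t i.
  rewrite !tnth_mktuple; have /andP[h1 h2] := floor_itv (N.+1%:R * tnth t i).
  have N0 : (0 : R) < N.+1%:R by [].
  rewrite ler_pdivrMr// [X in _ && (_ <= X)]mulrC h1 andbT.
  rewrite ler_pdivlMr// mulrBl mulVf ?gt_eqF// lerBlDr mulrC ltW//.
  by move: h2; rewrite intrD.
apply: (@squeeze_cvgr _ _ _ _ (fun N => tnth t i - N.+1%:R^-1) (fun=> tnth t i)).
- by apply: nearW.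
- rewrite -[X in _ --> X]subr0; apply: cvgB; first exact: cvg_cst.
  exact: cvg_harmonic.
- exact: cvg_cst.
Qed.

End sequentially_continuous.

Lemma measurable_forallb {d} {T : measurableType d} (I : finType)
    (b : I -> T -> bool) :
  (forall i, measurable_fun [set: T] (b i)) ->
  measurable_fun [set: T] (fun x => [forall i, b i x]).
Proof.
move=> mb; apply: (measurable_fun_bool true) => //; rewrite setTI.
rewrite (_ : _ @^-1` _ = \bigcap_(i in [set: I]) (b i @^-1` [set true])).
  apply: fin_bigcap_measurable => // i _.
  by rewrite -[X in measurable X]setTI; exact: mb.
apply/seteqP; split=> x /=; first by move=> /forallP h i _; exact: h.
by move=> h; apply/forallP => i; exact: h.
Qed.

Section measurable_cell.
Context {R : realType} {d} {T : measurableType d} {I : finType}.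

Lemma measurable_strict_cell (q e : T -> I -> R) j :
  (forall i, measurable_fun [set: T] (q^~ i)) ->
  (forall i, measurable_fun [set: T] (e^~ i)) ->
  measurable_fun [set: T] (fun x => strict_cell (q x) j (e x)).
Proof.
move=> mq me; apply: measurable_forallb => i; case: (i != j) => //=.
have mv : measurable_fun [set: T] (fun x => q x i * e x j - q x j * e x i).
  by apply: (@measurable_funB _ _ R); exact: (@measurable_funM _ _ R).
by apply: measurable_and; exact: measurable_fun_ltr.
Qed.

End measurable_cell.

(** * Weights of strict outcomes as functions of the proportions *)

Section lower_bound.
Context {R : realType} (n : nat).
Variables (q : n.+1.-tuple R -> 'I_n.+1 -> R) (g kap : R) (F : n.+1.-tuple R -> R).
Hypothesis q_gt0 : forall p, simplex p -> forall i, 0 < q p i.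
Hypothesis q_sum : forall p, simplex p -> \sum_i q p i = 1.
Hypothesis q_cont : forall i, seq_continuous (q^~ i).
Hypothesis F_cont : seq_continuous F.
Hypothesis F_ge0 : forall x, 0 <= F x.

(** The divisor method has [g = 0] and [kap = beta - 1], the quota method [g = gamma] and
    [kap = 0]. *)
Definition target N (p : n.+1.-tuple R) (i : 'I_n.+1) : R :=
  (N%:R + g) * tnth p i - kap.

Definition err N (p : n.+1.-tuple R) (s : 'I_n.+1 -> int) : n.+1.-tuple R :=
  [tuple (s i)%:~R - N%:R * tnth p i | i < n.+1].

Definition seats N (s : {ffun 'I_n.+1 -> 'I_N.+1}) (i : 'I_n.+1) : int :=
  (s i : nat)%:Z.

Definition weight N s j (p : n.+1.-tuple R) : R :=
  if strictly_rounded (q p) (target N p) N s j then F (err N p s) else 0.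

(* This is [F] of the error of the unique outcome when the outcome is strict, and [0]
   otherwise: hence always a lower bound for [F] of the error of any outcome. *)
Definition total_weight N (p : n.+1.-tuple R) : R :=
  \sum_(s : {ffun 'I_n.+1 -> 'I_N.+1}) \sum_j weight N (seats s) j p.

(* The errors [s i - target N p i] of an apportionment sum to this constant. *)
Definition shift_constant : R := n.+1%:R * kap - g.

(** Passes from the error relative to [target] to the seat excess: the difference
    [g * tnth p i - kap] of the two reference points is independent of [N]. *)
Definition limit_err (p : n.+1.-tuple R) (e : n.+1.-tuple R) : n.+1.-tuple R :=
  [tuple tnth e i + g * tnth p i - kap | i < n.+1].

Lemma weight_ge0 N s j p : 0 <= weight N s j p.
Proof. by rewrite /weight; case: ifP. Qed.

Lemma total_weight_ge0 N p : 0 <= total_weight N p.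
Proof. by do 2 apply: sumr_ge0 => ? _; exact: weight_ge0. Qed.

Lemma measurable_target N i : measurable_fun [set: n.+1.-tuple R] (target N ^~ i).
Proof.
apply: (@measurable_funB _ _ R) => //; apply: (@measurable_funM _ _ R) => //.
exact: measurable_tnth.
Qed.

Lemma measurable_err N s : measurable_fun [set: n.+1.-tuple R] (err N ^~ s).
Proof.
apply: measurable_mktuple => i; apply: (@measurable_funB _ _ R) => //.
apply: (@measurable_funM _ _ R) => //; exact: measurable_tnth.
Qed.

Lemma measurable_weight N s j : measurable_fun [set: n.+1.-tuple R] (weight N s j).
Proof.
apply: measurable_fun_ifT => //; last first.
  by apply: measurableT_comp (measurable_err _ _); exact: seq_continuous_measurable.
apply: measurable_and => //; apply: measurable_and => //.
apply: measurable_strict_cell => i; first exact: seq_continuous_measurable.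
by apply: (@measurable_funB _ _ R) => //; exact: measurable_target.
Qed.

Lemma measurable_total_weight N : measurable_fun [set: n.+1.-tuple R] (total_weight N).
Proof.
by do 2 apply: (@measurable_sum _ _ R) => ?; exact: measurable_weight.
Qed.

Lemma cvg_tuple_extend c u (t : n.-tuple R) : cvg_tuple u t ->
  cvg_tuple (fun N => extend c (u N)) (extend c t).
Proof.
move=> ut i; case: (unliftP ord_max i) => [k|] ->.
  by under eq_fun do rewrite tnth_insert_lift; rewrite tnth_insert_lift; exact: ut.
under eq_fun do rewrite tnth_insert; rewrite tnth_insert.
apply: cvgB; first exact: cvg_cst.
by apply: cvg_big => [|j _]; [exact: add_continuous|exact: ut].
Qed.

Lemma tsum_extend c (t : n.-tuple R) : tsum (extend c t) = c.
Proof. by rewrite tsum_insert subrK. Qed.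

Definition simplex_chart : set (n.-tuple R) := [set t | simplex (extend 1 t)].

Lemma simplex_chart_near u t : cvg_tuple u t -> simplex_chart t ->
  \forall N \near \oo, simplex_chart (u N).
Proof.
move=> /(cvg_tuple_extend (c := 1)) ut [t01 _].
have : \forall N \near \oo, forall i, 0 < tnth (extend 1 (u N)) i < 1.
  apply: filter_forall => i; have /andP[t0 t1] := t01 i.
  near=> N; apply/andP; split; near: N.
    exact: (cvgr_gt _ (ut i)).
  exact: (cvgr_lt _ (ut i)).
by apply: filterS => N uN; split => //; exact: tsum_extend.
Unshelve. all: by end_near. Qed.

Lemma measurable_extend c : measurable_fun [set: n.-tuple R] (extend c).
Proof.
apply: measurable_insert => //; apply: (@measurable_funB _ _ R) => //.
exact: measurable_tsum.
Qed.

Lemma measurable_simplex : measurable (simplex (m := n.+1) : set (n.+1.-tuple R)).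
Proof.
rewrite (_ : @simplex R n.+1 = [set p | forall i, `]0, 1[%classic (tnth p i)] `&`
  (@tsum R n.+1 @^-1` [set 1])).
  apply: measurableI; first by apply: (measurable_box (B := fun=> `]0, 1[%classic)).
  by rewrite -[X in measurable X]setTI; exact: measurable_tsum.
by apply/seteqP; split=> p [h1 h2]; split=> // i; have := h1 i; rewrite /= in_itv.
Qed.

Lemma measurable_simplex_chart : measurable simplex_chart.
Proof.
rewrite -[X in measurable X]setTI; apply: measurable_extend => //.
exact: measurable_simplex.
Qed.

End lower_bound.

(** * Averaging over small perturbations of the proportions *)

Section averaging.
Context {R : realType} (n : nat) {S : finType}.
Variables (b : S -> n.-tuple R -> 'I_n -> R) (M : R) (w : S -> n.-tuple R -> R).
Hypothesis mb : forall s i, measurable_fun [set: n.-tuple R] (b s ^~ i).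
Hypothesis mw : forall s, measurable_fun [set: n.-tuple R] (w s).
Hypothesis w0 : forall s t, 0 <= w s t.

(** Half-open, so that for each coordinate exactly one integer shift of a real number falls into it:
    the one given by [Num.ceil]. *)
Definition half_open_cube : set (n.-tuple R) :=
  [set t | forall i, `[0, 1[%classic (tnth t i)].

Lemma measurable_half_open_cube : measurable half_open_cube.
Proof. exact: (measurable_box (B := fun=> `[0, 1[%classic)). Qed.

Lemma leb_half_open_cube : leb n half_open_cube = 1%E.
Proof.
rewrite (leb_box (B := fun=> `[0, 1[%classic))// big1// => i _.
apply: (etrans (lebesgue_measure_itv `[0, 1[)).
by rewrite /= lte_fin ltr01 oppr0 adde0.
Qed.

Definition perturb (x th : n.-tuple R) : n.-tuple R :=
  tuple_add (fun i => tnth th i / M) x.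

Definition perturb_offset s (x a : n.-tuple R) : n.-tuple R := tuple_sub (b s x) a.

(* The weight [w s] is averaged over the displacements [th / M], and [a = b s x - th] is
   taken as variable: when [a] is fixed the sum over [s] has few terms and converges
   pointwise as [M] tends to infinity, whereas its integral does not depend on [M]. *)
Definition cell_average (z : n.-tuple R * n.-tuple R) : R :=
  \sum_s \1_half_open_cube (perturb_offset s z.1 z.2) *
    w s (perturb z.1 (perturb_offset s z.1 z.2)).

Let mperturb : measurable_fun [set: n.-tuple R * n.-tuple R]
  (fun z => perturb z.1 z.2).
Proof.
apply: measurable_mktuple => i; apply: (@measurable_funD _ _ R).
  exact: measurable_tnth_comp.
apply: (@measurable_funM _ _ R) => //.
exact: measurable_tnth_comp.
Qed.

Let moffset s : measurable_fun [set: n.-tuple R * n.-tuple R]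
  (fun z => perturb_offset s z.1 z.2).
Proof.
apply: measurable_mktuple => i; apply: (@measurable_funB _ _ R).
  exact: (measurableT_comp (mb s i)).
exact: measurable_tnth_comp.
Qed.

Let piece s (z : n.-tuple R * n.-tuple R) : R :=
  \1_half_open_cube z.2 * w s (perturb z.1 z.2).

Let piece0 s z : 0 <= piece s z.
Proof. by rewrite mulr_ge0// indicE ler0n. Qed.

Let mpiece s : measurable_fun [set: n.-tuple R * n.-tuple R] (piece s).
Proof.
apply: (@measurable_funM _ _ R); last exact: (measurableT_comp (mw s)).
have mI : measurable_fun [set: n.-tuple R] (\1_half_open_cube : _ -> R).
  by apply: measurable_indic; exact: measurable_half_open_cube.
exact: (measurableT_comp mI).
Qed.

Lemma measurable_cell_average :
  measurable_fun [set: n.-tuple R * n.-tuple R] cell_average.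
Proof.
apply: (@measurable_sum _ _ R) => s.
apply: (measurableT_comp (mpiece s) (g := fun z => (z.1, perturb_offset s z.1 z.2))).
exact: measurable_fun_pair.
Qed.

Lemma cell_average_ge0 z : 0 <= cell_average z.
Proof. by apply: sumr_ge0 => s _; rewrite mulr_ge0// indicE ler0n. Qed.

Local Open Scope ereal_scope.

(** For fixed [x], the reflection [th = b s x - a] is undone in each summand; for fixed [th], the
    point [x] is then translated by [th / M]. Both preserve Lebesgue measure, and the cube of the
    displacements [th] has volume 1. *)
Lemma integral_cell_average :
  \int[leb n \x leb n]_z (cell_average z)%:E =
  \int[leb n]_t (\sum_s w s t)%R%:E.
Proof.
have mE s : measurable_fun [set: n.-tuple R * n.-tuple R] (EFin \o piece s).
  exact/measurable_EFinP.
have mEx s x : measurable_fun [set: n.-tuple R] (fun th => (piece s (x, th))%:E).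
  by apply: (measurableT_comp (mE s) (g := fun th => (x, th))); exact: measurable_fun_pair.
rewrite fubini_tonelli1//=; last 2 first.
- by apply/measurable_EFinP; exact: measurable_cell_average.
- by move=> z; rewrite lee_fin cell_average_ge0.
transitivity (\int[leb n]_x \int[leb n]_th (\sum_s piece s (x, th))%R%:E).
  apply: eq_integral => x _; rewrite /fubini_F.
  under eq_integral do rewrite -sumEFin.
  under [RHS]eq_integral do rewrite -sumEFin.
  rewrite [RHS]ge0_integral_sum//; last by move=> s th _; rewrite lee_fin piece0.
  rewrite [LHS](@ge0_integral_sum _ _ _ _ _ measurableT _
      (fun s th => (piece s (x, perturb_offset s x th))%:E)); last 2 first.
  - move=> s; apply: (measurableT_comp (mEx s x) (g := perturb_offset s x)).
    exact: measurable_tuple_sub.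
  - by move=> s th _; rewrite lee_fin piece0.
  apply: eq_bigr => s _.
  by apply: (leb_reflect (b s x) (mEx s x)) => t; rewrite lee_fin piece0.
rewrite (fubini_tonelli (fun z => (\sum_s piece s z)%R%:E)); last 2 first.
- by apply/measurable_EFinP; exact: (@measurable_sum _ _ R).
- by move=> z; rewrite lee_fin; exact: sumr_ge0.
have mW : measurable_fun [set: n.-tuple R] (fun t => (\sum_s w s t)%R%:E).
  by apply/measurable_EFinP; exact: (@measurable_sum _ _ R).
have W0 t : 0 <= (\sum_s w s t)%R%:E by rewrite lee_fin sumr_ge0.
transitivity (\int[leb n]_th ((\1_half_open_cube th : R)%:E *
    \int[leb n]_t (\sum_s w s t)%R%:E)).
  apply: eq_integral => th _.
  transitivity (\int[leb n]_x ((\1_half_open_cube th : R)%:E *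
      (\sum_s w s (perturb x th))%R%:E)).
    by apply: eq_integral => x _; rewrite -EFinM mulr_sumr.
  rewrite ge0_integralZl//; last first.
    apply: (measurableT_comp mW (g := fun x => perturb x th)).
    exact: measurable_tuple_add.
  by congr (_ * _); exact: (leb_translate (fun i => tnth th i / M)%R mW).
rewrite ge0_integralZr//; last first.
- by apply: integral_ge0 => t _; exact: W0.
- apply/measurable_EFinP/measurable_indic; exact: measurable_half_open_cube.
rewrite integral_indic//; last exact: measurable_half_open_cube.
by rewrite setIT [X in X * _]leb_half_open_cube mul1e.
Qed.

End averaging.

(** * The pointwise lower bound at a fixed error *)

Section lower_limit.
Context {R : realType} (n : nat).
Variables (q : n.+1.-tuple R -> 'I_n.+1 -> R) (g kap : R) (F : n.+1.-tuple R -> R).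
Hypothesis q_gt0 : forall p, simplex p -> forall i, 0 < q p i.
Hypothesis q_sum : forall p, simplex p -> \sum_i q p i = 1.
Hypothesis q_cont : forall i, seq_continuous (q^~ i).
Hypothesis F_cont : seq_continuous F.
Hypothesis F_ge0 : forall x, 0 <= F x.
Variable D : set (n.-tuple R).
Hypothesis mD : measurable D.
Hypothesis D_simplex : D `<=` simplex_chart (n := n).
Hypothesis D_open : forall u t, cvg_tuple u t -> D t -> \forall N \near \oo, D (u N).

Let c := shift_constant n g kap.

(** This is the error of the first [n] seats at the proportions [x]. With [M = N + g], a
    displacement [th / M] moves the target by [th], so that after the displacement [th = b s x - a]
    the error is exactly [a]. *)
Let b N (s : {ffun 'I_n.+1 -> 'I_N.+1}) (x : n.-tuple R) (i : 'I_n) : R :=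
  (seats s (lift ord_max i))%:~R + kap - (N%:R + g) * tnth x i.

Let w N (s : {ffun 'I_n.+1 -> 'I_N.+1}) (t : n.-tuple R) : R :=
  \1_D t * \sum_j weight q g kap F N (seats s) j (extend 1 t).

Let avg N := cell_average (@b N) (N%:R + g) (@w N).

Section pointwise.
Variables (x a : n.-tuple R) (j : 'I_n.+1).
Hypothesis Dx : D x.
Hypothesis cell : strict_cell (q (extend 1 x)) j (tnth (extend c a)).

(** The only integers that put the offset in [half_open_cube]. Below, [pc] is the resulting
    perturbed point, and [sf] adds the last seat number, which is forced by the total. *)
Let sc N (i : 'I_n) : int := Num.ceil ((N%:R + g) * tnth x i + tnth a i - kap).

Let pc N : n.-tuple R :=
  [tuple ((sc N i)%:~R + kap - tnth a i) / (N%:R + g) | i < n].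

Let tnth_pc N i : tnth (pc N) i = ((sc N i)%:~R + kap - tnth a i) / (N%:R + g).
Proof. exact: tnth_mktuple. Qed.

Let sf N (i : 'I_n.+1) : int :=
  oapp (sc N) (N%:Z - \sum_k sc N k) (unlift ord_max i).

Let sf_sum N : \sum_i sf N i = N%:Z.
Proof.
rewrite (bigD1_ord ord_max)//= /sf unlift_none/=.
by under [X in _ + X]eq_bigr do rewrite liftK; rewrite subrK.
Qed.

Let denominator_gt0 : \forall N \near \oo, 0 < N%:R + g :> R.
Proof.
near=> N; rewrite -ltrBlDr sub0r; near: N; exact: nbhs_infty_gtr.
Unshelve. all: by end_near. Qed.

Let ceil_cell N i :
  0 <= (sc N i)%:~R + kap - tnth a i - (N%:R + g) * tnth x i < 1.
Proof.
by have := ceil_itv ((N%:R + g) * tnth x i + tnth a i - kap); rewrite -/(sc N i) intrB; lra.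
Qed.

Let cvg_pc : cvg_tuple pc x.
Proof.
move=> i.
(* The displacement is at most [1 / (N + g)], hence at most [2 / (N + 1)] as soon as
   [N > 1 - 2 * g]. *)
apply: (@squeeze_cvgr _ _ _ _ (fun=> tnth x i) (fun N => tnth x i + 2 * N.+1%:R^-1)).
- near=> N; rewrite tnth_mktuple.
  have N0 : 0 < N%:R + g by near: N; exact: denominator_gt0.
  have /andP[h0 h1] := ceil_cell N i.
  rewrite ler_pdivlMr// ler_pdivrMr//; apply/andP; split; first by rewrite mulrC; lra.
  have N1 : (0 : R) < N.+1%:R by [].
  have h2 : 1 <= 2 * N.+1%:R^-1 * (N%:R + g).
    rewrite mulrAC -(ler_pM2r N1) divfK ?gt_eqF// mul1r.
    have : 1 - 2 * g < N%:R by near: N; exact: nbhs_infty_gtr.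
    rewrite -natr1; lra.
  rewrite mulrDl [tnth x i * _]mulrC.
  by apply: le_trans (lerD (lexx _) h2); rewrite -lerBlDl; exact: ltW.
- exact: cvg_cst.
- rewrite -[X in _ --> X]addr0; apply: cvgD; first exact: cvg_cst.
  by rewrite -[X in _ --> X](mulr0 2); apply: cvgMr; exact: cvg_harmonic.
Unshelve. all: by end_near. Qed.

Let ph N := extend 1 (pc N).

Let cvg_ph : cvg_tuple ph (extend 1 x).
Proof. exact: cvg_tuple_extend. Qed.

Let error_const N : 0 < N%:R + g ->
  forall i, (sf N i)%:~R - target g kap N (ph N) i = tnth (extend c a) i.
Proof.
move=> N0 i; have Nn0 : N%:R + g != 0 by rewrite gt_eqF.
rewrite /target /ph; case: (unliftP ord_max i) => [k|] ->.
  rewrite !tnth_insert_lift /sf liftK/= tnth_pc mulrC divfK//; ring.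
rewrite !tnth_insert /sf unlift_none/=.
have -> : \sum_k tnth (pc N) k =
    (\sum_k (sc N k)%:~R + n%:R * kap - \sum_k tnth a k) / (N%:R + g).
  under eq_bigr do rewrite tnth_pc; rewrite -mulr_suml sumrB big_split/=.
  by rewrite sumr_const card_ord mulr_natl.
rewrite mulrBr mulr1 [X in _ - (_ - X - _)]mulrC divfK//.
rewrite intrB raddf_sum/= /c /shift_constant -[n.+1%:R]natr1; ring.
Qed.

Let cell_near : \forall N \near \oo, strict_cell (q (ph N)) j (tnth (extend c a)).
Proof.
set e := tnth (extend c a).
have : \forall N \near \oo, forall i, (i != j) ==>
    (0 < q (ph N) i * e j - q (ph N) j * e i < q (ph N) j).
  apply: filter_forall => i; case: (boolP (i != j)) => ij; last exact: nearW.
  have /forallP/(_ i) := cell; rewrite ij /= -/e => /andP[e0 e1].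
  have qi k : q (ph N) k @[N --> \oo] --> q (extend 1 x) k by exact: q_cont cvg_ph.
  have qe : q (ph N) i * e j - q (ph N) j * e i @[N --> \oo] -->
      q (extend 1 x) i * e j - q (extend 1 x) j * e i.
    by apply: cvgB; apply: cvgMl; exact: qi.
  near=> N; apply/andP; split; near: N; first exact: (cvgr_gt _ qe).
  under eq_near do rewrite -subr_gt0.
  by apply: (cvgr_gt (q (extend 1 x) j - (q (extend 1 x) i * e j - q (extend 1 x) j * e i)));
    [exact: cvgB|rewrite subr_gt0].
by apply: filterS => N h; apply/forallP.
Unshelve. all: by end_near. Qed.

Let sf_ge0_near : \forall N \near \oo, forall i, 0 <= sf N i.
Proof.
apply: filter_forall => i.
have [x01 _] := D_simplex Dx; have /andP[x0 _] := x01 i.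
set d := tnth (extend 1 x) i in x0.
near=> N.
have N0 : 0 < N%:R + g by near: N; exact: denominator_gt0.
have := error_const N0 i; rewrite /target => /eqP; rewrite subr_eq => /eqP sfE.
rewrite -(ler0z R) sfE.
(* Half of the positive limit [d] is a safe margin: the target then exceeds
   [(N + g) * (d / 2) - kap], which tends to infinity and absorbs the fixed error. *)
have p_gt : d / 2 < tnth (ph N) i.
  near: N; have phi : tnth (ph N) i @[N --> \oo] --> d by exact: cvg_ph.
  by apply: (cvgr_gt _ phi); lra.
have M_gt : (kap - tnth (extend c a) i) / (d / 2) - g < N%:R.
  by near: N; exact: nbhs_infty_gtr.
have d0 : 0 < d / 2 by rewrite divr_gt0.
have : kap - tnth (extend c a) i < (N%:R + g) * (d / 2).
  by rewrite -ltr_pdivrMr// -ltrBlDr.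
have : (N%:R + g) * (d / 2) < (N%:R + g) * tnth (ph N) i by rewrite ltr_pM2l.
lra.
Unshelve. all: by end_near. Qed.

Let perturb_pc N s : 0 < N%:R + g -> seats s = sf N ->
  perturb (N%:R + g) x (perturb_offset (@b N) s x a) = pc N.
Proof.
move=> N0 sE; apply: eq_from_tnth => i; rewrite !tnth_mktuple /b sE /sf liftK/=.
by field; rewrite gt_eqF.
Qed.

Let offset_cube N s : seats s = sf N -> half_open_cube (perturb_offset (@b N) s x a).
Proof.
move=> sE i; rewrite /= tnth_mktuple in_itv/= /b sE /sf liftK/=.
by have := ceil_cell N i; lra.
Qed.

Let err_limit N : 0 < N%:R + g ->
  err N (ph N) (sf N) = limit_err g kap (ph N) (extend c a).
Proof.
move=> N0; apply: eq_from_tnth => i.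
rewrite [LHS]tnth_mktuple [RHS]tnth_mktuple -(error_const N0 i) /target; ring.
Qed.

Let sf_lift N : (forall i, 0 <= sf N i) ->
  exists s : {ffun 'I_n.+1 -> 'I_N.+1}, seats s = sf N.
Proof.
move=> sf0; have sfN i : sf N i <= N%:Z.
  by rewrite -(sf_sum N) (bigD1 i)//= lerDl sumr_ge0.
exists [ffun i => inord `|sf N i|%N].
apply/funext => i; rewrite /seats ffunE inordK; last by have := sfN i; have := sf0 i; lia.
by rewrite gez0_abs.
Qed.

(** All summands but that of [sf N] and [j] are dropped, being nonnegative. The one that is kept is
    [F] at the error [extend c a] carried to the perturbed proportions, which converge to
    [extend 1 x]. *)
Lemma cell_average_lower :
  exists v : nat -> R,
    v N @[N --> \oo] --> F (limit_err g kap (extend 1 x) (extend c a)) /\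
    \forall N \near \oo, v N <= avg N (x, a).
Proof.
exists (fun N => F (limit_err g kap (ph N) (extend c a))); split.
  apply: F_cont => i; under eq_fun do rewrite tnth_mktuple; rewrite tnth_mktuple.
  apply: cvgB; last exact: cvg_cst.
  by apply: cvgD; [exact: cvg_cst|apply: cvgMr; exact: cvg_ph].
near=> N.
have N0 : 0 < N%:R + g by near: N; exact: denominator_gt0.
have e_err := error_const N0.
have DN : D (pc N) by near: N; exact: D_open cvg_pc Dx.
have cellN : strict_cell (q (ph N)) j (tnth (extend c a)) by near: N; exact: cell_near.
have sf0 : forall i, 0 <= sf N i by near: N; exact: sf_ge0_near.
have [s sE] := sf_lift sf0.
rewrite /avg /cell_average (bigD1 s)//=.
rewrite -[leLHS]addr0 lerD//; last first.
  apply: sumr_ge0 => s' _; rewrite mulr_ge0// ?indicE// mulr_ge0// ?indicE//.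
  by apply: sumr_ge0 => i _; exact: weight_ge0.
rewrite perturb_pc// /w !indicE mem_set ?mul1r; last exact: offset_cube.
rewrite mem_set// mul1r (bigD1 j)//= sE -[leLHS]addr0 lerD//; last first.
  by apply: sumr_ge0 => i _; exact: weight_ge0.
rewrite /weight ifT; last first.
  apply/and3P; split; [by rewrite sf_sum|exact/forallP|].
  rewrite (_ : (fun i => _) = tnth (extend c a))//.
  by apply/funext => i; exact: e_err.
by rewrite err_limit.
Unshelve. all: by end_near. Qed.

End pointwise.
End lower_limit.

Lemma le_limn_einf {R : realType} (u v : nat -> R) (l : R) :
  v N @[N --> \oo] --> l -> (\forall N \near \oo, v N <= u N) ->
  (l%:E <= limn_einf (fun N => (u N)%:E))%E.
Proof.
move=> vl vu; rewrite limn_einf_lim; apply/lee_addgt0Pr => e e0.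
rewrite -leeBlDr// -EFinB; apply: lime_ge; first exact: is_cvg_einfs.
have [K _ uK] : \forall N \near \oo, l - e <= u N.
  near=> N; apply: (@le_trans _ _ (v N)); last by near: N.
  by apply: ltW; near: N; apply: (cvgr_gt _ vl); rewrite ltrBlDr ltrDl.
exists K => // N /= KN; apply: le_ereal_inf_tmp => _ [k /= Nk <-].
by rewrite lee_fin; apply: uK => /=; exact: leq_trans Nk.
Unshelve. all: by end_near. Qed.

Lemma measurable_fun_limn_einf {d} {T : measurableType d} {R : realType}
    (f : nat -> T -> \bar R) : (forall N, measurable_fun [set: T] (f N)) ->
  measurable_fun [set: T] (fun x => limn_einf (f^~ x)).
Proof.
move=> mf; rewrite /limn_einf; apply: measurableT_comp => //.
apply: (@measurable_fun_limn_esup _ _ _ _ (fun N x => - f N x)%E) => N.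
exact: measurableT_comp.
Qed.

Section limit_functional.
Context {R : realType} (n : nat).
Local Open Scope ereal_scope.

Definition open_cube : set (n.-tuple R) := [set t | forall i, `]0%R, 1%R[%classic (tnth t i)].

Lemma measurable_open_cube : measurable open_cube.
Proof. exact: (measurable_box (B := fun=> `]0%R, 1%R[%classic)). Qed.

Lemma leb_open_cube : leb n open_cube = 1%E.
Proof.
rewrite (leb_box (B := fun=> `]0%R, 1%R[%classic))// big1// => i _.
apply: (etrans (lebesgue_measure_itv `]0%R, 1%R[)).
by rewrite /= lte_fin ltr01 oppr0 adde0.
Qed.

Definition cube_integral (f : n.-tuple R -> \bar R) : \bar R :=
  \int[leb n]_U ((\1_open_cube U : R)%:E * f U).

End limit_functional.

Section cell_volume.
Context {R : realType} (n : nat).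
Local Open Scope ereal_scope.
Variables (q : 'I_n.+1 -> R) (c : R) (f : n.+1.-tuple R -> \bar R) (j : 'I_n.+1).
Hypothesis q1 : (\sum_i q i = 1)%R.
Hypothesis qj : (0 < q j)%R.
Hypothesis mf : measurable_fun [set: n.+1.-tuple R] f.
Hypothesis f0 : forall t, 0 <= f t.

(** At an exit point [q i * e j - q j * e i] equals [q j * tnth U i] for [i != j]: the quantities
    bounded in [strict_cell] are the coordinates on the face, scaled by [q j]. *)
Lemma strict_cell_exit (U : n.+1.-tuple R) :
  strict_cell q j (tnth (flow_exit q c j U)) <->
  forall i, i != j -> (0 < tnth U i < 1)%R.
Proof.
have E i : i != j -> (q i * tnth (flow_exit q c j U) j - q j * tnth (flow_exit q c j U) i
    = q j * tnth U i)%R.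
  by move=> ij; rewrite !tnth_flow_exit eqxx (negbTE ij); ring.
split=> [/forallP h i ij|h].
  by have := h i; rewrite ij /= E// pmulr_rgt0// gtr_pMr//.
apply/forallP => i; apply/implyP => ij.
by rewrite E// pmulr_rgt0// gtr_pMr//; exact: h.
Qed.

(** This is [leb_extend_exit] for [f] cut off outside the cell: the cell confines the coordinates
    other than [j] to the unit interval, and [ind01] does the same for the coordinate [j]. *)
Lemma leb_cell_volume :
  \int[leb n]_a (if strict_cell q j (tnth (extend c a)) then f (extend c a) else 0) =
  (q j)%:E * cube_integral (fun U => f (flow_exit q c j U)).
Proof.
pose h e := if strict_cell q j (tnth e) then f e else 0.
have mh : measurable_fun [set: n.+1.-tuple R] h.
  apply: measurable_fun_ifT => //; apply: measurable_strict_cell => i //.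
  exact: measurable_tnth.
have h0 e : 0 <= h e by rewrite /h; case: ifP.
rewrite -[LHS]/(\int[leb n]_a h (extend c a)) (leb_extend_exit _ q1 mh h0 qj).
congr (_ * _); apply: eq_integral => U _.
rewrite /h; case: ifPn => cell.
  move/strict_cell_exit : cell => cell.
  congr (_%:E * _); rewrite !indicE; congr ((nat_of_bool _)%:R); apply/idP/idP.
    move=> /set_mem Uj; apply/mem_set => i /=; have [->//|ij] := eqVneq i j.
    by rewrite in_itv/=; exact: cell.
  by move=> /set_mem/(_ j) Uj; exact/mem_set.
rewrite mule0 indicE (_ : _ \in _ = false) ?mul0e//; apply/negbTE.
apply: contra cell => /set_mem Uc; apply/strict_cell_exit => i _.
by have := Uc i; rewrite /= in_itv.
Qed.

End cell_volume.

Section fatou_lower_limit.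
Context {R : realType} (n : nat).
Variables (q : n.+1.-tuple R -> 'I_n.+1 -> R) (g kap : R) (F : n.+1.-tuple R -> R).
Hypothesis q_gt0 : forall p, simplex p -> forall i, 0 < q p i.
Hypothesis q_sum : forall p, simplex p -> \sum_i q p i = 1.
Hypothesis q_cont : forall i, seq_continuous (q^~ i).
Hypothesis F_cont : seq_continuous F.
Hypothesis F_ge0 : forall x, 0 <= F x.
Local Open Scope ereal_scope.

Let c := shift_constant n g kap.

(* The cell [j] has volume [q p j], and [flow_exit] maps the uniform law of the cube to
   the uniform law of the cell. *)
Definition limit_mean (p : n.+1.-tuple R) : \bar R :=
  \sum_j (q p j)%:E *
    cube_integral (fun U => (F (limit_err g kap p (flow_exit (q p) c j U)))%:E).

Variable D : set (n.-tuple R).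
Hypothesis mD : measurable D.
Hypothesis D_simplex : D `<=` simplex_chart (n := n).
Hypothesis D_open : forall u t, cvg_tuple u t -> D t -> \forall N \near \oo, D (u N).

Let cell_term j (z : n.-tuple R * n.-tuple R) : R :=
  if strict_cell (q (extend 1 z.1)) j (tnth (extend c z.2))
  then F (limit_err g kap (extend 1 z.1) (extend c z.2)) else 0%R.

Let cell_term0 j z : (0 <= cell_term j z)%R.
Proof. by rewrite /cell_term; case: ifP. Qed.

Let mcell_term j : measurable_fun [set: n.-tuple R * n.-tuple R] (cell_term j).
Proof.
have m1 : measurable_fun [set: n.-tuple R * n.-tuple R] (fun z => extend 1%R z.1).
  exact: (measurableT_comp (@measurable_extend _ _ _)).
have m2 : measurable_fun [set: n.-tuple R * n.-tuple R] (fun z => extend c z.2).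
  exact: (measurableT_comp (@measurable_extend _ _ _)).
apply: measurable_fun_ifT => //.
  apply: measurable_strict_cell => i; last exact: measurable_tnth_comp.
  exact: (measurableT_comp (seq_continuous_measurable (@q_cont i)) m1).
apply: (measurableT_comp (seq_continuous_measurable F_cont)).
apply: measurable_mktuple => i.
apply: (@measurable_funB _ _ R) => //; apply: (@measurable_funD _ _ R) => //.
  exact: measurable_tnth_comp.
by apply: (@measurable_funM _ _ R) => //; exact: measurable_tnth_comp.
Qed.

Let limit_term (z : n.-tuple R * n.-tuple R) : R := (\1_D z.1 * \sum_j cell_term j z)%R.

(** Fatou's lemma over pairs of a proportion vector and an error. On the right,
    [integral_cell_average] removes the averaging; on the left, integrating out the error gives
    [limit_mean] by [leb_cell_volume]. Since the cells are disjoint, at most one [j] contributes at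
    each point. *)
Lemma lower_limit :
  \int[leb n]_x ((\1_D x : R)%:E * limit_mean (extend 1 x)) <=
  limn_einf (fun N => \int[leb n]_x
    (\1_D x * total_weight q g kap F N (extend 1 x))%:E).
Proof.
pose b N (s : {ffun 'I_n.+1 -> 'I_N.+1}) (x : n.-tuple R) (i : 'I_n) : R :=
  ((seats s (lift ord_max i))%:~R + kap - (N%:R + g) * tnth x i)%R.
pose w N (s : {ffun 'I_n.+1 -> 'I_N.+1}) (t : n.-tuple R) : R :=
  (\1_D t * \sum_j weight q g kap F N (seats s) j (extend 1 t))%R.
pose avg N := cell_average (@b N) (N%:R + g) (@w N).
have mID : measurable_fun [set: n.-tuple R] (\1_D : _ -> R) by exact: measurable_indic.
have mb N s i : measurable_fun [set: n.-tuple R] (@b N s ^~ i).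
  apply: (@measurable_funB _ _ R) => //; apply: (@measurable_funM _ _ R) => //.
  exact: measurable_tnth.
have mw N s : measurable_fun [set: n.-tuple R] (@w N s).
  apply: (@measurable_funM _ _ R) => //; apply: (@measurable_sum _ _ R) => j.
  apply: measurableT_comp (@measurable_extend _ _ _).
  exact: measurable_weight.
have w0 N s t : (0 <= @w N s t)%R.
  by rewrite mulr_ge0// ?indicE// sumr_ge0// => j _; exact: weight_ge0.
have mterm : measurable_fun [set: n.-tuple R * n.-tuple R] limit_term.
  apply: (@measurable_funM _ _ R); first exact: (measurableT_comp mID).
  exact: (@measurable_sum _ _ R).
have term0 z : (0 <= limit_term z)%R.
  by rewrite mulr_ge0// ?indicE// sumr_ge0.
have -> : (fun N => \int[leb n]_x (\1_D x * total_weight q g kap F N (extend 1 x))%:E) =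
    (fun N => \int[leb n \x leb n]_z (avg N z)%:E).
  apply/funext => N; rewrite integral_cell_average//.
  by apply: eq_integral => x _; rewrite /total_weight mulr_sumr.
apply: le_trans (fatou (leb n \x leb n) measurableT _ _); last 2 first.
- by move=> N; apply/measurable_EFinP; exact: measurable_cell_average.
- by move=> N z _; rewrite lee_fin; exact: cell_average_ge0.
apply: (@le_trans _ _ (\int[leb n \x leb n]_z (limit_term z)%:E)).
  rewrite fubini_tonelli1//; last exact/measurable_EFinP.
  rewrite le_eqVlt; apply/orP; left; apply/eqP/eq_integral => x _.
  rewrite /fubini_F /limit_term/= indicE; case: (boolP (x \in D)) => [/set_mem Dx|_]; last first.
    by rewrite mul0e integral0_eq// => a _; rewrite mul0r.
  rewrite mul1e; under [RHS]eq_integral do rewrite mul1r -sumEFin.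
  have mx j : measurable_fun [set: n.-tuple R] (fun a => (cell_term j (x, a))%:E).
    apply/measurable_EFinP; apply: (measurableT_comp (mcell_term j) (g := fun a => (x, a))).
    exact: measurable_fun_pair.
  rewrite ge0_integral_sum//; last by move=> j a _; rewrite lee_fin.
  apply: eq_bigr => j _.
  have sx := D_simplex Dx.
  pose f e := (F (limit_err g kap (extend 1%R x) e))%:E.
  rewrite -(leb_cell_volume (f := f) _ (q_sum sx) (q_gt0 sx j)).
  - by apply: eq_integral => a _; rewrite /cell_term/=; case: ifP.
  - apply/measurable_EFinP/(measurableT_comp (seq_continuous_measurable F_cont)).
    apply: measurable_mktuple => i.
    apply: (@measurable_funB _ _ R) => //; apply: (@measurable_funD _ _ R) => //.
    exact: measurable_tnth.
  - by move=> e; rewrite lee_fin.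
apply: ge0_le_integral => //.
- by move=> z _; rewrite lee_fin.
- exact/measurable_EFinP.
- apply: measurable_fun_limn_einf => N; apply/measurable_EFinP.
  exact: measurable_cell_average.
move=> [x a] _; rewrite /limit_term/= indicE.
have avg0 : 0 <= limn_einf (fun N => (avg N (x, a))%:E).
  apply: (@le_limn_einf _ _ (fun=> 0%R)); first exact: cvg_cst.
  by apply: nearW => N; exact: cell_average_ge0.
case: (boolP (x \in D)) => [/set_mem Dx|_]; last by rewrite mul0r.
rewrite mul1r; have [[j cellj]|nocell] := pselect (exists j,
    strict_cell (q (extend 1%R x)) j (tnth (extend c a))); last first.
  rewrite big1// => j _; rewrite /cell_term/= ifN//.
  by apply/negP => cellj; apply: nocell; exists j.
rewrite (bigD1 j)//= big1 ?addr0; last first.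
  move=> k kj; rewrite /cell_term/= ifN//; apply: contra kj => cellk.
  exact/eqP/(strict_cell_inj cellk cellj).
rewrite /cell_term/= cellj.
have [v [vl vavg]] := cell_average_lower q_cont F_cont F_ge0 D_simplex D_open Dx cellj.
exact: le_limn_einf vl vavg.
Qed.

End fatou_lower_limit.

(** * From lower limits to convergence, for absolutely continuous laws *)

Section density_measure.
Context {R : realType} {d} {T : measurableType d}.
Local Open Scope ereal_scope.
Variables (mu : {measure set T -> \bar R}) (f : T -> R).

(** The proofs [mf] and [f0] are arguments so that the measure structure can be attached to
    [density mf f0]. *)
Definition density (mf : measurable_fun [set: T] f) (f0 : forall x, (0 <= f x)%R)
  (A : set T) : \bar R := \int[mu]_(x in A) (f x)%:E.

Hypothesis mf : measurable_fun [set: T] f.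
Hypothesis f0 : forall x, (0 <= f x)%R.

Let mEf : measurable_fun [set: T] (EFin \o f). Proof. exact/measurable_EFinP. Qed.

Let density_set0 : density mf f0 set0 = 0.
Proof. by rewrite /density integral_set0. Qed.

Let density_ge0 A : 0 <= density mf f0 A.
Proof. by apply: integral_ge0 => x _; rewrite lee_fin. Qed.

Let density_sigma_additive : semi_sigma_additive (density mf f0).
Proof.
move=> /= G mG tG mUG; rewrite /density; apply: cvg_toP.
  apply: ereal_nondecreasing_is_cvgn => m n mn.
  apply: lee_sum_nneg_natr => // k _ _.
  by apply: integral_ge0 => x _; rewrite lee_fin.
rewrite ge0_integral_bigcup//=; first exact: measurable_funTS.
by move=> x _; rewrite lee_fin.
Qed.

HB.instance Definition _ := isMeasure.Build _ _ _ (density mf f0)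
  density_set0 density_ge0 density_sigma_additive.

Lemma densityE A : density mf f0 A = \int[mu]_x ((\1_A x : R) * f x)%:E.
Proof.
rewrite /density integral_mkcond; apply: eq_integral => x _.
by rewrite patchE indicE; case: ifPn; rewrite ?mul1r ?mul0r.
Qed.

Import HBNNSimple.

Let integral_nnsfun_density (h : {nnsfun T >-> R}) :
  \int[density mf f0]_x (h x)%:E = \int[mu]_x ((h x)%:E * (f x)%:E).
Proof.
have mh r : measurable (h @^-1` [set r]) by [].
have mI r : measurable_fun [set: T] (\1_(h @^-1` [set r]) : T -> R).
  exact: measurable_indic.
transitivity (\sum_(r \in range h) \int[mu]_x (r * (\1_(h @^-1` [set r]) x * f x))%:E).
  under [LHS]eq_integral do rewrite fimfunE -fsumEFin//.
  rewrite [LHS]ge0_integral_fsum//; last 2 first.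
  - by move=> r; apply/measurable_EFinP; apply: (@measurable_funM _ _ R) => //.
  - by move=> r x _; rewrite EFinM nnfun_muleindic_ge0.
  apply: eq_fsbigr => r /set_mem [y _ <-].
  under eq_integral do rewrite EFinM.
  under [RHS]eq_integral do rewrite EFinM.
  rewrite !ge0_integralZl ?lee_fin//.
  - by rewrite integral_indic// setIT -densityE.
  - by apply/measurable_EFinP; exact: (@measurable_funM _ _ R).
  - by move=> x _; rewrite lee_fin mulr_ge0// indicE ler0n.
  - exact/measurable_EFinP.
have E r x : (r * \1_(h @^-1` [set r]) x * f x)%:E =
    (r * (\1_(h @^-1` [set r]) x * f x))%:E by rewrite mulrA.
transitivity (\int[mu]_x \sum_(r \in range h)
    (r * (\1_(h @^-1` [set r]) x * f x))%:E).
  rewrite ge0_integral_fsum//.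
  - move=> r; apply/measurable_EFinP; apply: (@measurable_funM _ _ R) => //.
    exact: (@measurable_funM _ _ R).
  - move=> r x _; rewrite -E EFinM; apply: mule_ge0; last by rewrite lee_fin.
    by rewrite EFinM; exact: nnfun_muleindic_ge0.
apply: eq_integral => x _; rewrite fimfunE -fsumEFin// ge0_mule_fsuml//; last first.
  by move=> r; rewrite EFinM; exact: nnfun_muleindic_ge0.
by apply: eq_fsbigr => r _; rewrite -E EFinM.
Qed.

Lemma ge0_integral_density (h : T -> \bar R) :
  measurable_fun [set: T] h -> (forall x, 0 <= h x) ->
  \int[density mf f0]_x h x = \int[mu]_x (h x * (f x)%:E).
Proof.
move=> mh h0; pose h_ := nnsfun_approx measurableT mh.
transitivity (lim (\int[density mf f0]_x (h_ k x)%:E @[k --> \oo])).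
  rewrite -monotone_convergence//=.
  - apply: eq_integral => x _; apply/esym/cvg_lim => //.
    by apply: cvg_nnsfun_approx.
  - by move=> k; exact/measurable_EFinP/measurable_funTS.
  - by move=> k x _; rewrite lee_fin.
  - by move=> x _ a b ab; rewrite lee_fin; exact/lefP/nd_nnsfun_approx.
transitivity (lim (\int[mu]_x ((h_ k x)%:E * (f x)%:E) @[k --> \oo])).
  by apply: congr_lim; apply/funext => k; exact: integral_nnsfun_density.
rewrite -monotone_convergence//=.
- apply: eq_integral => x _; apply/cvg_lim => //; apply: cvgeZr => //.
  exact: cvg_nnsfun_approx.
- by move=> k; apply: emeasurable_funM => //; exact/measurable_EFinP/measurable_funTS.
- by move=> k x _; rewrite mule_ge0// lee_fin.
- by move=> x _ a b ab; apply: lee_wpmul2r; rewrite lee_fin//; exact/lefP/nd_nnsfun_approx.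
Qed.

End density_measure.

Section setwise_convergence.
Import HBNNSimple.
Context {R : realType} {d} {T : measurableType d}.
Local Open Scope ereal_scope.
Variables (nu : nat -> {measure set T -> \bar R}) (mu la : {measure set T -> \bar R}).

(** The sets on which the masses converge form a Dynkin system. Complements rely on finite masses;
    for a disjoint union, the masses of the pieces are integrated against the counting measure, with
    [la] as the dominating function. *)
Lemma setwise_cvg_dynkin (G : set (set T)) :
  measurable = <<s G >> -> setI_closed G -> G setT -> la setT < +oo ->
  (forall N A, measurable A -> nu N A <= la A) ->
  (forall A, measurable A -> mu A <= la A) ->
  (forall A, G A -> nu N A @[N --> \oo] --> mu A) ->
  forall A, measurable A -> nu N A @[N --> \oo] --> mu A.
Proof.
move=> GE GI GT laT nula mula Gcvg A mA.
have lafin B : measurable B -> la B < +oo.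
  move=> mB; apply: le_lt_trans laT; apply: le_measure; rewrite ?inE//.
have nufin N B : measurable B -> nu N B \is a fin_num.
  move=> mB; rewrite ge0_fin_numE//; apply: le_lt_trans (lafin _ mB); exact: nula.
have mufin B : measurable B -> mu B \is a fin_num.
  move=> mB; rewrite ge0_fin_numE//; apply: le_lt_trans (lafin _ mB); exact: mula.
have sGA : <<s G >> A by rewrite -GE.
apply: (dynkin_induction (P := fun A => nu N A @[N --> \oo] --> mu A) GE GI) sGA => //.
- exact: Gcvg.
- have setCE (m : {measure set T -> \bar R}) B : measurable B ->
      m setT \is a fin_num -> m (~` B) = m setT - m B.
    move=> mB mT; rewrite -setTD measureD ?setTI//.
    by rewrite -ge0_fin_numE.
  move=> B mB nuB; rewrite setCE ?mufin//.
  rewrite (_ : (fun N => _) = (fun N => nu N setT - nu N B)); last first.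
    by apply/funext => N; rewrite setCE ?nufin.
  apply: cvgeB => //; last exact: Gcvg.
  by rewrite fin_num_adde_defr// mufin.
move=> B mB tB nuB; have mU : measurable (\bigcup_k B k) by exact: bigcup_measurable.
have seriesE (m : {measure set T -> \bar R}) : m (\bigcup_k B k) = \int[counting]_k m (B k).
  by rewrite ge0_integral_count// measure_bigcup// ; apply: eq_eseriesl => k /=; rewrite in_setT.
rewrite seriesE; under eq_fun do rewrite seriesE.
apply: (@dominated_cvg _ _ _ counting setT measurableT (fun N k => nu N (B k)) _ (fun k => la (B k))) => //.
- by move=> k _; rewrite ge0_fin_numE// lafin.
- apply/integrableP; split => //.
  under eq_integral do rewrite gee0_abs//.
  by rewrite -seriesE lafin.
- by move=> N k _; rewrite gee0_abs//; exact: nula.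
Qed.

(** Fatou's lemma for varying measures. The integral of a simple function below [rho] converges, as
    a finite combination of masses, and bounds the lower limit; monotone convergence then recovers
    [rho]. As [rho] may be unbounded, only a lower limit is claimed. *)
Lemma setwise_cvg_liminf (rho : T -> \bar R) :
  (forall A, measurable A -> nu N A @[N --> \oo] --> mu A) ->
  measurable_fun [set: T] rho -> (forall x, 0 <= rho x) ->
  \int[mu]_x rho x <= limn_einf (fun N => \int[nu N]_x rho x).
Proof.
move=> nucvg mrho rho0; pose h := nnsfun_approx measurableT mrho.
have hrho k x : (h k x)%:E <= rho x.
  have hx : (h j x)%:E @[j --> \oo] --> rho x by exact: cvg_nnsfun_approx.
  have nd : nondecreasing_seq (fun j => (h j x)%:E).
    by move=> a b ab; rewrite lee_fin; exact/lefP/nd_nnsfun_approx.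
  rewrite -(cvg_lim _ hx)// (cvg_lim _ (ereal_nondecreasing_cvgn nd))//.
  by apply: ereal_sup_ubound; exists k.
have hcvg k : \int[nu N]_x (h k x)%:E @[N --> \oo] --> \int[mu]_x (h k x)%:E.
  have hE (m : {measure set T -> \bar R}) : \int[m]_x (h k x)%:E =
      (\sum_(r <- finmap.enum_fset (fset_set (range (h k)))) r%:E * m (h k @^-1` [set r]))%E.
    by rewrite integralT_nnsfun sintegralE fsbig_finite.
  rewrite hE; under eq_fun do rewrite hE.
  apply: cvg_nnesum => r _.
    (* A nonnegative function has an empty fibre over a negative [r], so every term of the sum is
       nonnegative. *)
    apply: nearW => N; have [r0|r0] := leP 0%R r; first by rewrite mule_ge0// lee_fin.
    by rewrite preimage_nnfun0// measure0 mule0.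
  by apply: cvgeZl => //; exact: nucvg.
have -> : \int[mu]_x rho x = lim (\int[mu]_x (h k x)%:E @[k --> \oo]).
  rewrite -monotone_convergence//=.
  - apply: eq_integral => x _; apply/esym/cvg_lim => //.
    by apply: cvg_nnsfun_approx.
  - by move=> k; exact/measurable_EFinP/measurable_funTS.
  - by move=> k x _; rewrite lee_fin.
  - by move=> x _ a b ab; rewrite lee_fin; exact/lefP/nd_nnsfun_approx.
apply: lime_le.
  apply: ereal_nondecreasing_is_cvgn => a b ab; apply: ge0_le_integral => //.
  - by move=> x _; rewrite lee_fin.
  - exact/measurable_EFinP.
  - exact/measurable_EFinP.
  - by move=> x _; rewrite lee_fin; exact/lefP/nd_nnsfun_approx.
apply: nearW => k; rewrite -(cvg_lim _ (hcvg k))// -is_cvg_limn_einfE; last first.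
  by apply/cvg_ex; eexists; exact: hcvg.
rewrite !limn_einf_lim; apply: lee_lim; [exact: is_cvg_einfs..|].
apply: nearW => N; apply: le_ereal_inf_tmp => _ [j /= Nj <-].
apply: (@le_trans _ _ (\int[nu j]_x (h k x)%:E)).
  by apply: ereal_inf_lbound; exists j.
apply: ge0_le_integral => //; first by move=> x _; rewrite lee_fin.
exact/measurable_EFinP.
Qed.

End setwise_convergence.

Lemma limn_einf_mono {R : realType} (u v : nat -> \bar R) :
  (\forall N \near \oo, (u N <= v N)%E) -> (limn_einf u <= limn_einf v)%E.
Proof.
move=> [K _ uv]; rewrite !limn_einf_lim; apply: lee_lim; [exact: is_cvg_einfs..|].
exists K => // N /= KN; apply: le_ereal_inf_tmp => _ [j /= Nj <-].
apply: (@le_trans _ _ (u j)); first by apply: ereal_inf_lbound; exists j.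
by apply: uv => /=; exact: leq_trans Nj.
Qed.

Lemma lt_limn_einf {R : realType} (u : nat -> \bar R) x :
  (x < limn_einf u)%E -> \forall N \near \oo, (x < u N)%E.
Proof.
rewrite limn_einf_lim.
have /cvg_lim -> // := @cvg_einfs_sup _ u.
move=> /ereal_sup_gt[_ [K _ <-] xK]; exists K => // N /= KN.
by apply: lt_le_trans xK _; apply: ereal_inf_lbound; exists N.
Qed.

(* Applied to [F] and [M - F]: the two Fatou lower bounds add up to the total mass. *)
Lemma cvg_of_two_liminf {R : realType} (u v : nat -> \bar R) (a b : R) :
  (\forall N \near \oo, u N + v N <= (a + b)%:E)%E ->
  (a%:E <= limn_einf u)%E -> (b%:E <= limn_einf v)%E ->
  u N @[N --> \oo] --> a%:E.
Proof.
move=> uv au bv.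
have near_a e : 0 < e -> \forall N \near \oo, ((a - e)%:E < u N < (a + e)%:E)%E.
  move=> e0; near=> N.
  have h1 : ((a - e)%:E < u N)%E.
    near: N; apply: lt_limn_einf; apply: lt_le_trans au.
    by rewrite lte_fin ltrBlDr ltrDl.
  have h2 : ((b - e)%:E < v N)%E.
    near: N; apply: lt_limn_einf; apply: lt_le_trans bv.
    by rewrite lte_fin ltrBlDr ltrDl.
  have h3 : (u N + v N <= (a + b)%:E)%E by near: N.
  rewrite h1/=; move: h3 h1 h2.
  case: (u N) => [x| |]; case: (v N) => [y| |] //=; rewrite ?lte_fin -?EFinD ?lee_fin; lra.
apply/fine_cvgP; split.
  apply: filterS (near_a _ ltr01) => N /andP[h1 h2].
  by rewrite fin_real// (lt_trans _ h1) ?ltNyr// (lt_trans h2) ?ltry.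
apply/cvgrPdist_lt => e e0; apply: filterS (near_a _ e0) => N.
case/andP => h1 h2.
have fu : u N \is a fin_num.
  by rewrite fin_real// (lt_trans _ h1) ?ltNyr// (lt_trans h2) ?ltry.
by move: h1 h2; rewrite -(fineK fu) !lte_fin /= ltr_distlC => -> ->.
Unshelve. all: by end_near. Qed.

Section absolutely_continuous_liminf.
Context {R : realType} {d} {T : measurableType d}.
Local Open Scope ereal_scope.
Variables (mu : {sigma_finite_measure set T -> \bar R}) (nu : {finite_measure set T -> \bar R}).
Variables (G : set (set T)) (D : set T) (M : R).
Variables (u v : nat -> T -> R) (u' v' : T -> R).
Hypothesis nu_mu : nu `<< mu.
Hypothesis GE : measurable = <<s G >>.
Hypothesis GI : setI_closed G.
Hypothesis GT : G setT.
Hypothesis mD : measurable D.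
Hypothesis muD : mu D < +oo.
Hypothesis M0 : (0 <= M)%R.
Hypothesis mu_ : forall N, measurable_fun [set: T] (u N).
Hypothesis mv_ : forall N, measurable_fun [set: T] (v N).
Hypothesis mu' : measurable_fun [set: T] u'.
Hypothesis mv' : measurable_fun [set: T] v'.
Hypothesis u0 : forall N x, (0 <= u N x)%R.
Hypothesis v0 : forall N x, (0 <= v N x)%R.
Hypothesis u'0 : forall x, (0 <= u' x)%R.
Hypothesis v'0 : forall x, (0 <= v' x)%R.
Hypothesis uvM : forall N x, (u N x + v N x <= M * \1_D x)%R.
Hypothesis uvM' : forall x, (u' x + v' x = M * \1_D x)%R.
Hypothesis Gu : forall A, G A ->
  \int[mu]_(x in A) (u' x)%:E <= limn_einf (fun N => \int[mu]_(x in A) (u N x)%:E).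
Hypothesis Gv : forall A, G A ->
  \int[mu]_(x in A) (v' x)%:E <= limn_einf (fun N => \int[mu]_(x in A) (v N x)%:E).

(** With [rho] the density of [nu], the two densities exchange roles: [rho], known only to be
    integrable and nonnegative, becomes the integrand against the measures of density [u N]. These
    converge setwise and are dominated by the finite measure of density [M * \1_D]. *)
Lemma absolutely_continuous_liminf :
  \int[nu]_x (u' x)%:E <= limn_einf (fun N => \int[nu]_x (u N x)%:E).
Proof.
have [rho [rho0 rhofin rhoint nuE]] := radon_nikodym_sigma_finite nu_mu.
pose r := fine \o rho.
have rE x : (r x)%:E = rho x by rewrite /r/= fineK.
have mr : measurable_fun [set: T] r.
  by apply/measurable_EFinP; rewrite (_ : _ \o _ = rho);
    [exact: measurable_int rhoint|apply/funext => x; rewrite /= rE].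
have r0 x : (0 <= r x)%R by rewrite -lee_fin rE.
have mMD : measurable_fun [set: T] (fun x => M * \1_D x)%R.
  by apply: (@measurable_funM _ _ R) => //; exact: measurable_indic.
have MD0 x : (0 <= M * \1_D x)%R by rewrite mulr_ge0// indicE ler0n.
have intr (h : T -> R) (mh : measurable_fun [set: T] h) (h0 : forall x, (0 <= h x)%R) :
    \int[nu]_x (h x)%:E = \int[density mu mh h0]_x (r x)%:E.
  rewrite (eq_measure_integral (density mu mr r0)); last first.
    by move=> A mA _; apply: (etrans (nuE A mA)); apply: eq_integral => x _; rewrite rE.
  rewrite ge0_integral_density//; last exact/measurable_EFinP.
  rewrite ge0_integral_density//; last exact/measurable_EFinP.
  by apply: eq_integral => x _; rewrite muleC.
rewrite (intr _ mu' u'0).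
rewrite (_ : (fun N => _) = fun N => \int[density mu (mu_ N) (u0 N)]_x (r x)%:E); last first.
  by apply/funext => N; exact: intr.
apply: setwise_cvg_liminf; last 2 first.
- exact/measurable_EFinP.
- by move=> x; rewrite lee_fin.
have le_uM N x : (u N x <= M * \1_D x)%R by apply: le_trans (uvM N x); rewrite lerDl.
have intMD A : measurable A -> density mu mMD MD0 A <= (M%:E * mu D).
  move=> mA; rewrite /density; under eq_integral do rewrite EFinM.
  rewrite ge0_integralZl//; last by apply/measurable_EFinP/measurable_indic.
  rewrite integral_indic// lee_wpmul2l ?lee_fin//.
  apply: le_measure; rewrite ?inE//; exact: measurableI.
apply: (setwise_cvg_dynkin (la := density mu mMD MD0) GE GI GT).
- apply: le_lt_trans (intMD _ measurableT) _.
  by rewrite lte_mul_pinfty// lee_fin.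
- move=> N A mA; apply: ge0_le_integral => //.
  + by move=> x _; rewrite lee_fin.
  + by apply/measurable_EFinP; exact: measurable_funTS.
  + by apply/measurable_EFinP; exact: measurable_funTS.
  + by move=> x _; rewrite lee_fin.
- move=> A mA; apply: ge0_le_integral => //.
  + by move=> x _; rewrite lee_fin.
  + by apply/measurable_EFinP; exact: measurable_funTS.
  + by apply/measurable_EFinP; exact: measurable_funTS.
  + by move=> x _; rewrite lee_fin -uvM' lerDl.
move=> A GA.
have mA : measurable A by rewrite GE; exact: sub_sigma_algebra.
have intD (f h : T -> R) : measurable_fun [set: T] f -> measurable_fun [set: T] h ->
    (forall x, (0 <= f x)%R) -> (forall x, (0 <= h x)%R) ->
    \int[mu]_(x in A) (f x)%:E + \int[mu]_(x in A) (h x)%:E =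
    \int[mu]_(x in A) (f x + h x)%:E.
  move=> mf mh f0 h0; rewrite -ge0_integralD//.
  - by move=> x _; rewrite lee_fin.
  - by apply/measurable_EFinP; exact: measurable_funTS.
  - by move=> x _; rewrite lee_fin.
  - by apply/measurable_EFinP; exact: measurable_funTS.
have fin (f : T -> R) : measurable_fun [set: T] f -> (forall x, (0 <= f x)%R) ->
    (forall x, (f x <= M * \1_D x)%R) -> \int[mu]_(x in A) (f x)%:E \is a fin_num.
  move=> mf f0 fM; rewrite ge0_fin_numE; last first.
    by apply: integral_ge0 => x _; rewrite lee_fin.
  apply: (@le_lt_trans _ _ (density mu mMD MD0 A)); last first.
    by apply: le_lt_trans (intMD _ mA) _; rewrite lte_mul_pinfty// lee_fin.
  apply: ge0_le_integral => //.
  + by move=> x _; rewrite lee_fin.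
  + by apply/measurable_EFinP; exact: measurable_funTS.
  + by apply/measurable_EFinP; exact: measurable_funTS.
  + by move=> x _; rewrite lee_fin.
have fu : \int[mu]_(x in A) (u' x)%:E \is a fin_num.
  by apply: fin => // x; rewrite -uvM' lerDl.
have fv : \int[mu]_(x in A) (v' x)%:E \is a fin_num.
  by apply: fin => // x; rewrite -uvM' lerDr.
rewrite [X in _ --> X](_ : _ = (fine (\int[mu]_(x in A) (u' x)%:E))%:E); last by rewrite fineK.
(* On a generator [A] the masses for [u N] and [v N] add up to at most the mass of [M * \1_D], and
   those for the limits to exactly this mass, so the two lower limits force convergence. *)
apply: (@cvg_of_two_liminf _ _ (fun N => \int[mu]_(x in A) (v N x)%:E) _
  (fine (\int[mu]_(x in A) (v' x)%:E))).
- apply: nearW => N; rewrite EFinD !fineK// (intD u' v')//.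
  rewrite -[leLHS]/(\int[mu]_(x in A) (u N x)%:E + \int[mu]_(x in A) (v N x)%:E).
  rewrite intD//.
  apply: ge0_le_integral => //.
  + by move=> x _; rewrite lee_fin addr_ge0.
  + by apply/measurable_EFinP; apply: measurable_funTS; exact: (@measurable_funD _ _ R).
  + by apply/measurable_EFinP; apply: measurable_funTS; exact: (@measurable_funD _ _ R).
  + by move=> x _; rewrite lee_fin uvM'.
- by rewrite fineK//; exact: Gu.
- by rewrite fineK//; exact: Gv.
Qed.

End absolutely_continuous_liminf.

Section chart.
Context {R : realType} {n : nat}.

Definition chart (p : n.+1.-tuple R) : n.-tuple R :=
  [tuple tnth p (lift ord_max i) | i < n].

Lemma measurable_chart : measurable_fun [set: n.+1.-tuple R] chart.
Proof. by apply: measurable_mktuple => i; exact: measurable_tnth. Qed.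

Lemma extendK c : cancel (extend c) chart.
Proof.
by move=> t; apply: eq_from_tnth => i; rewrite tnth_mktuple tnth_insert_lift.
Qed.

Lemma chartK (p : n.+1.-tuple R) : simplex p -> extend 1 (chart p) = p.
Proof.
move=> [_ p1]; apply: eq_from_tnth => i; case: (unliftP ord_max i) => [k|] ->.
  by rewrite tnth_insert_lift tnth_mktuple.
rewrite tnth_insert -p1 (bigD1_ord ord_max)//= addrC.
by under [X in _ - X]eq_bigr do rewrite tnth_mktuple; rewrite addrC addrK.
Qed.

Lemma complete_tupleE (t : n.-tuple R) : complete_tuple (m := n.+1) t = extend 1 t.
Proof.
apply: eq_from_tnth => i; rewrite [LHS]tnth_mktuple.
case: (unliftP ord_max i) => [k|] ->.
  by rewrite tnth_insert_lift lift_max -tnth_nth.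
by rewrite tnth_insert nth_default//= size_tuple.
Qed.

HB.instance Definition _ := isMeasurableFun.Build _ _ _ _ chart measurable_chart.

(** The sides are open because [lower_limit] needs a sequence tending to a point of the set to be
    eventually in the set: the perturbed proportions must stay inside. *)
Definition open_boxes : set (set (n.-tuple R)) :=
  [set A | exists2 B : 'I_n -> set R, forall i, open (B i)
         & A = [set t | forall i, B i (tnth t i)]].

Lemma open_boxes_setI : setI_closed open_boxes.
Proof.
move=> _ _ [B mB ->] [C mC ->]; exists (fun i => B i `&` C i).
  by move=> i; exact: openI.
apply/seteqP; split=> t /=; first by move=> [Bt Ct] i; split.
by move=> BCt; split=> i; have [] := BCt i.
Qed.

Lemma open_boxes_setT : open_boxes setT.
Proof. by exists (fun=> setT) => [i|]; [exact: openT|apply/seteqP; split]. Qed.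

Lemma open_boxes_measurable A : open_boxes A -> measurable A.
Proof. by move=> [B oB ->]; apply: measurable_box => i; exact: open_measurable. Qed.

Lemma open_boxes_near u t A : open_boxes A -> cvg_tuple u t -> A t ->
  \forall N \near \oo, A (u N).
Proof.
move=> [B oB ->] ut At; apply: filter_forall => i.
by apply: (ut i); exact: open_nbhs_nbhs.
Qed.

Lemma measurable_open_boxes : @measurable _ (n.-tuple R) = <<s open_boxes >>.
Proof.
apply/seteqP; split; last first.
  apply: smallest_sub; first exact: sigma_algebra_measurable.
  exact: open_boxes_measurable.
apply: smallest_sub; first exact: smallest_sigma_algebra.
rewrite -bigcup_seq => A [i _ [B mB <-]]; rewrite setTI.
have : preimage_set_system [set: n.-tuple R] (@tnth _ R ^~ i)
    (@RGenOpens.G R).-sigma.-measurable ((@tnth _ R ^~ i) @^-1` B).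
  by exists B; [rewrite -RGenOpens.measurableE|rewrite setTI].
rewrite -g_sigma_preimageE => + C [sC GC]; apply; split => // W [V [x [y oO]] <-].
apply: GC; exists (fun k => if k == i then V else setT).
  by move=> k; case: ifP => // _; [rewrite oO; exact: interval_open|exact: openT].
apply/seteqP; split=> t /=; first by move=> [_ Bt] k; case: eqP => // ->.
by move=> /(_ i); rewrite eqxx.
Qed.

End chart.

(** * Convergence of expectations over the outcomes *)

Section main_convergence.
Context {R : realType} {n : nat} {d} {T : measurableType d} (P : probability T R).
Variable p : {RV P >-> n.+1.-tuple R}.
Hypothesis p_simplex : {ae P, forall w, simplex (p w)}.
Hypothesis p_ac : distribution P p `<< simplex_lebesgue (m := n.+1).
Variables (q : n.+1.-tuple R -> 'I_n.+1 -> R) (g kap : R).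
Hypothesis q_gt0 : forall p, simplex p -> forall i, 0 < q p i.
Hypothesis q_sum : forall p, simplex p -> \sum_i q p i = 1.
Hypothesis q_cont : forall i, seq_continuous (q^~ i).

(** The pair [(s, j)] is the same for all [F], so that the weights of [F] and of its complement are
    values at one and the same error. *)
Lemma total_weight_cases N (x : n.+1.-tuple R) : simplex x ->
  (forall F, total_weight q g kap F N x = 0) \/
  exists s j, strictly_rounded (q x) (target g kap N x) N (seats s) j /\
    forall F, total_weight q g kap F N x = F (err N x (@seats n N s)).
Proof.
move=> sx; have [[s [j sj]]|none] := pselect (exists s j,
    strictly_rounded (q x) (target g kap N x) N (@seats n N s) j); last first.
  left=> F; rewrite /total_weight big1// => s _; rewrite big1// => j _.
  by rewrite /weight ifN//; apply/negP => sj; apply: none; exists s, j.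
right; exists s, j; split=> // F.
have uniq s' j' : strictly_rounded (q x) (target g kap N x) N (@seats n N s') j' ->
    s' = s /\ j' = j.
  move=> /(strictly_rounded_inj (q_gt0 sx) sj)[ss' ->]; split=> //.
  apply/ffunP => i; apply/val_inj => /=; have := ss' i; rewrite /seats; lia.
rewrite /total_weight (bigD1 s)//= (bigD1 j)//= {1}/weight sj !big1 ?addr0//.
- move=> s' s's; rewrite big1// => j' _; rewrite /weight ifN//.
  by apply: contra s's => /uniq[->].
- move=> j' j'j; rewrite /weight ifN//.
  by apply: contra j'j => /uniq[_ ->].
Qed.

Local Open Scope ereal_scope.

Definition chart_law := distribution P [the {mfun _ >-> _} of chart \o p].

Lemma chart_law_ac : chart_law `<< leb n.
Proof.
apply/null_content_dominatesP => A mA A0.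
suff : distribution P p (chart @^-1` A) = 0 by [].
have mcA : measurable (chart @^-1` A : set (n.+1.-tuple R)).
  by rewrite -[X in measurable X]setTI; exact: measurable_chart.
(* [simplex_lebesgue] is a bare set function, so a null set is one all of whose measurable subsets
   [B] have value 0. Read in the chart, the part of such a [B] in the simplex lies in [A]. *)
apply: (@p_ac (chart @^-1` A)) => // B mB BA.
have mC : measurable (complete_tuple (m := n.+1) @^-1` (B `&` simplex (m := n.+1))).
  rewrite (_ : complete_tuple (m := n.+1) = extend 1%R); last first.
    by apply/funext => t; exact: complete_tupleE.
  rewrite -[X in measurable X]setTI; apply: measurable_extend => //.
  by apply: measurableI => //; exact: measurable_simplex.
rewrite /simplex_lebesgue leb_tupleE//; apply/eqP; rewrite eq_le measure_ge0 andbT.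
rewrite -A0; apply: le_measure; rewrite ?inE// => t [Bt _].
by have := BA _ Bt; rewrite /= complete_tupleE extendK.
Qed.

Lemma integral_chart_law (h : n.-tuple R -> \bar R) :
  measurable_fun [set: n.-tuple R] h -> (forall t, 0 <= h t) ->
  \int[chart_law]_t h t = \int[P]_w h (chart (p w)).
Proof. by move=> mh h0; exact: ge0_integral_distribution. Qed.

Let c := shift_constant n g kap.

Let exit_value (F : n.+1.-tuple R -> R) (x : n.+1.-tuple R) j U : R :=
  F (limit_err g kap x (flow_exit (q x) c j U)).

Lemma measurable_exit_value F j : seq_continuous F ->
  measurable_fun [set: n.+1.-tuple R * n.+1.-tuple R]
    (fun z => exit_value F z.1 j z.2).
Proof.
move=> Fc; apply: (measurableT_comp (seq_continuous_measurable Fc)).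
apply: measurable_mktuple => i.
apply: (@measurable_funB _ _ R) => //; apply: (@measurable_funD _ _ R) => //; last first.
  by apply: (@measurable_funM _ _ R) => //; exact: measurable_tnth_comp.
rewrite (_ : (fun x => _) = (fun z : n.+1.-tuple R * n.+1.-tuple R =>
  (q z.1 i * (c + (tsum z.2 - tnth z.2 j)) - (if i == j then 0 else tnth z.2 i))%R)); last first.
  by apply/funext => z; rewrite tnth_flow_exit.
apply: (@measurable_funB _ _ R).
  apply: (@measurable_funM _ _ R).
    exact: (measurableT_comp (seq_continuous_measurable (@q_cont i)) measurable_fst).
  apply: (@measurable_funD _ _ R) => //; apply: (@measurable_funB _ _ R).
    exact: (measurableT_comp (@measurable_tsum _ _) measurable_snd).
  exact: measurable_tnth_comp.
by case: eqP => // _; exact: measurable_tnth_comp.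
Qed.

Let measurable_exit_value2 F j x : seq_continuous F ->
  measurable_fun [set: n.+1.-tuple R] (fun U => (exit_value F x j U)%:E).
Proof.
move=> Fc; apply/measurable_EFinP.
apply: (measurableT_comp (measurable_exit_value j Fc) (g := fun U => (x, U))).
exact: measurable_fun_pair.
Qed.

Let mcube : measurable_fun [set: n.+1.-tuple R] (\1_(@open_cube R n.+1) : _ -> R).
Proof. by apply: measurable_indic; exact: measurable_open_cube. Qed.

Lemma measurable_limit_mean F : seq_continuous F -> (forall t, (0 <= F t)%R) ->
  measurable_fun [set: n.+1.-tuple R] (limit_mean q g kap F).
Proof.
move=> Fc F0; apply: emeasurable_sum => j; apply: emeasurable_funM.
  by apply/measurable_EFinP; exact: seq_continuous_measurable.
pose h (z : n.+1.-tuple R * n.+1.-tuple R) :=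
  (\1_(@open_cube R n.+1) z.2 : R)%:E * (exit_value F z.1 j z.2)%:E.
suff : measurable_fun [set: n.+1.-tuple R] (fubini_F (leb n.+1) h) by [].
apply: measurable_fun_fubini_tonelli_F.
  apply: emeasurable_funM; apply/measurable_EFinP; last exact: measurable_exit_value.
  exact: (measurableT_comp mcube).
by move=> z; apply: mule_ge0; rewrite lee_fin ?indicE ?ler0n//; exact: F0.
Qed.

Lemma cube_integral_ge0 k (f : k.-tuple R -> \bar R) : (forall U, 0 <= f U) ->
  0 <= cube_integral f.
Proof.
by move=> f0; apply: integral_ge0 => U _; apply: mule_ge0 => //; rewrite lee_fin indicE ler0n.
Qed.

Lemma limit_mean_ge0 F x : simplex x -> (forall t, (0 <= F t)%R) ->
  0 <= limit_mean q g kap F x.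
Proof.
move=> sx F0; apply: sume_ge0 => j _; apply: mule_ge0; first by rewrite lee_fin ltW// q_gt0.
by apply: cube_integral_ge0 => U; rewrite lee_fin.
Qed.

(** On the simplex [limit_mean] is a mean for a probability: the weights [q x j] have sum 1 and the
    cube has volume 1. *)
Lemma limit_mean_compl F F' M x : simplex x ->
  seq_continuous F -> seq_continuous F' ->
  (forall t, (0 <= F t)%R) -> (forall t, (0 <= F' t)%R) ->
  (forall t, (F t + F' t = M)%R) ->
  limit_mean q g kap F x + limit_mean q g kap F' x = M%:E.
Proof.
move=> sx Fc F'c F0 F'0 FM; rewrite /limit_mean -big_split/=.
transitivity (\sum_j (q x j)%:E * M%:E); last first.
  rewrite -ge0_sume_distrl; last by move=> j _; rewrite lee_fin ltW// q_gt0.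
  by rewrite sumEFin q_sum// mul1e.
apply: eq_bigr => j _; rewrite -ge0_muleDr; last 2 first.
- by apply: cube_integral_ge0 => U; rewrite lee_fin.
- by apply: cube_integral_ge0 => U; rewrite lee_fin.
congr (_ * _); rewrite /cube_integral -ge0_integralD//; last 4 first.
- by move=> U _; apply: mule_ge0; rewrite lee_fin ?indicE ?ler0n//; exact: F0.
- apply: emeasurable_funM; first exact/measurable_EFinP.
  exact: (measurable_exit_value2 j x Fc).
- by move=> U _; apply: mule_ge0; rewrite lee_fin ?indicE ?ler0n//; exact: F'0.
- apply: emeasurable_funM; first exact/measurable_EFinP.
  exact: (measurable_exit_value2 j x F'c).
under eq_integral => U _.
  rewrite -ge0_muleDr ?lee_fin// -EFinD FM; over.
rewrite ge0_integralZr//; last first.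
- by rewrite lee_fin -(FM x) addr_ge0.
- exact/measurable_EFinP.
rewrite integral_indic//; last exact: measurable_open_cube.
by rewrite setIT [X in X * _]leb_open_cube mul1e.
Qed.

End main_convergence.

Section main_convergence.
Context {R : realType} {n : nat} {d} {T : measurableType d} (P : probability T R).
Variable p : {RV P >-> n.+1.-tuple R}.
Hypothesis p_simplex : {ae P, forall w, simplex (p w)}.
Hypothesis p_ac : distribution P p `<< simplex_lebesgue (m := n.+1).
Variables (q : n.+1.-tuple R -> 'I_n.+1 -> R) (g kap : R).
Hypothesis q_gt0 : forall p, simplex p -> forall i, 0 < q p i.
Hypothesis q_sum : forall p, simplex p -> \sum_i q p i = 1.
Hypothesis q_cont : forall i, seq_continuous (q^~ i).
Local Open Scope ereal_scope.
Local Notation D := (@simplex_chart R n).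

Section complementary_pair.
Variables (F F' : n.+1.-tuple R -> R) (M : R).
Hypothesis Fc : seq_continuous F.
Hypothesis F'c : seq_continuous F'.
Hypothesis F0 : forall t, (0 <= F t)%R.
Hypothesis F'0 : forall t, (0 <= F' t)%R.
Hypothesis FM : forall t, (F t + F' t = M)%R.

Lemma limit_mean_fin_num x : simplex x -> limit_mean q g kap F x \is a fin_num.
Proof.
move=> sx; rewrite ge0_fin_numE; last exact: limit_mean_ge0.
apply: (@le_lt_trans _ _ M%:E); last exact: ltry.
rewrite -(limit_mean_compl g kap q_gt0 q_sum q_cont sx Fc F'c F0 F'0 FM).
by rewrite leeDl// limit_mean_ge0.
Qed.

Let u N t := (\1_D t * total_weight q g kap F N (extend 1 t))%R.
(** The indicator keeps to the simplex, where [limit_mean] is finite and nonnegative, so that [fine]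
    loses nothing. *)
Let u' t := (\1_D t * fine (limit_mean q g kap F (extend 1 t)))%R.

Lemma chart_weight_ge0 N t : (0 <= u N t)%R.
Proof. by rewrite mulr_ge0// ?indicE// total_weight_ge0. Qed.

Lemma chart_limit_ge0 t : (0 <= u' t)%R.
Proof.
rewrite /u' indicE; case: (boolP (t \in D)) => [/set_mem tD|_]; last by rewrite mul0r.
by rewrite mul1r fine_ge0// limit_mean_ge0.
Qed.

Lemma measurable_chart_weight N : measurable_fun [set: n.-tuple R] (u N).
Proof.
apply: (@measurable_funM _ _ R).
  by apply: measurable_indic; exact: measurable_simplex_chart.
apply: measurableT_comp (@measurable_extend _ _ _).
exact: measurable_total_weight.
Qed.

Lemma measurable_chart_limit : measurable_fun [set: n.-tuple R] u'.
Proof.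
apply: (@measurable_funM _ _ R).
  by apply: measurable_indic; exact: measurable_simplex_chart.
apply: measurableT_comp; first exact: fine_measurable.
apply: measurableT_comp (@measurable_extend _ _ _).
exact: measurable_limit_mean.
Qed.

Lemma open_box_liminf A : open_boxes A ->
  \int[leb n]_(t in A) (u' t)%:E <= limn_einf (fun N => \int[leb n]_(t in A) (u N t)%:E).
Proof.
move=> oA; have mAD : measurable (A `&` D).
  by apply: measurableI; [exact: open_boxes_measurable|exact: measurable_simplex_chart].
have ADnear v t : cvg_tuple v t -> (A `&` D) t -> \forall N \near \oo, (A `&` D) (v N).
  move=> vt [At Dt]; near=> N; split; near: N.
    exact: open_boxes_near vt At.
  exact: simplex_chart_near vt Dt.
have indAD (t : n.-tuple R) : (\1_(A `&` D) t = \1_A t * \1_D t :> R)%R by rewrite indicI.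
have int_ind (h : n.-tuple R -> R) :
    \int[leb n]_(t in A) (h t)%:E = \int[leb n]_t (\1_A t * h t)%:E.
  rewrite integral_mkcond; apply: eq_integral => t _.
  by rewrite patchE indicE; case: ifP => _; rewrite ?mul1r ?mul0r.
have := lower_limit g kap q_gt0 q_sum q_cont Fc F0 mAD (@subIsetr _ A D) ADnear.
rewrite int_ind; under [X in _ -> _ <= limn_einf X]eq_fun do rewrite int_ind.
congr (is_true (_ <= limn_einf _)).
  apply: eq_integral => t _; rewrite /u' mulrA -indAD indicE.
  case: (boolP (t \in _)) => [/set_mem[_ Dt]|_]; last by rewrite !mul0r mul0e.
  by rewrite mul1r mul1e fineK// limit_mean_fin_num.
by apply/funext => N; apply: eq_integral => t _; rewrite indAD mulrA.
Unshelve. all: by end_near. Qed.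

Lemma integral_law_limit :
  \int[P]_w limit_mean q g kap F (p w) = \int[chart_law p]_t (u' t)%:E.
Proof.
have mp : measurable_fun [set: T] p by [].
rewrite integral_chart_law; last 2 first.
- by apply/measurable_EFinP; exact: measurable_chart_limit.
- by move=> t; rewrite lee_fin chart_limit_ge0.
apply: ae_eq_integral => //.
- apply: measurableT_comp mp; exact: measurable_limit_mean.
- have mc := measurableT_comp (@measurable_chart R n) mp.
  apply/measurable_EFinP.
  exact: (measurableT_comp measurable_chart_limit mc).
apply: filterS p_simplex => w sw _.
have sc : D (chart (p w)) by rewrite /simplex_chart /= chartK.
by rewrite /u' indicE mem_set// mul1r chartK// fineK// limit_mean_fin_num.
Qed.

Lemma integral_law_weight N :
  \int[chart_law p]_t (u N t)%:E <= \int[P]_w (total_weight q g kap F N (p w))%:E.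
Proof.
have mp : measurable_fun [set: T] p by [].
rewrite integral_chart_law; last 2 first.
- by apply/measurable_EFinP; exact: measurable_chart_weight.
- by move=> t; rewrite lee_fin chart_weight_ge0.
apply: ae_ge0_le_integral => //.
- by move=> w _; rewrite lee_fin chart_weight_ge0.
- have mc := measurableT_comp (@measurable_chart R n) mp.
  apply/measurable_EFinP.
  exact: (measurableT_comp (measurable_chart_weight N) mc).
- by move=> w _; rewrite lee_fin total_weight_ge0.
- apply/measurable_EFinP.
  apply: measurableT_comp mp; exact: measurable_total_weight.
apply: filterS p_simplex => w sw _; rewrite lee_fin /u chartK//.
by rewrite indicE -[leRHS]mul1r ler_wpM2r// ?total_weight_ge0// lern1 leq_b1.
Qed.

End complementary_pair.

Lemma law_liminf F F' M : seq_continuous F -> seq_continuous F' ->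
  (forall t, (0 <= F t)%R) -> (forall t, (0 <= F' t)%R) ->
  (forall t, (F t + F' t = M)%R) ->
  \int[P]_w limit_mean q g kap F (p w) <=
  limn_einf (fun N => \int[P]_w (total_weight q g kap F N (p w))%:E).
Proof.
move=> Fc F'c F0 F'0 FM; have F'M t : (F' t + F t = M)%R by rewrite addrC.
rewrite (integral_law_limit Fc F'c F0 F'0 FM).
apply: le_trans; last first.
  by apply: limn_einf_mono; apply: nearW => N; exact: integral_law_weight.
have M0 : (0 <= M)%R by rewrite -(FM [tuple of nseq n.+1 0%R]) addr_ge0.
apply: (@absolutely_continuous_liminf _ _ _ (leb n) (chart_law p) open_boxes D M
  _ (fun N t => \1_D t * total_weight q g kap F' N (extend 1 t))%R _
  (fun t => \1_D t * fine (limit_mean q g kap F' (extend 1 t)))%R).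
- exact: chart_law_ac.
- exact: measurable_open_boxes.
- exact: open_boxes_setI.
- exact: open_boxes_setT.
- exact: measurable_simplex_chart.
- apply: (@le_lt_trans _ _ (leb n (@open_cube R n))); last by rewrite leb_open_cube ltry.
  apply: le_measure; rewrite ?inE.
  + exact: measurable_simplex_chart.
  + exact: measurable_open_cube.
  + by move=> t [t01 _] i; have := t01 (lift ord_max i); rewrite tnth_insert_lift /= in_itv.
- exact: M0.
- by move=> N; exact: measurable_chart_weight.
- by move=> N; exact: measurable_chart_weight.
- exact: measurable_chart_limit.
- exact: measurable_chart_limit.
- by move=> N t; exact: chart_weight_ge0.
- by move=> N t; exact: chart_weight_ge0.
- by move=> t; exact: chart_limit_ge0.
- by move=> t; exact: chart_limit_ge0.
(* For the weights this is only an inequality: both vanish when there is no strict outcome. The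
   limits add up to [M] on all of [D]. *)
- move=> N t; rewrite -mulrDr [leRHS]mulrC indicE.
  case: (boolP (t \in D)) => [/set_mem Dt|_]; last by rewrite !mul0r.
  rewrite !mul1r.
  have [tw0|[s [j [_ twE]]]] := total_weight_cases g kap q_gt0 N Dt.
    by rewrite !tw0 addr0.
  by rewrite !twE FM.
- move=> t; rewrite -mulrDr [RHS]mulrC indicE.
  case: (boolP (t \in D)) => [/set_mem Dt|_]; last by rewrite !mul0r.
  rewrite !mul1r -fineD; last 2 first.
  + exact: (limit_mean_fin_num Fc F'c F0 F'0 FM).
  + exact: (limit_mean_fin_num F'c Fc F'0 F0 F'M).
  by rewrite (limit_mean_compl g kap q_gt0 q_sum q_cont Dt Fc F'c F0 F'0 FM).
- by move=> A; exact: (open_box_liminf Fc F'c F0 F'0 FM).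
- by move=> A; exact: (open_box_liminf F'c Fc F'0 F0 F'M).
Qed.

Lemma integral_limit_mean_compl F F' M : seq_continuous F -> seq_continuous F' ->
  (forall t, (0 <= F t)%R) -> (forall t, (0 <= F' t)%R) ->
  (forall t, (F t + F' t = M)%R) ->
  \int[P]_w limit_mean q g kap F (p w) + \int[P]_w limit_mean q g kap F' (p w) = M%:E.
Proof.
move=> Fc F'c F0 F'0 FM; have F'M t : (F' t + F t = M)%R by rewrite addrC.
have mp : measurable_fun [set: T] p by [].
rewrite (integral_law_limit Fc F'c F0 F'0 FM) (integral_law_limit F'c Fc F'0 F0 F'M).
rewrite -ge0_integralD//; last 4 first.
- by move=> t _; rewrite lee_fin chart_limit_ge0.
- by apply/measurable_EFinP; exact: measurable_chart_limit.
- by move=> t _; rewrite lee_fin chart_limit_ge0.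
- by apply/measurable_EFinP; exact: measurable_chart_limit.
rewrite integral_chart_law//; last 2 first.
- by apply: emeasurable_funD; apply/measurable_EFinP; exact: measurable_chart_limit.
- by move=> t; rewrite adde_ge0// lee_fin chart_limit_ge0.
transitivity (\int[P]_w M%:E); last first.
  by rewrite integral_cst// [X in _ * X]probability_setT mule1.
have mc := measurableT_comp (@measurable_chart R n) mp.
have mlim h : seq_continuous h -> (forall t, (0 <= h t)%R) -> measurable_fun [set: n.-tuple R]
    (fun t => \1_D t * fine (limit_mean q g kap h (extend 1 t)))%R.
  by move=> hc h0; exact: measurable_chart_limit.
apply: ae_eq_integral => //.
  apply: emeasurable_funD; apply/measurable_EFinP.
    exact: (measurableT_comp (mlim F Fc F0) mc).
  exact: (measurableT_comp (mlim F' F'c F'0) mc).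
apply: filterS p_simplex => w sw _.
have sc : D (chart (p w)) by rewrite /simplex_chart /= chartK.
rewrite indicE mem_set// !mul1r chartK// !fineK.
- exact: (limit_mean_compl g kap q_gt0 q_sum q_cont sw Fc F'c F0 F'0 FM).
- exact: (limit_mean_fin_num F'c Fc F'0 F0 F'M).
- exact: (limit_mean_fin_num Fc F'c F0 F'0 FM).
Qed.

Lemma measurable_seats_real (s : T -> 'I_n.+1 -> int) i : measurable_seats s ->
  measurable_fun [set: T] (fun w => (s w i)%:~R : R).
Proof.
move=> ms _ Y mY; rewrite setTI.
rewrite (_ : _ @^-1` Y = \bigcup_(z in [set: int])
    (if (z%:~R : R) \in Y then [set w | s w i = z] else set0)).
  apply: countable_bigcupT_measurable; first exact: (@countableP _ [set: int]).
  by move=> z; case: ifP => // _; exact: ms.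
apply/seteqP; split=> w /=.
  by move=> Yw; exists (s w i) => //; rewrite mem_set.
by move=> [z _]; case: ifPn => // /set_mem Yz /= ->.
Qed.

Lemma measurable_err_seats N (s : T -> 'I_n.+1 -> int) : measurable_seats s ->
  measurable_fun [set: T] (fun w => err N (p w) (s w)).
Proof.
move=> ms; apply: measurable_mktuple => i; apply: (@measurable_funB _ _ R).
  exact: measurable_seats_real.
by apply: (@measurable_funM _ _ R) => //; exact: measurable_tnth_comp.
Qed.

Variable s : nat -> T -> 'I_n.+1 -> int.
Hypothesis s_rounded : \forall N \near \oo, measurable_seats (s N) /\
  {ae P, forall w, rounded (q (p w)) (target g kap N (p w)) N (s N w)}.

(** Where a strict outcome exists it is the only outcome and the integrands agree, however ties are
    resolved; elsewhere the left one is 0. *)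
Lemma total_weight_le_outcome F : seq_continuous F -> (forall t, (0 <= F t)%R) ->
  \forall N \near \oo, \int[P]_w (total_weight q g kap F N (p w))%:E <=
    \int[P]_w (F (err N (p w) (s N w)))%:E.
Proof.
move=> Fc F0; have mp : measurable_fun [set: T] p by [].
apply: filterS s_rounded => N [ms sr]; apply: ae_ge0_le_integral => //.
- by move=> w _; rewrite lee_fin total_weight_ge0.
- apply/measurable_EFinP; apply: measurableT_comp mp; exact: measurable_total_weight.
- by move=> w _; rewrite lee_fin.
- apply/measurable_EFinP.
  exact: (measurableT_comp (seq_continuous_measurable Fc) (measurable_err_seats N ms)).
apply: filterS2 p_simplex sr => w sw rw _; rewrite lee_fin.
have [->//|[s' [j [sj ->]]]] := total_weight_cases g kap q_gt0 N sw.
by rewrite (_ : s N w = seats s')//; apply/funext; exact: (rounded_unique (q_gt0 sw) sj rw).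
Qed.

(** For the actual outcomes the expectations of [F] and [M - F] have sum [M], as have their expected
    limits, so the lower limits inherited from strict outcomes leave no room for either to exceed
    its limit. *)
Lemma main_convergence F M : seq_continuous F -> (forall t, (0 <= F t <= M)%R) ->
  \int[P]_w (F (err N (p w) (s N w)))%:E @[N --> \oo] -->
  \int[P]_w limit_mean q g kap F (p w).
Proof.
move=> Fc FM; pose F' t := (M - F t)%R.
have F0 t : (0 <= F t)%R by have /andP[] := FM t.
have F'0 t : (0 <= F' t)%R by rewrite subr_ge0; have /andP[] := FM t.
have F'c : seq_continuous F'.
  by move=> u t ut; apply: cvgB; [exact: cvg_cst|exact: Fc].
have FF' t : (F t + F' t = M)%R by rewrite addrC subrK.
have F'F t : (F' t + F t = M)%R by rewrite subrK.
set a := \int[P]_w limit_mean q g kap F (p w).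
set b := \int[P]_w limit_mean q g kap F' (p w).
have abM : a + b = M%:E := integral_limit_mean_compl Fc F'c F0 F'0 FF'.
have [fa fb] : a \is a fin_num /\ b \is a fin_num.
  by apply/andP; rewrite -fin_numD abM.
have aE : (fine a)%:E = a by rewrite fineK.
have bE : (fine b)%:E = b by rewrite fineK.
rewrite -aE.
apply: (@cvg_of_two_liminf _ _ (fun N => \int[P]_w (F' (err N (p w) (s N w)))%:E) _ (fine b)).
- apply: filterS s_rounded => N [ms _].
  have me (h : n.+1.-tuple R -> R) : seq_continuous h ->
      measurable_fun [set: T] (fun w => (h (err N (p w) (s N w)))%:E).
    move=> hc; apply/measurable_EFinP.
    exact: (measurableT_comp (seq_continuous_measurable hc) (measurable_err_seats N ms)).
  rewrite EFinD aE bE abM -ge0_integralD//; last 4 first.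
  + by move=> w _; rewrite lee_fin.
  + exact: me.
  + by move=> w _; rewrite lee_fin.
  + exact: me.
  under eq_integral do rewrite -EFinD FF'.
  by rewrite integral_cst// [X in _ * X]probability_setT mule1.
- rewrite aE; apply: le_trans (law_liminf Fc F'c F0 F'0 FF') _.
  by apply: limn_einf_mono; exact: total_weight_le_outcome.
- rewrite bE; apply: le_trans (law_liminf F'c Fc F'0 F0 F'F) _.
  by apply: limn_einf_mono; exact: total_weight_le_outcome.
Qed.

End main_convergence.

(** * The law of one coordinate *)

Section cube_probability.
Context {R : realType} (k : nat).
Local Open Scope ereal_scope.

Let mI : measurable_fun [set: k.-tuple R] (\1_(@open_cube R k) : _ -> R).
Proof. by apply: measurable_indic; exact: measurable_open_cube. Qed.

Let I0 (t : k.-tuple R) : (0 <= \1_(@open_cube R k) t :> R)%R.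
Proof. by rewrite indicE ler0n. Qed.

Definition cube_prob : set (k.-tuple R) -> \bar R := density (leb k) mI I0.

HB.instance Definition _ := Measure.on cube_prob.

Lemma cube_prob_setT : cube_prob setT = 1.
Proof.
transitivity (\int[leb k]_t (\1_(@open_cube R k) t : R)%:E) => //.
rewrite integral_indic//; last exact: measurable_open_cube.
by rewrite setIT; exact: leb_open_cube.
Qed.

HB.instance Definition _ := Measure_isProbability.Build _ _ R cube_prob cube_prob_setT.

Lemma integral_cube_prob (f : k.-tuple R -> \bar R) :
  measurable_fun [set: k.-tuple R] f -> (forall t, 0 <= f t) ->
  \int[cube_prob]_t f t = cube_integral f.
Proof.
move=> mf f0; rewrite ge0_integral_density//.
by apply: eq_integral => t _; rewrite muleC.
Qed.

Lemma cube_prob_box (B : 'I_k -> set R) : (forall i, measurable (B i)) ->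
  cube_prob [set t | forall i, B i (tnth t i)] =
  \prod_i lebesgue_measure (B i `&` `]0%R, 1%R[).
Proof.
move=> mB; rewrite [LHS]densityE -leb_box; last by move=> i; exact: measurableI.
transitivity (\int[leb k]_t (\1_([set t | forall i, B i (tnth t i)] `&` @open_cube R k) t : R)%:E).
  by apply: eq_integral => t _; rewrite indicI.
rewrite integral_indic ?setIT//.
  congr (leb k _); apply/seteqP; split=> t /=.
    by move=> [Bt ct] i; split; [exact: Bt|exact: ct].
  by move=> h; split=> i; have [] := h i.
by apply: measurableI; [exact: measurable_box|exact: measurable_open_cube].
Qed.

End cube_probability.

Section cube_insert.
Context {R : realType} (n : nat).
Local Open Scope ereal_scope.

Lemma open_cube_insert (j : 'I_n.+1) (x : R) (t : n.-tuple R) :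
  (\1_(@open_cube R n.+1) (insert j x t) : R)%:E =
  ind01 x * (\1_(@open_cube R n) t : R)%:E.
Proof.
rewrite /ind01 -EFinM !indicE -natrM mulnb; congr (_%:R%:E); congr nat_of_bool.
apply/idP/andP.
  move=> /set_mem h; split; apply/mem_set; first by have := h j; rewrite tnth_insert.
  by move=> i; have := h (lift j i); rewrite tnth_insert_lift.
move=> [/set_mem hx /set_mem ht]; apply/mem_set => i.
by case: (unliftP j i) => [l|] ->; rewrite ?tnth_insert_lift ?tnth_insert//; exact: ht.
Qed.

Lemma cube_integral_insert (j : 'I_n.+1) (f : n.+1.-tuple R -> \bar R) :
  measurable_fun [set: n.+1.-tuple R] f -> (forall t, 0 <= f t) ->
  cube_integral f =
  \int[lebesgue_measure]_x (ind01 x * cube_integral (fun t => f (insert j x t))).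
Proof.
move=> mf f0; have mI : measurable_fun [set: n.+1.-tuple R] (\1_(@open_cube R n.+1) : _ -> R).
  by apply: measurable_indic; exact: measurable_open_cube.
have mI' : measurable_fun [set: n.-tuple R] (\1_(@open_cube R n) : _ -> R).
  by apply: measurable_indic; exact: measurable_open_cube.
rewrite /cube_integral (leb_insert_integral j); last 2 first.
- by apply: emeasurable_funM => //; exact/measurable_EFinP.
- by move=> t; apply: mule_ge0 => //; rewrite lee_fin indicE ler0n.
apply: eq_integral => x _; rewrite -ge0_integralZl//.
- by apply: eq_integral => t _; rewrite open_cube_insert muleA.
- apply: emeasurable_funM; first exact/measurable_EFinP.
  by apply: (measurableT_comp mf); apply: measurable_insert.
- by move=> t _; apply: mule_ge0 => //; rewrite lee_fin indicE ler0n.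
- exact: ind01_ge0.
Qed.

Lemma measurable_cube_integral {d} {T : measurableType d} (f : T * n.-tuple R -> \bar R) :
  measurable_fun [set: T * n.-tuple R] f -> (forall z, 0 <= f z) ->
  measurable_fun [set: T] (fun x => cube_integral (fun t => f (x, t))).
Proof.
move=> mf f0.
pose h (z : T * n.-tuple R) := (\1_(@open_cube R n) z.2 : R)%:E * f z.
suff : measurable_fun [set: T] (fubini_F (leb n) h) by [].
have mI : measurable_fun [set: n.-tuple R] (\1_(@open_cube R n) : _ -> R).
  by apply: measurable_indic; exact: measurable_open_cube.
apply: measurable_fun_fubini_tonelli_F.
  apply: emeasurable_funM => //; apply/measurable_EFinP.
  exact: (measurableT_comp mI).
by move=> z; apply: mule_ge0 => //; rewrite lee_fin indicE ler0n.
Qed.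

End cube_insert.

Lemma integral_ind01_cst {R : realType} (a : \bar R) : (0 <= a)%E ->
  (\int[lebesgue_measure]_x (ind01 x * a) = a)%E.
Proof.
move=> a0; rewrite ge0_integralZr//;
  [|exact: measurable_ind01|by move=> *; exact: ind01_ge0].
by rewrite integral_ind01 mul1e.
Qed.

Section marginal.
Context {R : realType} (k : nat).
Local Open Scope ereal_scope.
Local Notation mu := (@lebesgue_measure R).
Variables (q : 'I_k.+2 -> R) (H : R -> \bar R) (i : 'I_k.+2).
Hypothesis q1 : (\sum_j q j = 1)%R.
Hypothesis q_gt0 : forall j, (0 < q j)%R.
Hypothesis qi_lt1 : (q i < 1)%R.
Hypothesis mH : measurable_fun [set: R] H.
Hypothesis H0 : forall x, 0 <= H x.

(** Adds the [k] uniform variables that enter with the factor [q i] whichever face is left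
    through. *)
Let smear y := cube_integral (fun t : k.-tuple R => H (y + q i * tsum t)%R).

Let smear_arg : measurable_fun [set: R * k.-tuple R] (fun z => H (z.1 + q i * tsum z.2)%R).
Proof.
apply: (measurableT_comp mH); apply: (@measurable_funD _ _ R) => //.
apply: (@measurable_funM _ _ R) => //.
exact: (measurableT_comp (@measurable_tsum _ _)).
Qed.

Let msmear : measurable_fun [set: R] smear.
Proof. by apply: (measurable_cube_integral smear_arg) => z; exact: H0. Qed.

Let smear0 y : 0 <= smear y.
Proof. by apply: cube_integral_ge0 => U; exact: H0. Qed.

Let exit_coord j (U : k.+2.-tuple R) : R :=
  (q i * (tsum U - tnth U j) - (if i == j then 0 else tnth U i))%R.

Let mexit j : measurable_fun [set: k.+2.-tuple R] (fun U => H (exit_coord j U)).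
Proof.
apply: (measurableT_comp mH); apply: (@measurable_funB _ _ R).
  apply: (@measurable_funM _ _ R) => //; apply: (@measurable_funB _ _ R).
    exact: measurable_tsum.
  exact: measurable_tnth.
by case: eqP => // _; exact: measurable_tnth.
Qed.

Let exit_self : cube_integral (fun U => H (exit_coord i U)) =
  \int[mu]_u (ind01 u * smear (q i * u)%R).
Proof.
have mh : measurable_fun [set: k.+1.-tuple R] (fun t => H (q i * tsum t)%R).
  apply: (measurableT_comp mH); apply: (@measurable_funM _ _ R) => //.
  exact: measurable_tsum.
rewrite (cube_integral_insert i (mexit i) (fun _ => H0 _)).
transitivity (\int[mu]_x (ind01 x * cube_integral (fun t : k.+1.-tuple R => H (q i * tsum t)%R))).
  apply: eq_integral => x _; congr (_ * _); apply: eq_integral => t _.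
  by rewrite /exit_coord eqxx tsum_insert tnth_insert [(x + _)%R]addrC addrK subr0.
rewrite integral_ind01_cst; last by apply: cube_integral_ge0 => t; exact: H0.
rewrite (cube_integral_insert ord0 mh (fun _ => H0 _)).
apply: eq_integral => u _; congr (_ * _); apply: eq_integral => t _.
by rewrite tsum_insert mulrDr.
Qed.

(** The coordinate [U j] does not occur; of the others, [U i] enters as [q i * u - u], the remaining
    [k] through [smear]. *)
Let exit_other j : j != i -> cube_integral (fun U => H (exit_coord j U)) =
  \int[mu]_u (ind01 u * smear (- ((1 - q i) * u))%R).
Proof.
move=> ji; have [i' iE _] := unlift_some ji.
have mh : measurable_fun [set: k.+1.-tuple R]
    (fun t => H (q i * tsum t - tnth t i')%R).
  apply: (measurableT_comp mH); apply: (@measurable_funB _ _ R).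
    by apply: (@measurable_funM _ _ R) => //; exact: measurable_tsum.
  exact: measurable_tnth.
rewrite (cube_integral_insert j (mexit j) (fun _ => H0 _)).
transitivity (\int[mu]_x (ind01 x * cube_integral (fun t : k.+1.-tuple R =>
    H (q i * tsum t - tnth t i')%R))).
  apply: eq_integral => x _; congr (_ * _); apply: eq_integral => t _.
  rewrite /exit_coord eq_sym (negbTE ji) tsum_insert tnth_insert [(x + _)%R]addrC addrK.
  by rewrite (_ : tnth (insert j x t) i = tnth t i')//; rewrite iE tnth_insert_lift.
rewrite integral_ind01_cst; last by apply: cube_integral_ge0 => U; exact: H0.
rewrite (cube_integral_insert i' mh (fun _ => H0 _)).
apply: eq_integral => u _; congr (_ * _); apply: eq_integral => t _.
by rewrite tsum_insert tnth_insert; congr (_ * H _); ring.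
Qed.

(* Leaving at [i] (weight [q i]) the [i]-th coordinate is [q i * u] plus the remaining
   terms, otherwise (weight [1 - q i]) it is [- (1 - q i) * u] plus the same terms, [u]
   uniform on [(0, 1)]: the mixture is uniform on [(- (1 - q i), q i)]. *)
Lemma exit_marginal :
  \sum_j (q j)%:E * cube_integral (fun U : k.+2.-tuple R =>
    H (q i * (tsum U - tnth U j) - (if i == j then 0 else tnth U i))%R) =
  cube_integral (fun W : k.+1.-tuple R =>
    H (tnth W ord0 - (1 - q i) + q i * (tsum W - tnth W ord0))%R).
Proof.
have q1i : (0 < 1 - q i)%R by rewrite subr_gt0.
rewrite (bigD1 i)//= exit_self.
rewrite (eq_bigr (fun j => (q j)%:E * \int[mu]_u (ind01 u * smear (- ((1 - q i) * u))%R))); last first.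
  by move=> j ji; rewrite exit_other.
rewrite -ge0_sume_distrl; last by move=> j _; rewrite lee_fin ltW.
rewrite sumEFin (_ : \sum_(j | j != i) q j = 1 - q i)%R; last first.
  by rewrite -q1 [X in (X - _)%R](bigD1 i)//= [(q i + _)%R]addrC addrK.
pose g (A : set R) y : \bar R := (\1_A y : R)%:E * smear y.
have g0 A y : 0 <= g A y by apply: mule_ge0 => //; rewrite lee_fin indicE ler0n.
have mg A : measurable A -> measurable_fun [set: R] (g A).
  by move=> mA; apply: emeasurable_funM => //; apply/measurable_EFinP; exact: measurable_indic.
pose lo : set R := `]0%R, q i[%classic.
pose hi : set R := `](- (1 - q i))%R, 0%R[%classic.
have mlo : measurable lo by exact: measurable_itv.
have mhi : measurable hi by exact: measurable_itv.
have -> : (q i)%:E * \int[mu]_u (ind01 u * smear (q i * u)%R) = \int[mu]_y g lo y.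
  rewrite (lebesgue_integral_scale (q_gt0 i) (mg lo mlo) (g0 lo)) /g.
  congr (_ * _); apply: eq_integral => u _; congr (_ * _).
  rewrite /ind01 !indicE; congr (_%:R%:E); congr nat_of_bool.
  by apply/idP/idP => /set_mem h; apply/mem_set; move: h;
    rewrite /lo /= !in_itv/= pmulr_rgt0// gtr_pMr.
have -> : (1 - q i)%:E * \int[mu]_u (ind01 u * smear (- ((1 - q i) * u))%R) =
    \int[mu]_y g hi y.
  have mN : measurable_fun [set: R] (fun x => g hi (0 - x)%R).
    by apply: (measurableT_comp (mg hi mhi)); exact: (@measurable_funB _ R R).
  rewrite -(lebesgue_integral_reflect 0 (mg hi mhi) (g0 hi)).
  rewrite (lebesgue_integral_scale q1i mN (fun x => g0 hi _)).
  congr (_ * _); apply: eq_integral => u _; rewrite /g sub0r; congr (_ * _).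
  rewrite /ind01 !indicE; congr (_%:R%:E); congr nat_of_bool.
  by apply/idP/idP => /set_mem h; apply/mem_set; move: h;
    rewrite /hi /= !in_itv/= ltrN2 oppr_lt0 pmulr_rgt0// gtr_pMr// andbC.
have mw : measurable_fun [set: k.+1.-tuple R]
    (fun W => H (tnth W ord0 - (1 - q i) + q i * (tsum W - tnth W ord0))%R).
  apply: (measurableT_comp mH); apply: (@measurable_funD _ _ R).
    by apply: (@measurable_funB _ _ R) => //; exact: measurable_tnth.
  apply: (@measurable_funM _ _ R) => //; apply: (@measurable_funB _ _ R).
    exact: measurable_tsum.
  exact: measurable_tnth.
rewrite -(@ge0_integralD _ (measurableTypeR R) R mu setT measurableT (g lo) (g hi)
  (fun y _ => g0 lo y) (mg lo mlo) (fun y _ => g0 hi y) (mg hi mhi)).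
rewrite (cube_integral_insert ord0 mw (fun _ => H0 _)).
transitivity (\int[mu]_w (ind01 w * smear (w - (1 - q i))%R)); last first.
  apply: eq_integral => w _; congr (_ * _); apply: eq_integral => t _.
  by rewrite tsum_insert tnth_insert [(w + _ - _)%R]addrC addKr.
pose unit_shift : set R := `](- (1 - q i))%R, q i[%classic.
have ms : measurable unit_shift by exact: measurable_itv.
rewrite -[LHS]/(\int[mu]_y (g lo y + g hi y)).
(* The intervals [lo] and [hi] fill [unit_shift], of length 1, up to the point 0. *)
transitivity (\int[mu]_y g unit_shift y).
  apply: ae_eq_integral => //; [by apply: emeasurable_funD; exact: mg|exact: mg|].
  exists [set 0%R]; split; [exact: measurable_set1|exact: lebesgue_measure_set1|].
  move=> y /= h; apply/eqP/negPn/negP => y0; apply: h => _.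
  rewrite /g -ge0_muleDl ?lee_fin ?indicE ?ler0n//; congr (_ * _).
  rewrite -EFinD -natrD; congr (_%:R%:E).
  rewrite /lo /hi /unit_shift !mem_setE !in_itv/=.
  have := q_gt0 i; move: y0; rewrite neq_lt => /orP[] y0 q0.
    by rewrite y0 (lt_trans y0 q0) ltNge (ltW y0)/= !andbT.
  have q1' : (- (1 - q i) < y)%R by rewrite (lt_trans _ y0)// oppr_lt0.
  by rewrite y0 q1' [(y < 0)%R]ltNge (ltW y0)/= addn0.
have mt : measurable_fun [set: R] (fun w => g unit_shift (w - (1 - q i))%R).
  by apply: (measurableT_comp (mg _ ms)); exact: (@measurable_funB _ R R).
rewrite -(lebesgue_integral_translate (- (1 - q i)) (mg _ ms) (g0 _)).
apply: eq_integral => w _; congr (_ * _).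
rewrite /ind01 !indicE; congr (_%:R%:E); congr nat_of_bool.
by rewrite /unit_shift !mem_setE !in_itv/= -[X in (X < _)%R]sub0r ltrD2r ltrBlDr addrC subrK.
Qed.

End marginal.

Section rectangle_law.
Context {R : realType} {d1 d2} {T : measurableType d1} {E : measurableType d2} (k : nat).
Local Open Scope ereal_scope.
Variables (m0 : {measure set T -> \bar R}) (nu : {measure set E -> \bar R}).
Variables (X : T -> E) (W : T -> k.-tuple R).
Hypothesis mX : measurable_fun [set: T] X.
Hypothesis mW : measurable_fun [set: T] W.
Hypothesis nuoo : nu setT < +oo.
Hypothesis law_box : forall A (B : 'I_k -> set R), measurable A ->
  (forall i, measurable (B i)) ->
  m0 [set w | A (X w) /\ forall i, B i (tnth (W w) i)] =
  nu A * \prod_i lebesgue_measure (B i `&` `]0%R, 1%R[%classic).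

Let law_rectangle A C : measurable A -> measurable C ->
  m0 [set w | A (X w) /\ C (W w)] = nu A * cube_prob C.
Proof.
move=> mA mC; have mXA : measurable (X @^-1` A) by rewrite -[X in measurable X]setTI; exact: mX.
have nuA0 : 0 <= nu A by exact: measure_ge0.
have nuAoo : nu A < +oo by apply: le_lt_trans nuoo; apply: le_measure; rewrite ?inE.
have nuAE : (fine (nu A))%:E = nu A by rewrite fineK// ge0_fin_numE.
have f0 : (0 <= fine (nu A))%R by exact: fine_ge0.
pose m1 := image_measure (mrestr m0 mXA : {measure set T -> \bar R}) mW.
have m1E B : m1 B = m0 [set w | A (X w) /\ B (W w)].
  by rewrite /m1 /= /pushforward /mrestr; congr (m0 _); apply/seteqP; split=> w /= [].
pose m2 : {measure set (k.-tuple R) -> \bar R} := mscale (NngNum f0) (@cube_prob R k).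
have m12 (B : 'I_k -> set R) : (forall i, measurable (B i)) ->
    m1 [set t | forall i, B i (tnth t i)] = m2 [set t | forall i, B i (tnth t i)].
  move=> mB; rewrite m1E [LHS](law_box mA mB) /m2 /= /mscale /=.
  by rewrite nuAE cube_prob_box.
have m1oo : m1 setT < +oo.
  have := m12 (fun=> setT) (fun=> measurableT).
  rewrite (_ : [set t | _] = setT); last by apply/seteqP; split.
  by move=> ->; rewrite /m2 /= /mscale /= cube_prob_setT mule1 nuAE.
by rewrite -m1E -[nu A]nuAE -[RHS]/(m2 C); exact: box_unique.
Qed.

(** For fixed [A], boxes determine the law of [W] on the event that [X] lies in [A]; rectangles then
    determine the joint law as a product. General measures are allowed so that [m0] can be [P]
    weighted by the indicator of an event such as [J = j]. *)
Lemma rectangle_integral (G : E * k.-tuple R -> \bar R) :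
  measurable_fun [set: E * k.-tuple R] G -> (forall z, 0 <= G z) ->
  \int[m0]_w G (X w, W w) = \int[nu]_x cube_integral (fun U => G (x, U)).
Proof.
move=> mG G0; have mXW : measurable_fun [set: T] (fun w => (X w, W w)).
  exact: measurable_fun_pair.
pose nu' : {finite_measure set E -> \bar R} := mfrestr measurableT nuoo.
have nu'E A : nu' A = nu A by rewrite /nu' /= /mfrestr /mrestr setIT.
rewrite -(ge0_integral_image mXW (nu := nu' \x @cube_prob R k))//; last first.
  move=> A mA; rewrite -[RHS]/(image_measure m0 mXW A).
  apply: product_measure_unique => // B C mB mC.
  transitivity (nu B * cube_prob C); first by rewrite -law_rectangle.
  by congr (_ * _); rewrite -nu'E.
rewrite fubini_tonelli1//.
rewrite (eq_measure_integral nu' (m1 := nu)); last by move=> A mA _; rewrite -nu'E.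
apply: eq_integral => x _; apply: integral_cube_prob => //.
by apply: (measurableT_comp mG); exact: measurable_pair1.
Qed.

End rectangle_law.

Lemma uniform_shift_law {R : realType} {d} {T : measurableType d} (P : probability T R)
    (a b : R) (X : {RV P >-> R}) (B : set R) : b - a = 1 -> uniform_on a b X ->
  measurable B -> P [set w | B (X w - a)] = lebesgue_measure (B `&` `]0%R, 1%R[%classic).
Proof.
move=> ba [ab Xu] mB.
have mBa : measurable [set x : R | B (x - a)].
  have mf : measurable_fun [set: R] (fun x : R => x - a) by exact: (@measurable_funB _ R R).
  by rewrite -[X in measurable X]setTI; exact: mf.
rewrite -[LHS]/(distribution P X [set x | B (x - a)]) Xu//.
pose h (x : R) : \bar R := (\1_([set x | B (x - a)] `&` `[a, b]) x : R)%:E.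
have mI : measurable ([set x : R | B (x - a)] `&` `[a, b]) by apply: measurableI.
have mh : measurable_fun [set: R] h by apply/measurable_EFinP; exact: measurable_indic.
have -> : uniform_prob ab [set x | B (x - a)] = (\int[lebesgue_measure]_x h x)%E.
  transitivity (\int[uniform_prob ab]_x (\1_[set x | B (x - a)] x : R)%:E)%E.
    by rewrite integral_indic// setIT.
  rewrite integral_uniform//; last first.
    by apply/measurable_EFinP; exact: measurable_indic.
  rewrite ba invr1 mul1e integral_mkcond; apply: eq_integral => x _.
  rewrite patchE /h indicI; case: ifPn => xab; last by rewrite /= [\1_(`[a, b]) x]indicE (negbTE xab) mulr0.
  by rewrite /= [\1_(`[a, b]) x]indicE xab mulr1.
rewrite -(lebesgue_integral_translate a mh); last by move=> x; rewrite lee_fin indicE ler0n.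
transitivity (\int[lebesgue_measure]_x (\1_(B `&` `]0%R, 1%R[%classic) x : R)%:E)%E; last first.
  by rewrite integral_indic ?setIT//; exact: measurableI.
apply: ae_eq_integral => //.
- have mf : measurable_fun [set: R] (fun x : R => x + a) by exact: (@measurable_funD _ R R).
  exact: (measurableT_comp mh mf).
- by apply/measurable_EFinP; apply: measurable_indic; exact: measurableI.
(* The closed interval of [uniform_prob] and the open unit interval differ only in the two end
   points. *)
exists ([set 0] `|` [set 1]); split.
- by apply: measurableU; exact: measurable_set1.
- apply: countable_lebesgue_measure0; apply: finite_set_countable.
  by rewrite finite_setU; split; exact: finite_set1.
move=> x /= hx; apply: contrapT => /not_orP[x0 x1]; apply: hx => _.
rewrite /h !indicE; congr (_%:R%:E); congr nat_of_bool.
have bE : b = a + 1 by rewrite -ba addrC subrK.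
apply/idP/idP => /set_mem /= [] /=; rewrite ?addrK !in_itv/= => Bx xab; apply/mem_set; split=> //=;
  rewrite ?addrK// in_itv/=.
  by move: xab; rewrite bE lerDr [x + a]addrC lerD2l !le_eqVlt eq_sym => /andP[/orP[/eqP//|->] /orP[/eqP//|->]].
by move: xab => /andP[/ltW ? /ltW ?]; rewrite bE lerDr [x + a]addrC lerD2l; apply/andP.
Qed.

(** * The limit variables *)

Lemma big_option {S : Type} {idx : S} (op : Monoid.com_law idx) (k : nat)
    (f : option 'I_k -> S) :
  \big[op/idx]_(o in [set: option 'I_k]%SET) f o = op (f None) (\big[op/idx]_i f (Some i)).
Proof.
rewrite (eq_bigl predT); last by move=> o; rewrite inE.
rewrite (bigD1 None)//=; congr (op _ _).
rewrite (reindex_omap (@Some 'I_k) id)/=; last by case.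
by apply: eq_bigl => i; rewrite eqxx.
Qed.

Section independent_boxes.
Context {d} {T : measurableType d} {R : realType} (P : probability T R) (k : nat).
Variables (F : option 'I_k -> set_system T).

Lemma bigcap_option (A0 : set T) (A : 'I_k -> set T) :
  \bigcap_(o in [set` [set: option 'I_k]%SET]) (if o is Some i then A i else A0) =
  [set w | A0 w /\ forall i, A i w].
Proof.
apply/seteqP; split=> w /=.
  move=> h; split=> [|i]; first by apply: (h None); rewrite /= inE.
  by apply: (h (Some i)); rewrite /= inE.
by move=> [h0 h] [i|] _.
Qed.

Lemma mutually_independent_box (A0 : set T) (A : 'I_k -> set T) :
  mutually_independent P F -> F None A0 -> (forall i, F (Some i) (A i)) ->
  P [set w | A0 w /\ forall i, A i w] = (P A0 * \prod_i P (A i))%E.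
Proof.
move=> ind F0 FA; rewrite -bigcap_option ind ?big_option//.
by case.
Qed.

End independent_boxes.

Section centered.
Context {d} {T : measurableType d} {R : realType} (P : probability T R) (m : nat).
Variables (p : {RV P >-> m.-tuple R}) (Ut : nat -> {RV P >-> R}).
Hypothesis hUt : centered_uniforms p Ut.

Definition recentered (w : T) : m.-1.-tuple R := [tuple Ut i w + 2^-1 | i < m.-1].

Lemma measurable_recentered : measurable_fun [set: T] recentered.
Proof.
apply: measurable_mktuple => i; apply: (@measurable_funD _ _ R) => //.
Qed.

Lemma centered_integral (G : m.-tuple R * m.-1.-tuple R -> \bar R) :
  measurable_fun [set: m.-tuple R * m.-1.-tuple R] G -> (forall z, 0 <= G z)%E ->
  (\int[P]_w G (p w, recentered w) = \int[P]_w cube_integral (fun U => G (p w, U)))%E.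
Proof.
move=> mG G0; have [uUt iUt] := hUt.
have mp : measurable_fun [set: T] p by [].
rewrite (rectangle_integral mp measurable_recentered (nu := distribution P p))//.
- rewrite ge0_integral_distribution//; first exact: measurable_cube_integral.
  by move=> x; apply: cube_integral_ge0 => U; exact: G0.
- by rewrite [X in (X < _)%E]probability_setT ltry.
move=> A B mA mB.
rewrite (_ : [set w | _] = [set w | (p @^-1` A) w /\
    forall i : 'I_m.-1, (Ut i @^-1` [set x | B i (x + 2^-1)]) w]); last first.
  by apply/seteqP; split=> w /= [Aw h]; split=> // i; have := h i; rewrite tnth_mktuple.
have mB' i : measurable [set x : R | B i (x + 2^-1)].
  have mf : measurable_fun [set: R] (fun x : R => x + 2^-1) by exact: (@measurable_funD _ R R).
  by rewrite -[X in measurable X]setTI; exact: mf.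
apply: etrans (mutually_independent_box iUt _ _) _.
- by exists A => //; rewrite setTI.
- by move=> i; exists [set x | B i (x + 2^-1)] => //; rewrite setTI.
congr (_ * _)%E; apply: eq_bigr => i _.
rewrite -(uniform_shift_law (a := - 2^-1) (b := 2^-1) (X := Ut i))//.
- by congr (P _); apply/seteqP; split=> w /=; rewrite opprK.
- by rewrite opprK; lra.
- exact: uUt.
Qed.

End centered.

Section divisor_limit_variables.
Context {d} {T : measurableType d} {R : realType} (P : probability T R) (m : nat).
Variables (p : {RV P >-> m.-tuple R}) (U : 'I_m -> {RV P >-> R}) (J : T -> 'I_m).
Hypothesis hU : divisor_variables p U J.

Definition uniform_vector (w : T) : m.-tuple R := [tuple U i w | i < m].

Lemma measurable_uniform_vector : measurable_fun [set: T] uniform_vector.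
Proof. by apply: measurable_mktuple => i. Qed.

Let mJ j : measurable [set w | J w = j]. Proof. by have [] := hU. Qed.

(** [cond_independent] is stated for versions of conditional probabilities; by independence from
    [p], a constant is such a version for [U i]. *)
Lemma cond_prob_independent (B : set R) i : measurable B ->
  cond_prob P (sigma_of p) (U i @^-1` B) (fun=> fine (P (U i @^-1` B))).
Proof.
move=> mB; have [_ iU _ _ _] := hU.
have mp : measurable_fun [set: T] p by [].
have mU : measurable_fun [set: T] (U i) by [].
have mUB : measurable (U i @^-1` B) by rewrite -[X in measurable X]setTI; exact: mU.
have fU : P (U i @^-1` B) \is a fin_num by exact: fin_num_measure.
split.
- move=> C mC; case: (pselect (C (fine (P (U i @^-1` B))))) => hC.
    by exists setT => //; rewrite setTI; apply/seteqP; split.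
  by exists set0 => //; rewrite setTI; apply/seteqP; split.
- by apply: finite_measure_integrable_cst.
move=> _ [A mA <-]; rewrite setTI integral_cst//; last first.
  by rewrite -[X in measurable X]setTI; exact: mp.
rewrite fineK//.
pose A' (o : option 'I_m) := if o is Some i then U i @^-1` B else p @^-1` A.
have := iU [set None; Some i]%SET A'.
rewrite big_setU1 ?inE//= big_set1/= muleC => <-.
- congr (P _); apply/seteqP; split=> w /=.
    move=> h; split; first by apply: (h (Some i)); rewrite /= !inE eqxx orbT.
    by apply: (h None); rewrite /= !inE eqxx.
  by move=> [hB hA] [l|] //=; rewrite !inE => /eqP[->].
- by move=> [l|] /=; rewrite !inE//= => _; [exists B|exists A] => //; rewrite setTI.
Qed.

(** Conditional independence with constant versions for the [U i]: the constants leave the integral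
    over the event that [p] lies in [A], and there remains the integral of the conditional
    probability of [J = j]. *)
Lemma seat_law_box j A (B : 'I_m -> set R) : measurable A -> (forall i, measurable (B i)) ->
  P [set w | [/\ J w = j, A (p w) & forall i, B i (U i w)]] =
  (P ([set w | J w = j] `&` p @^-1` A) * \prod_i P (U i @^-1` B i))%E.
Proof.
move=> mA mB; have [_ _ _ cJ ci] := hU.
pose E (o : option 'I_m) := if o is Some i then U i @^-1` B i else [set w | J w = j].
pose g (o : option 'I_m) w := if o is Some i then fine (P (U i @^-1` B i)) else tnth (p w) j.
have [|_ _ /(_ (p @^-1` A))] := ci [set: option 'I_m]%SET E g.
  move=> [i|] _; last by split; [exists [set j] => //; rewrite setTI|exact: cJ].
  by split; [exists (B i) => //; rewrite setTI|exact: cond_prob_independent].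
have -> : P [set w | [/\ J w = j, A (p w) & forall i, B i (U i w)]] =
    P (\bigcap_(o in [set` [set: option 'I_m]%SET]) E o `&` p @^-1` A).
  congr (P _); apply/seteqP; split=> w /=.
    by move=> [Jw Aw Bw]; split=> // -[i|] _ //; exact: Bw.
  move=> [h Aw]; split=> //; first by apply: (h None); rewrite /= inE.
  by move=> i; apply: (h (Some i)); rewrite /= inE.
have Sp : sigma_of p (p @^-1` A) by exists A => //; rewrite setTI.
have mp : measurable_fun [set: T] p by [].
have mS : measurable (p @^-1` A) by rewrite -[X in measurable X]setTI; exact: mp.
move=> /(_ Sp) <-; have [_ iJ /(_ _ Sp) <-] := cJ j.
pose c := \prod_i fine (P (U i @^-1` B i)).
have cE : (\prod_i P (U i @^-1` B i) = c%:E)%E.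
  rewrite /c -prodEFin; apply: eq_bigr => i _; rewrite fineK//; apply: fin_num_measure.
  by rewrite -[X in measurable X]setTI; apply: (@measurable_funPT _ _ _ _ (U i)).
rewrite cE -integralZr//; last by apply: (integrableS _ _ _ iJ).
by apply: eq_integral => w _; rewrite big_option -EFinM.
Qed.

Hypothesis p_simplex : {ae P, forall w, simplex (p w)}.

(** Weighting [P] by the indicator of [J = j] gives the law of [p] the density [tnth p j] and leaves
    the [U i] uniform and independent of [p]. The truncation at 0 makes this density nonnegative
    everywhere, since [p] is in the simplex only almost surely. *)
Lemma seat_integral j (G : m.-tuple R * m.-tuple R -> \bar R) :
  measurable_fun [set: m.-tuple R * m.-tuple R] G -> (forall z, 0 <= G z)%E ->
  (\int[P]_w (G (p w, uniform_vector w) * (\1_[set w | J w = j] w : R)%:E) =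
   \int[P]_w (cube_integral (fun V => G (p w, V)) * (Num.max 0 (tnth (p w) j))%:E))%E.
Proof.
move=> mG G0; have mp : measurable_fun [set: T] p by [].
have mI : measurable_fun [set: T] (\1_[set w | J w = j] : _ -> R) by exact: measurable_indic.
have I0 w : 0 <= \1_[set w | J w = j] w :> R by rewrite indicE ler0n.
have mx : measurable_fun [set: m.-tuple R] (fun t => Num.max 0 (tnth t j) : R).
  by apply: measurable_maxr => //; exact: measurable_tnth.
have x0 (t : m.-tuple R) : 0 <= Num.max 0 (tnth t j) by rewrite le_max lexx.
have mGU : measurable_fun [set: T] (fun w => G (p w, uniform_vector w)).
  by apply: (measurableT_comp mG); apply: measurable_fun_pair => //; exact: measurable_uniform_vector.
have mcG : measurable_fun [set: m.-tuple R] (fun x => cube_integral (fun V => G (x, V))).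
  exact: measurable_cube_integral.
have cG0 x : (0 <= cube_integral (fun V => G (x, V)))%E.
  by apply: cube_integral_ge0 => V; exact: G0.
have nuE A : measurable A ->
    density (distribution P p) mx x0 A = P ([set w | J w = j] `&` p @^-1` A).
  move=> mA; have mS : measurable (p @^-1` A) by rewrite -[X in measurable X]setTI; exact: mp.
  have Sp : sigma_of p (p @^-1` A) by exists A => //; rewrite setTI.
  have [_ _ _ cJ _] := hU; have [_ iJ <-//] := cJ j.
  rewrite densityE ge0_integral_distribution//; last 2 first.
  - apply/measurable_EFinP; apply: (@measurable_funM _ _ R) => //; exact: measurable_indic.
  - by move=> x; rewrite lee_fin mulr_ge0// indicE ler0n.
  rewrite [RHS]integral_mkcond; apply: ae_eq_integral => //.
  - apply/measurable_EFinP; apply: (@measurable_funM _ _ R).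
      by apply: (measurableT_comp _ mp); exact: measurable_indic.
    exact: (measurableT_comp mx mp).
  - apply/(measurable_restrictT _ _).1 => //; apply/measurable_EFinP.
    by apply: measurable_funTS; exact: measurable_tnth_comp.
  apply: filterS p_simplex => w [pw _] _; have /andP[/ltW pj _] := pw j.
  rewrite /= patchE (max_idPr pj) indicE.
  have -> : (w \in p @^-1` A) = (p w \in A) by apply/idP/idP => /set_mem h; apply/mem_set.
  by case: ifP; rewrite ?mul1r ?mul0r.
rewrite -(ge0_integral_density P mI I0 mGU)//.
rewrite (rectangle_integral mp measurable_uniform_vector
  (nu := density (distribution P p) mx x0))//.
- rewrite ge0_integral_density// ge0_integral_distribution//.
    by apply: emeasurable_funM => //; exact/measurable_EFinP.
  by move=> x; apply: mule_ge0; rewrite ?lee_fin.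
- by rewrite [X in (X < _)%E]nuE// (le_lt_trans (probability_le1 _ _)) ?ltry//;
    apply: measurableI => //; rewrite preimage_setT.
move=> A B mA mB; rewrite [X in (_ = X * _)%E]nuE//.
have mS : measurable [set w | A (p w) /\ forall i, B i (tnth (uniform_vector w) i)].
  apply: measurableI; first by rewrite -[X in measurable X]setTI; exact: mp.
  rewrite -[X in measurable X]setTI; exact: (measurable_uniform_vector measurableT (measurable_box mB)).
rewrite -[LHS]/(\int[P]_(w in _) (\1_[set w | J w = j] w : R)%:E)%E integral_indic//.
apply: etrans (etrans (seat_law_box j mA mB) _).
  congr (P _); apply/seteqP; split=> w /=.
    by move=> [Jw [Aw Bw]]; split=> // i; have := Bw i; rewrite tnth_mktuple.
  by move=> [Jw Aw Bw]; split=> //; split=> // i; rewrite tnth_mktuple.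
have [uU _ _ _ _] := hU.
congr (_ * _)%E; apply: eq_bigr => i _.
rewrite -(uniform_shift_law (a := 0) (b := 1) (X := U i)) ?subr0//.
by congr (P _); apply/seteqP; split=> w /=; rewrite subr0.
Qed.

Lemma seats_integral (G : 'I_m -> m.-tuple R * m.-tuple R -> \bar R) :
  (forall j, measurable_fun [set: m.-tuple R * m.-tuple R] (G j)) ->
  (forall j z, 0 <= G j z)%E ->
  (\int[P]_w G (J w) (p w, uniform_vector w) =
   \int[P]_w \sum_j (tnth (p w) j)%:E * cube_integral (fun V => G j (p w, V)))%E.
Proof.
move=> mG G0; have mp : measurable_fun [set: T] p by [].
have mGU j : measurable_fun [set: T] (fun w => G j (p w, uniform_vector w)).
  by apply: (measurableT_comp (mG j)); apply: measurable_fun_pair => //; exact: measurable_uniform_vector.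
have mcG j : measurable_fun [set: T] (fun w => cube_integral (fun V => G j (p w, V))).
  exact: (measurableT_comp (measurable_cube_integral (mG j) (G0 j)) mp).
have cG0 j x : (0 <= cube_integral (fun V => G j (x, V)))%E.
  by apply: cube_integral_ge0 => V; exact: G0.
have mt j : measurable_fun [set: T] (fun w => tnth (p w) j) by exact: measurable_tnth_comp.
have mx j : measurable_fun [set: T] (fun w => Num.max 0 (tnth (p w) j) : R).
  exact: measurable_maxr.
transitivity (\int[P]_w \sum_j (G j (p w, uniform_vector w) * (\1_[set w | J w = j] w : R)%:E))%E.
  apply: eq_integral => w _; rewrite (bigD1 (J w))//= big1 ?adde0.
    by rewrite indicE mem_set// mule1.
  move=> j jJ; rewrite indicE (_ : _ \in _ = false) ?mule0//; apply/negbTE.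
  by apply: contra jJ => /set_mem /= ->.
rewrite ge0_integral_sum//; last 2 first.
- by move=> j; apply: emeasurable_funM => //; apply/measurable_EFinP; exact: measurable_indic.
- by move=> j w _; apply: mule_ge0 => //; rewrite lee_fin indicE ler0n.
rewrite (eq_bigr _ (fun j _ => seat_integral j (mG j) (G0 j))).
rewrite -ge0_integral_sum//; last 2 first.
- by move=> j; apply: emeasurable_funM => //; apply/measurable_EFinP.
- by move=> j w _; apply: mule_ge0 => //; rewrite lee_fin le_max lexx.
apply: ae_eq_integral => //.
- by apply: emeasurable_sum => j; apply: emeasurable_funM => //; apply/measurable_EFinP.
- by apply: emeasurable_sum => j; apply: emeasurable_funM => //; apply/measurable_EFinP.
apply: filterS p_simplex => w [pw _] _; apply: eq_bigr => j _.
by have /andP[/ltW pj _] := pw j; rewrite (max_idPr pj) muleC.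
Qed.

End divisor_limit_variables.

Lemma lt1_of_sum {R : realType} k (q : 'I_k.+2 -> R) i : \sum_j q j = 1 ->
  (forall j, 0 < q j) -> q i < 1.
Proof.
move=> q1 q0; rewrite -q1 (bigD1 i)//= ltrDl.
have [j ji] : exists j : 'I_k.+2, j != i by exists (lift i ord0); rewrite eq_sym neq_lift.
by rewrite (bigD1 j)//=; apply: ltr_pwDl => //; apply: sumr_ge0 => l _; exact: ltW.
Qed.

Lemma seq_continuous_tnth {R : realType} k (i : 'I_k) :
  seq_continuous (fun t : k.-tuple R => tnth t i).
Proof. by move=> u t; apply. Qed.

(** The function may take both signs: it will be [limit_mean], which is known to be nonnegative on
    the simplex only. *)
Lemma integral_same_law {R : realType} {d1 d2 d} {T1 : measurableType d1}
    {T2 : measurableType d2} {E : measurableType d}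
    (P1 : probability T1 R) (X1 : {RV P1 >-> E}) (P2 : probability T2 R) (X2 : {RV P2 >-> E})
    (f : E -> \bar R) : same_law P1 X1 P2 X2 ->
  measurable_fun [set: E] f -> (\int[P1]_w f (X1 w) = \int[P2]_w f (X2 w))%E.
Proof.
move=> X12 mf.
have ge0 (h : E -> \bar R) : measurable_fun [set: E] h -> (forall x, 0 <= h x)%E ->
    (\int[P1]_w (h \o X1) w = \int[P2]_w (h \o X2) w)%E.
  move=> mh h0; rewrite -[LHS]ge0_integral_distribution// -[RHS]ge0_integral_distribution//.
  by apply: eq_measure_integral => A mA _; exact: X12.
have split_pos d3 (T3 : measurableType d3) (P3 : probability T3 R)
    (X : T3 -> E) : (\int[P3]_w f (X w) =
    \int[P3]_w (f^\+ \o X) w - \int[P3]_w (f^\- \o X) w)%E.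
  by rewrite -funepos_comp -funeneg_comp -integralE.
rewrite !split_pos; congr (_ - _)%E.
- exact: (ge0 _ (measurable_funepos mf) (funepos_ge0 f)).
- exact: (ge0 _ (measurable_funeneg mf) (funeneg_ge0 f)).
Qed.

Section coordinate_law.
Context {R : realType} (k : nat).
Local Open Scope ereal_scope.

Lemma exit_coordinate (q : 'I_k.+2 -> R) (c : R) i (H : R -> \bar R) :
  (\sum_j q j = 1)%R -> (forall j, (0 < q j)%R) ->
  measurable_fun [set: R] H -> (forall x, 0 <= H x) ->
  \sum_j (q j)%:E * cube_integral (fun U => H (tnth (flow_exit q c j U) i)) =
  cube_integral (fun W : k.+1.-tuple R =>
    H (q i * c + (tnth W ord0 - (1 - q i) + q i * (tsum W - tnth W ord0)))%R).
Proof.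
move=> q1 q0 mH H0.
have mHc : measurable_fun [set: R] (fun y => H (q i * c + y)%R).
  by apply: (measurableT_comp mH); apply: (@measurable_funD _ _ R).
rewrite -(exit_marginal q1 q0 (lt1_of_sum i q1 q0) mHc (fun _ => H0 _)).
apply: eq_bigr => j _; congr (_ * _); apply: eq_integral => U _; congr (_ * H _).
by rewrite tnth_flow_exit; ring.
Qed.

Context {d} {T : measurableType d} {P : probability T R}.
Variables (p : {RV P >-> k.+2.-tuple R}) (Ut : nat -> {RV P >-> R}).
Hypothesis hUt : centered_uniforms p Ut.
Hypothesis p_simplex : {ae P, forall w, simplex (p w)}.
Variables (q : k.+2.-tuple R -> 'I_k.+2 -> R) (g kap c : R).
Hypothesis q_gt0 : forall x, simplex x -> forall i, (0 < q x i)%R.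
Hypothesis q_sum : forall x, simplex x -> (\sum_i q x i = 1)%R.
Hypothesis q_cont : forall i, seq_continuous (q^~ i).

(** The form of [Y] is that of [exit_coordinate] in centered variables. Each is a variable uniform
    on the unit interval minus [1 / 2], whence [2^-1] and [k%:R / 2]; subtracting [1 - q (p w) i]
    moves the unit interval to the one found in [exit_marginal]. *)
Lemma centered_coordinate i (H : R -> \bar R) (Y : T -> R) :
  measurable_fun [set: R] H -> (forall x, 0 <= H x) ->
  (forall w, Y w = q (p w) i * c + (Ut 0%N w + 2^-1 - (1 - q (p w) i)
     + q (p w) i * (\sum_(1 <= l < k.+1) Ut l w + k%:R / 2)) + g * tnth (p w) i - kap)%R ->
  measurable_fun [set: k.+2.-tuple R] (fun x => \sum_j (q x j)%:E *
    cube_integral (fun U => H (tnth (flow_exit (q x) c j U) i + g * tnth x i - kap)%R)) ->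
  \int[P]_w H (Y w) = \int[P]_w \sum_j (q (p w) j)%:E *
    cube_integral (fun U => H (tnth (flow_exit (q (p w)) c j U) i + g * tnth (p w) i - kap)%R).
Proof.
move=> mH H0 YE mS.
pose arg (z : k.+2.-tuple R * k.+1.-tuple R) : R :=
  (q z.1 i * c + (tnth z.2 ord0 - (1 - q z.1 i) + q z.1 i * (tsum z.2 - tnth z.2 ord0))
   + g * tnth z.1 i - kap)%R.
have mq : measurable_fun [set: k.+2.-tuple R * k.+1.-tuple R] (fun z => q z.1 i).
  exact: (measurableT_comp (seq_continuous_measurable (@q_cont i))).
have m0 : measurable_fun [set: k.+2.-tuple R * k.+1.-tuple R] (fun z => tnth z.2 ord0).
  exact: measurable_tnth_comp.
have m1 : measurable_fun [set: k.+2.-tuple R * k.+1.-tuple R] (fun z => tnth z.1 i).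
  exact: measurable_tnth_comp.
have mt : measurable_fun [set: k.+2.-tuple R * k.+1.-tuple R] (fun z => tsum z.2).
  exact: (measurableT_comp (@measurable_tsum _ _)).
have marg : measurable_fun [set: k.+2.-tuple R * k.+1.-tuple R] arg.
  apply: (@measurable_funB _ _ R) => //; apply: (@measurable_funD _ _ R); last exact: (@measurable_funM _ _ R).
  apply: (@measurable_funD _ _ R); first exact: (@measurable_funM _ _ R).
  apply: (@measurable_funD _ _ R).
    by apply: (@measurable_funB _ _ R) => //; exact: (@measurable_funB _ _ R).
  by apply: (@measurable_funM _ _ R) => //; exact: (@measurable_funB _ _ R).
have mG := measurableT_comp mH marg.
transitivity (\int[P]_w (H \o arg) (p w, recentered k.+2 Ut w)).
  apply: eq_integral => w _.
  pose W : k.+1.-tuple R := recentered k.+2 Ut w.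
  have W0 : (tnth W ord0 = Ut 0%N w + 2^-1)%R by rewrite [LHS]tnth_mktuple.
  have WS : (tsum W = Ut 0%N w + 2^-1 + (\sum_(1 <= l < k.+1) Ut l w + k%:R / 2))%R.
    rewrite /tsum big_ord_recl W0; congr (_ + _)%R.
    rewrite (eq_bigr (fun l : 'I_k => Ut l.+1 w + 2^-1))%R; last first.
      by move=> l _; rewrite [LHS]tnth_mktuple.
    rewrite big_split/= sumr_const card_ord -[X in (_ + X = _)%R]mulr_natl.
    by rewrite big_add1 big_mkord.
  rewrite -[RHS]/(H (arg (p w, W))); congr (H _).
  by rewrite YE /arg /= W0 WS; ring.
rewrite (centered_integral hUt mG (fun _ => H0 _)).
have mp : measurable_fun [set: T] p by [].
apply: ae_eq_integral => //.
- exact: (measurableT_comp (measurable_cube_integral mG (fun _ => H0 _)) mp).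
- exact: (measurableT_comp mS mp).
apply: filterS p_simplex => w sw _.
have mHw : measurable_fun [set: R] (fun y => H (y + g * tnth (p w) i - kap)%R).
  apply: (measurableT_comp mH); apply: (@measurable_funB _ _ R) => //.
  exact: (@measurable_funD _ _ R).
by rewrite (exit_coordinate c i (q_sum sw) (q_gt0 sw) mHw (fun _ => H0 _)).
Qed.

End coordinate_law.

Section limit_identities.
Context {R : realType} (k : nat).
Context {d} {T : measurableType d} {P : probability T R}.
Variable (p : {RV P >-> k.+2.-tuple R}).
Hypothesis p_simplex : {ae P, forall w, simplex (p w)}.
Local Open Scope ereal_scope.

Lemma limit_mean_coordinate q g kap i (f : R -> R) (x : k.+2.-tuple R) :
  limit_mean q g kap (fun t => f (tnth t i)) x =
  \sum_j (q x j)%:E * cube_integral (fun U =>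
    (f (tnth (flow_exit (q x) (shift_constant k.+1 g kap) j U) i + g * tnth x i - kap)%R)%:E).
Proof.
apply: eq_bigr => j _; congr (_ * _); apply: eq_integral => U _; congr (_ * _%:E).
by rewrite /limit_err tnth_mktuple.
Qed.

Lemma divisor_Xbar_integral beta (Ut : nat -> {RV P >-> R}) i (f : R -> R) :
  centered_uniforms p Ut -> seq_continuous (fun t : k.+2.-tuple R => f (tnth t i)) ->
  measurable_fun [set: R] f -> (forall x, (0 <= f x)%R) ->
  \int[P]_w (f (divisor_Xbar beta p Ut i w))%:E =
  \int[P]_w limit_mean (fun x => tnth x) 0 (beta - 1) (fun t => f (tnth t i)) (p w).
Proof.
move=> hUt fc mf f0.
have x0 (x : k.+2.-tuple R) : simplex x -> forall i, (0 < tnth x i)%R.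
  by move=> [h _] l; have /andP[] := h l.
have x1 (x : k.+2.-tuple R) : simplex x -> (\sum_i tnth x i = 1)%R by case.
have := measurable_limit_mean 0 (beta - 1) (@seq_continuous_tnth R k.+2) fc (fun _ => f0 _).
rewrite (funext (limit_mean_coordinate _ _ _ _ _)) => mS.
have mH : measurable_fun [set: R] (EFin \o f) by exact/measurable_EFinP.
have H0 x : 0 <= (EFin \o f) x by rewrite lee_fin.
apply: (centered_coordinate hUt p_simplex x0 x1 (@seq_continuous_tnth R k.+2) mH H0 _ mS).
(* The coefficient [beta - 1 / 2] is [beta - 1], from [kap] and the shift constant, plus [1 / 2],
   from the centering, whose constants add up to half of [m * p_i - 1]. *)
move=> w; rewrite /divisor_Xbar /shift_constant -[k.+2%:R]natr1 -[k.+1%:R]natr1.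
by field.
Qed.

Lemma quota_Y_integral gamma (Ut : nat -> {RV P >-> R}) i (H : R -> \bar R) :
  centered_uniforms p Ut -> measurable_fun [set: R] H -> (forall x, 0 <= H x) ->
  measurable_fun [set: k.+2.-tuple R] (fun x => \sum_(j < k.+2) (k.+2%:R^-1 : R)%:E *
    cube_integral (fun U => H (tnth (flow_exit (fun=> k.+2%:R^-1) (- gamma) j U) i + gamma * tnth x i)%R)) ->
  \int[P]_w H (quota_Y gamma p Ut i w) =
  \int[P]_w \sum_(j < k.+2) (k.+2%:R^-1 : R)%:E *
    cube_integral (fun U => H (tnth (flow_exit (fun=> k.+2%:R^-1) (- gamma) j U) i + gamma * tnth (p w) i)%R).
Proof.
move=> hUt mH H0 mS.
have E (x : k.+2.-tuple R) : \sum_(j < k.+2) (k.+2%:R^-1 : R)%:E *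
    cube_integral (fun U => H (tnth (flow_exit (fun=> k.+2%:R^-1) (- gamma) j U) i + gamma * tnth x i)%R) =
    \sum_(j < k.+2) (k.+2%:R^-1 : R)%:E *
    cube_integral (fun U => H (tnth (flow_exit (fun=> k.+2%:R^-1) (- gamma) j U) i + gamma * tnth x i - 0)%R).
  by apply: eq_bigr => j _; congr (_ * _); apply: eq_integral => U _; rewrite subr0.
under [RHS]eq_integral do rewrite E.
move: mS; rewrite (funext E) => mS.
apply: (centered_coordinate hUt p_simplex _ _ _ mH H0 _ mS).
- by move=> x _ _; rewrite invr_gt0.
- by move=> x _; rewrite sumr_const card_ord -[LHS]mulr_natl divff.
- by move=> l u t _; exact: cvg_cst.
(* Here the centering constants cancel, because [m * q = 1]. *)
move=> w; rewrite /quota_Y -[k.+2%:R]natr1 -[k.+1%:R]natr1.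
have : (0 <= k%:R :> R)%R by [].
by move=> k0; field; rewrite gt_eqF//; lra.
Qed.

Lemma divisor_X_integral beta (U : 'I_k.+2 -> {RV P >-> R}) (J : T -> 'I_k.+2)
    (F : k.+2.-tuple R -> R) :
  divisor_variables p U J -> seq_continuous F -> (forall t, (0 <= F t)%R) ->
  \int[P]_w (F [tuple divisor_X beta p U J i w | i < k.+2])%:E =
  \int[P]_w limit_mean (fun x => tnth x) 0 (beta - 1) F (p w).
Proof.
move=> hU Fc F0.
pose c : R := shift_constant k.+1 0 (beta - 1).
pose G (j : 'I_k.+2) (z : k.+2.-tuple R * k.+2.-tuple R) :=
  (F (limit_err 0 (beta - 1) z.1 (flow_exit (tnth z.1) c j z.2)))%:E.
have mG j : measurable_fun [set: k.+2.-tuple R * k.+2.-tuple R] (G j).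
  apply/measurable_EFinP.
  exact: (measurable_exit_value 0 (beta - 1) (@seq_continuous_tnth R k.+2) j Fc).
rewrite -(seats_integral hU p_simplex mG); last by move=> j z; rewrite lee_fin.
apply: eq_integral => w _; congr (F _)%:E; apply: eq_from_tnth => i.
rewrite /limit_err !tnth_mktuple/= /c /shift_constant /divisor_X.
(* Putting 0 at [J] removes [U J] from the total, exactly as [flow_exit] does at the face [J]. *)
have -> : (\sum_(j < k.+2) divisor_V U J j w =
   tsum (uniform_vector U w) - tnth (uniform_vector U w) (J w))%R.
  rewrite /tsum (bigD1 (J w))//= [in RHS](bigD1 (J w))//=.
  rewrite {1}/divisor_V eqxx add0r [(tnth _ (J w) + _)%R]addrC addrK.
  apply: eq_bigr => l lJ; rewrite /divisor_V lJ; by rewrite tnth_mktuple.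
by rewrite /divisor_V; case: eqP => _ /=; rewrite ?tnth_mktuple; ring.
Qed.

End limit_identities.

(** * The two methods *)

Section outcomes.
Context {R : realType} (n : nat).

Lemma divisor_outcome_rounded beta N (p : n.+1.-tuple R) s :
  divisor_outcome beta N p s -> rounded (tnth p) (target 0 (beta - 1) N p) N s.
Proof.
move=> [[D [D0 Ds]] sN]; split=> //; exists (D^-1 - N%:R) => i.
have [k [/andP[k1 k2] sk]] := Ds i; exists k; rewrite /target addr0; split; last by right.
by apply/andP; split; [move: k1|move: k2]; lra.
Qed.

Lemma quota_outcome_rounded gamma N (p : n.+1.-tuple R) s :
  quota_outcome gamma N p s -> rounded (fun=> n.+1%:R^-1) (target gamma 0 N p) N s.
Proof.
move=> [[alpha sE] sN]; split=> //; exists (n.+1%:R * (1 - alpha)) => i.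
have /andP[k1 k2] := sE i; exists (s i); rewrite /target mulrA mulVf// mul1r subr0.
by split; [apply/andP; split; [move: k2|move: k1]; lra|left].
Qed.

Lemma divisor_admissible_near (beta : R) : \forall N \near \oo, divisor_admissible n.+1 beta N.
Proof.
exists (`|(n.+1%:Z * (Num.floor `|beta| + 1))%R|)%N => // N /= hN _.
by rewrite (le_trans (ler_norm _))// -abszE lez_nat.
Qed.

Lemma quota_admissible_near (gamma : R) : \forall N \near \oo, quota_admissible gamma N.
Proof.
near=> N; rewrite /quota_admissible -ltrBlDr sub0r; near: N; exact: nbhs_infty_gtr.
Unshelve. all: by end_near. Qed.

End outcomes.

Lemma row_of_tuple_seq_continuous {R : realType} k (f : 'rV[R]_k -> R) : continuous f ->
  seq_continuous (fun t : k.-tuple R => f (row_of_tuple t)).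
Proof.
move=> fc u t ut; apply: (cvg_comp (fun N => row_of_tuple (u N)) f _ (fc _)).
move=> A [Q Qt QA]; rewrite /= nbhs_filterE.
have : \forall N \near \oo, forall i : 'I_k, Q ord0 i (tnth (u N) i).
  apply: filter_forall => i; apply: ut; have := Qt ord0 i; by rewrite mxE.
by apply: filterS => N h; apply: QA => i j; rewrite ord1 mxE.
Qed.

Lemma tnth_seq_continuous {R : realType} k (i : 'I_k) (f : R -> R) : continuous f ->
  seq_continuous (fun t : k.-tuple R => f (tnth t i)).
Proof. by move=> fc u t ut; apply: continuous_cvg; [exact: fc|exact: ut]. Qed.

Section bounded_expectations.
Context {R : realType}.
Local Open Scope ereal_scope.

(** Test functions are bounded but of any sign, whereas [main_convergence] concerns nonnegative
    ones; adding the bound [M] passes from one to the other. *)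
Lemma expectation_shift {d} {T : measurableType d} (P : probability T R) (h : T -> R) (M : R) :
  measurable_fun [set: T] h -> (forall w, (`|h w| <= M)%R) ->
  'E_P[h] = \int[P]_w (h w + M)%:E - M%:E.
Proof.
move=> mh hM.
have ih : P.-integrable setT (EFin \o h).
  apply: (@le_integrable _ _ _ P setT measurableT _ (cst M%:E)).
  - exact/measurable_EFinP.
  - by move=> w _ /=; rewrite lee_fin (le_trans (hM w))// ler_norm.
  - exact: finite_measure_integrable_cst.
rewrite unlock; under [in RHS]eq_integral do rewrite EFinD.
rewrite integralD//; last exact: finite_measure_integrable_cst.
by rewrite integral_cst// [X in _ * X]probability_setT mule1 addeK.
Qed.

Lemma cvg_expectation {d1 d2} {T1 : measurableType d1} {T2 : measurableType d2}
    (P1 : probability T1 R) (P2 : probability T2 R) (h : nat -> T1 -> R) (h' : T2 -> R) (M : R) :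
  (\forall N \near \oo, measurable_fun [set: T1] (h N)) -> measurable_fun [set: T2] h' ->
  (forall N w, (`|h N w| <= M)%R) -> (forall w, (`|h' w| <= M)%R) ->
  \int[P1]_w (h N w + M)%:E @[N --> \oo] --> \int[P2]_w (h' w + M)%:E ->
  'E_P1[h N] @[N --> \oo] --> 'E_P2[h'].
Proof.
move=> mh mh' hM h'M hh'; rewrite (expectation_shift P2 mh' h'M).
apply: (@cvg_trans _ ((\int[P1]_w (h N w + M)%:E - M%:E) @[N --> \oo])).
  by apply: near_eq_cvg; apply: filterS mh => N mhN; rewrite (expectation_shift P1 mhN (hM N)).
apply: cvgeB => //; last exact: cvg_cst.
by rewrite fin_num_adde_defl.
Qed.

End bounded_expectations.

Lemma simplex_same_law {R : realType} {d1 d2} {T1 : measurableType d1} {T2 : measurableType d2}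
    {m} {P1 : probability T1 R} {P2 : probability T2 R}
    (p1 : {RV P1 >-> m.+1.-tuple R}) (p2 : {RV P2 >-> m.+1.-tuple R}) :
  same_law P1 p1 P2 p2 -> {ae P1, forall w, simplex (p1 w)} -> {ae P2, forall w, simplex (p2 w)}.
Proof.
move=> p12 s1; have mS := @measurable_simplex R m.
have mp1 : measurable_fun [set: T1] p1 by [].
have mp2 : measurable_fun [set: T2] p2 by [].
have m1 : measurable (p1 @^-1` ~` (@simplex R m.+1)).
  by rewrite -[X in measurable X]setTI; apply: mp1 => //; exact: measurableC.
have m2 : measurable (p2 @^-1` ~` (@simplex R m.+1)).
  by rewrite -[X in measurable X]setTI; apply: mp2 => //; exact: measurableC.
exists (p2 @^-1` ~` (@simplex R m.+1)); split=> //.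
rewrite -p12; last exact: measurableC.
by apply/negligibleP.
Qed.

Section convergence.
Context {R : realType} {n : nat} {d} {T : measurableType d} {P : probability T R}.
Variable p : {RV P >-> n.+1.-tuple R}.
Hypothesis p_simplex : {ae P, forall w, simplex (p w)}.
Hypothesis p_ac : distribution P p `<< simplex_lebesgue (m := n.+1).
Variables (q : n.+1.-tuple R -> 'I_n.+1 -> R) (g kap : R).
Hypothesis q_gt0 : forall x, simplex x -> forall i, 0 < q x i.
Hypothesis q_sum : forall x, simplex x -> \sum_i q x i = 1.
Hypothesis q_cont : forall i, seq_continuous (q^~ i).
Variable s : nat -> T -> 'I_n.+1 -> int.
Hypothesis s_rounded : \forall N \near \oo, measurable_seats (s N) /\
  {ae P, forall w, rounded (q (p w)) (target g kap N (p w)) N (s N w)}.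

(** Reduces each of the four convergences to one identity between the mean of the limit variable, on
    its own probability space, and the mean of [limit_mean]. *)
Lemma err_convergence {d'} {T' : measurableType d'} (P' : probability T' R)
    (F : n.+1.-tuple R -> R) (M : R) (h : T' -> R) :
  seq_continuous F -> (forall t, `|F t| <= M) ->
  measurable_fun [set: T'] h -> (forall w, `|h w| <= M) ->
  (\int[P']_w (h w + M)%R%:E = \int[P]_w limit_mean q g kap (fun t => F t + M)%R (p w))%E ->
  'E_P[fun w => F (err N (p w) (s N w))]%E @[N --> \oo] --> 'E_P'[h]%E.
Proof.
move=> Fc FM mh hM hE.
apply: (cvg_expectation (M := M)) => //.
- apply: filterS s_rounded => N [ms _].
  exact: (measurableT_comp (seq_continuous_measurable Fc) (measurable_err_seats p N ms)).
rewrite hE.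
apply: (main_convergence p_simplex p_ac q_gt0 q_sum (@q_cont) s_rounded
  (F := fun t => F t + M) (M := M + M)).
  by move=> u t ut; apply: cvgD; [exact: Fc|exact: cvg_cst].
by move=> t; have := FM t; rewrite ler_norml => /andP[h1 h2]; apply/andP; split; lra.
Qed.

End convergence.

Section method_convergence.
Context {R : realType} {k : nat} {d} {T : measurableType d} {P : probability T R}.
Variable p : {RV P >-> k.+2.-tuple R}.
Hypothesis p_simplex : {ae P, forall w, simplex (p w)}.
Hypothesis p_ac : distribution P p `<< simplex_lebesgue (m := k.+2).
Variable s : nat -> T -> 'I_k.+2 -> int.

Let excess_row (f : 'rV[R]_k.+2 -> R) N :
  f \o (fun w => \row_i excess N (p w) (s N w) i) =
  (fun w => f (row_of_tuple (err N (p w) (s N w)))).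
Proof.
apply/funext => w /=; congr f; apply/rowP => i.
by rewrite !mxE /err tnth_mktuple.
Qed.

Let excess_coordinate (f : R -> R) N i :
  f \o (fun w => excess N (p w) (s N w) i) = (fun w => f (tnth (err N (p w) (s N w)) i)).
Proof. by apply/funext => w /=; rewrite /err tnth_mktuple. Qed.

Section divisor.
Variable beta : R.
Hypothesis s_outcome : forall N, divisor_admissible k.+2 beta N ->
  measurable_seats (s N) /\ {ae P, forall w, divisor_outcome beta N (p w) (s N w)}.

Let s_rounded : \forall N \near \oo, measurable_seats (s N) /\
  {ae P, forall w, rounded (tnth (p w)) (target 0 (beta - 1) N (p w)) N (s N w)}.
Proof.
apply: filterS (divisor_admissible_near k.+1 beta) => N /s_outcome[ms so]; split=> //.
by apply: filterS so => w; exact: divisor_outcome_rounded.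
Qed.

Let tnth_gt0 (x : k.+2.-tuple R) : simplex x -> forall i, 0 < tnth x i.
Proof. by move=> [h _] l; have /andP[] := h l. Qed.

Let tnth_sum (x : k.+2.-tuple R) : simplex x -> \sum_i tnth x i = 1.
Proof. by case. Qed.

Lemma divisor_coordinate_cvg {d'} {T' : measurableType d'} (P' : probability T' R)
    (p' : {RV P' >-> k.+2.-tuple R}) (Ut : nat -> {RV P' >-> R}) i :
  same_law P p P' p' -> centered_uniforms p' Ut ->
  cvg_in_distribution P (fun N w => excess N (p w) (s N w) i) P' (divisor_Xbar beta p' Ut i).
Proof.
move=> pp' hUt f fc [M fM].
have mf : measurable_fun [set: R] f by exact: continuous_measurable_fun.
under eq_fun do rewrite excess_coordinate.
have mX : measurable_fun [set: T'] (divisor_Xbar beta p' Ut i).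
  have mp' : measurable_fun [set: T'] p' by [].
  have mi : measurable_fun [set: T'] (fun w => tnth (p' w) i) by exact: measurable_tnth_comp.
  apply: (@measurable_funD _ _ R).
    apply: (@measurable_funD _ _ R) => //; apply: (@measurable_funM _ _ R) => //.
    by apply: (@measurable_funB _ _ R) => //; exact: (@measurable_funM _ _ R).
  by apply: (@measurable_funM _ _ R) => //; exact: (@measurable_sum _ _ R).
have fMc : seq_continuous (fun t : k.+2.-tuple R => f (tnth t i) + M).
  by move=> u t ut; apply: cvgD; [exact: (tnth_seq_continuous fc)|exact: cvg_cst].
have fM0 x : 0 <= f x + M.
  by have := fM x; rewrite ler_norml => /andP[h1 h2]; lra.
apply: (err_convergence p_simplex p_ac tnth_gt0 tnth_sum (@seq_continuous_tnth R k.+2)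
  s_rounded (M := M) (F := fun t => f (tnth t i))) => //.
- exact: tnth_seq_continuous.
- exact: (measurableT_comp mf mX).
- by move=> w; exact: fM.
have mfM : measurable_fun [set: R] (fun x => f x + M) by exact: (@measurable_funD _ _ R).
rewrite (@divisor_Xbar_integral _ _ _ _ _ _ (simplex_same_law pp' p_simplex) beta _ _
  (fun x => f x + M) hUt fMc mfM fM0).
apply/esym; apply: (integral_same_law (f := limit_mean (fun x => tnth x) 0 (beta - 1) _) pp').
by apply: measurable_limit_mean => //; exact: seq_continuous_tnth.
Qed.

Lemma divisor_vector_cvg {d'} {T' : measurableType d'} (P' : probability T' R)
    (p' : {RV P' >-> k.+2.-tuple R}) (U : 'I_k.+2 -> {RV P' >-> R}) (J : T' -> 'I_k.+2) :
  same_law P p P' p' -> divisor_variables p' U J ->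
  cvg_in_distribution P (fun N w => \row_i excess N (p w) (s N w) i)
    P' (fun w => \row_i divisor_X beta p' U J i w).
Proof.
move=> pp' hU f fc [M fM]; under eq_fun do rewrite excess_row.
pose F (t : k.+2.-tuple R) := f (row_of_tuple t).
have Fc : seq_continuous F by exact: row_of_tuple_seq_continuous.
have mX : measurable_fun [set: T'] (fun w => [tuple divisor_X beta p' U J i w | i < k.+2]).
  have mp' : measurable_fun [set: T'] p' by [].
  have mi i : measurable_fun [set: T'] (fun w => tnth (p' w) i) by exact: measurable_tnth_comp.
  have mV i : measurable_fun [set: T'] (divisor_V U J i).
    apply: measurable_fun_ifT => //; apply: (measurable_fun_bool false).
    rewrite setTI (_ : _ @^-1` _ = [set w | J w = i]); first by have [_ _] := hU.
    by apply/seteqP; split=> w /=; [move/negbFE/eqP => ->|move=> ->; rewrite eqxx].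
  apply: measurable_mktuple => i; apply: (@measurable_funD _ _ R).
    apply: (@measurable_funB _ _ R) => //; apply: (@measurable_funM _ _ R) => //.
    exact: (@measurable_sum _ _ R).
  apply: (@measurable_funM _ _ R) => //; apply: (@measurable_funB _ _ R) => //.
  exact: (@measurable_funM _ _ R).
have -> : f \o (fun w => \row_i divisor_X beta p' U J i w) =
    (fun w => F [tuple divisor_X beta p' U J i w | i < k.+2]).
  by apply/funext => w; congr f; apply/rowP => i; rewrite !mxE tnth_mktuple.
have FMc : seq_continuous (fun t => F t + M).
  by move=> u t ut; apply: cvgD; [exact: Fc|exact: cvg_cst].
have FM0 t : 0 <= F t + M.
  by have := fM (row_of_tuple t); rewrite ler_norml => /andP[h1 h2]; rewrite /F; lra.
apply: (err_convergence p_simplex p_ac tnth_gt0 tnth_sum (@seq_continuous_tnth R k.+2)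
  s_rounded (M := M) (F := F)) => //.
- by move=> t; exact: fM.
- exact: (measurableT_comp (seq_continuous_measurable Fc) mX).
- by move=> w; exact: fM.
rewrite (divisor_X_integral (simplex_same_law pp' p_simplex) beta hU FMc FM0).
apply/esym; apply: (integral_same_law (f := limit_mean (fun x => tnth x) 0 (beta - 1) _) pp').
by apply: measurable_limit_mean => //; exact: seq_continuous_tnth.
Qed.

End divisor.
End method_convergence.

(** * The limit law of the quota method *)

Section zone.
Context {R : realType} (n : nat) (gamma : R).
Local Open Scope ereal_scope.

Definition zone_exit (j : 'I_n.+1) : n.+1.-tuple R -> n.+1.-tuple R :=
  flow_exit (fun=> n.+1%:R^-1)%R (- gamma)%R j.

Let weight_ge0 : (0 <= n.+1%:R^-1 :> R)%R. Proof. by rewrite invr_ge0. Qed.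

(** The face is indexed by a natural number through [inord] to fit [msum], which sums a sequence of
    measures. *)
Definition exit_law (l : nat) : {measure set (n.+1.-tuple R) -> \bar R} :=
  mscale (NngNum weight_ge0)
    (image_measure (@cube_prob R n.+1) (measurable_flow_exit (fun=> n.+1%:R^-1)%R (- gamma)%R (inord l))).

(* The uniform law of the projection of the cube along the diagonal, as the mixture of its
   cells, which have equal volumes. *)
Definition zone_law : set (n.+1.-tuple R) -> \bar R := msum exit_law n.+1.

HB.instance Definition _ := Measure.on zone_law.

Lemma zone_lawE A : zone_law A =
  \sum_(j < n.+1) (n.+1%:R^-1 : R)%:E * cube_prob (zone_exit j @^-1` A).
Proof.
rewrite /zone_law /msum; apply: eq_bigr => j _.
by rewrite -[in RHS](inord_val j).
Qed.

Lemma zone_law_setT : zone_law setT = 1.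
Proof.
rewrite zone_lawE (eq_bigr (fun=> (n.+1%:R^-1 : R)%:E)); last first.
  by move=> j _; rewrite preimage_setT [X in _ * X]cube_prob_setT mule1.
by rewrite sumEFin sumr_const card_ord -[X in X%:E]mulr_natl divff.
Qed.

HB.instance Definition _ := Measure_isProbability.Build _ _ R zone_law zone_law_setT.

Lemma integral_zone_law (f : n.+1.-tuple R -> \bar R) :
  measurable_fun [set: n.+1.-tuple R] f -> (forall z, 0 <= f z) ->
  \int[zone_law]_z f z =
  \sum_(j < n.+1) (n.+1%:R^-1 : R)%:E * cube_integral (fun U => f (zone_exit j U)).
Proof.
move=> mf f0; rewrite [LHS](ge0_integral_measure_sum exit_law measurableT)//.
apply: eq_bigr => j _; rewrite /exit_law ge0_integral_mscale//; congr (_ * _).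
have mj := @measurable_flow_exit R n (fun=> n.+1%:R^-1)%R (- gamma)%R.
rewrite (ge0_integral_image (m := @cube_prob R n.+1) (mj (inord j)))// integral_cube_prob ?inord_val//.
exact: (measurableT_comp mf (mj _)).
Qed.

End zone.

Section permutation.
Context {R : realType} (n : nat).
Local Open Scope ereal_scope.

Definition permute (pi : {perm 'I_n}) (t : n.-tuple R) : n.-tuple R :=
  [tuple tnth t (pi i) | i < n].

Lemma measurable_permute pi : measurable_fun [set: n.-tuple R] (permute pi).
Proof. by apply: measurable_mktuple => i; exact: measurable_tnth. Qed.

Lemma cube_prob_permute pi (A : set (n.-tuple R)) : measurable A ->
  cube_prob (permute pi @^-1` A) = cube_prob A.
Proof.
move=> mA; rewrite -[LHS]/(image_measure (@cube_prob R n) (measurable_permute pi) A).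
apply: box_unique => //.
  rewrite (_ : image_measure _ _ setT = 1) ?ltry//.
  by rewrite /image_measure/= /pushforward preimage_setT; exact: cube_prob_setT.
move=> B mB; rewrite [RHS]cube_prob_box//.
rewrite -[LHS]/(cube_prob (permute pi @^-1` [set t | forall i, B i (tnth t i)])).
rewrite (_ : _ @^-1` _ = [set t : n.-tuple R | forall i, B ((pi^-1)%g i) (tnth t i)]).
  rewrite [LHS](cube_prob_box (B := fun i => B ((pi^-1)%g i)))// (reindex_inj (@perm_inj _ pi)).
  by apply: eq_bigr => i _; rewrite permK.
apply/seteqP; split=> t /= h i.
  by have := h ((pi^-1)%g i); rewrite tnth_mktuple permKV.
by have := h (pi i); rewrite tnth_mktuple permK.
Qed.

End permutation.

(** As the direction is constant, permuting the coordinates only renames the faces. *)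
Lemma permute_zone_exit {R : realType} n (gamma : R) (pi : {perm 'I_n.+1}) j U :
  permute pi (zone_exit gamma (pi j) U) = zone_exit gamma j (permute pi U).
Proof.
apply: eq_from_tnth => i; rewrite [LHS]tnth_mktuple !tnth_flow_exit !tnth_mktuple.
rewrite (inj_eq perm_inj); congr (_ * (_ + (_ - _)) - _).
rewrite /tsum (reindex_inj (@perm_inj _ pi)); apply: eq_bigr => l _.
by rewrite tnth_mktuple.
Qed.

Lemma zone_law_permute {R : realType} n (gamma : R) (pi : {perm 'I_n.+1}) A :
  measurable A -> zone_law gamma (permute pi @^-1` A) = zone_law (n := n) gamma A.
Proof.
move=> mA; rewrite !zone_lawE (reindex_inj (@perm_inj _ pi)).
apply: eq_bigr => j _; congr (_ * _)%E.
rewrite -[RHS](cube_prob_permute pi); last first.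
  by rewrite -[X in measurable X]setTI; exact: measurable_flow_exit.
by congr (cube_prob _); apply/seteqP; split=> U /=; rewrite permute_zone_exit.
Qed.

Section quota_limit.
Context {R : realType} (n : nat) (gamma : R).

Definition quota_limit (z : n.+1.-tuple R * n.+1.-tuple R) : n.+1.-tuple R :=
  [tuple tnth z.2 i + gamma * tnth z.1 i | i < n.+1].

Lemma measurable_quota_limit :
  measurable_fun [set: n.+1.-tuple R * n.+1.-tuple R] quota_limit.
Proof.
apply: measurable_mktuple => i; apply: (@measurable_funD _ _ R).
  exact: measurable_tnth_comp.
by apply: (@measurable_funM _ _ R) => //; exact: measurable_tnth_comp.
Qed.

(** Neither the weights nor the shift constant depend on the proportions: the limit error is a fixed
    law translated by [gamma * x], whence the independence claimed for the quota method. *)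
Lemma limit_mean_zone (F : n.+1.-tuple R -> R) (x : n.+1.-tuple R) : seq_continuous F -> (forall t, 0 <= F t) ->
  (limit_mean (fun _ _ => n.+1%:R^-1)%R gamma 0 F x =
   \int[@zone_law R n gamma]_z (F (quota_limit (x, z)))%:E)%E.
Proof.
move=> Fc F0; rewrite integral_zone_law//; last 2 first.
- apply/measurable_EFinP; apply: (measurableT_comp (seq_continuous_measurable Fc)).
  by apply: (measurableT_comp measurable_quota_limit); exact: measurable_pair1.
- by move=> z; rewrite lee_fin.
apply: eq_bigr => j _; congr (_ * _)%E; apply: eq_integral => U _; congr (_ * (F _)%:E)%E.
apply: eq_from_tnth => i; rewrite [LHS]tnth_mktuple [RHS]tnth_mktuple subr0.
by rewrite /zone_exit /shift_constant mulr0 sub0r.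
Qed.

Lemma measurable_zone_integral {d} {E : measurableType d} (G : E * n.+1.-tuple R -> \bar R) :
  measurable_fun [set: E * n.+1.-tuple R] G -> (forall z, 0 <= G z)%E ->
  measurable_fun [set: E] (fun x => \int[@zone_law R n gamma]_z G (x, z))%E.
Proof.
by move=> mG G0; apply: (@measurable_fun_fubini_tonelli_F _ _ _ _ _ (@zone_law R n gamma) G).
Qed.

End quota_limit.

(** With [H] merely measurable, this serves both for continuous test functions, in the convergence,
    and for indicators, in the equality of laws. *)
Lemma quota_Y_law {R : realType} k {d} {T : measurableType d} {P : probability T R}
    (p : {RV P >-> k.+2.-tuple R}) gamma (Ut : nat -> {RV P >-> R}) i (H : R -> \bar R) :
  {ae P, forall w, simplex (p w)} -> centered_uniforms p Ut ->
  measurable_fun [set: R] H -> (forall x, 0 <= H x)%E ->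
  (\int[P]_w H (quota_Y gamma p Ut i w) =
   \int[P]_w \int[@zone_law R k.+1 gamma]_z H (tnth (quota_limit gamma (p w, z)) i))%E.
Proof.
move=> p_simplex hUt mH H0.
pose G (z : k.+2.-tuple R * k.+2.-tuple R) := H (tnth (quota_limit gamma z) i).
have mG : measurable_fun [set: k.+2.-tuple R * k.+2.-tuple R] G.
  by apply: (measurableT_comp mH); apply: measurable_tnth_comp; exact: measurable_quota_limit.
have zE x : (\int[@zone_law R k.+1 gamma]_z G (x, z) =
    \sum_(j < k.+2) (k.+2%:R^-1 : R)%:E * cube_integral (fun U =>
      H (tnth (flow_exit (fun=> k.+2%:R^-1) (- gamma) j U) i + gamma * tnth x i)%R))%E.
  have mx : measurable_fun [set: k.+2.-tuple R] (fun z => G (x, z)).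
    by apply: (measurableT_comp mG); exact: measurable_pair1.
  rewrite (integral_zone_law gamma mx (fun _ => H0 _)).
  apply: eq_bigr => j _; congr (_ * _)%E; apply: eq_integral => U _; congr (_ * H _)%E.
  by rewrite /quota_limit tnth_mktuple.
rewrite (quota_Y_integral p_simplex hUt mH H0).
  by apply: eq_integral => w _; rewrite -zE.
by rewrite -(funext zE); apply: measurable_zone_integral => // z; exact: H0.
Qed.

Section quota.
Context {R : realType} {k : nat} {d} {T : measurableType d} {P : probability T R}.
Variable p : {RV P >-> k.+2.-tuple R}.
Hypothesis p_simplex : {ae P, forall w, simplex (p w)}.
Hypothesis p_ac : distribution P p `<< simplex_lebesgue (m := k.+2).
Variable s : nat -> T -> 'I_k.+2 -> int.
Variable gamma : R.
Hypothesis s_outcome : forall N, quota_admissible gamma N ->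
  measurable_seats (s N) /\ {ae P, forall w, quota_outcome gamma N (p w) (s N w)}.

Let q (_ : k.+2.-tuple R) (_ : 'I_k.+2) : R := k.+2%:R^-1.

Let s_rounded : \forall N \near \oo, measurable_seats (s N) /\
  {ae P, forall w, rounded (q (p w)) (target gamma 0 N (p w)) N (s N w)}.
Proof.
apply: filterS (quota_admissible_near gamma) => N /s_outcome[ms so]; split=> //.
by apply: filterS so => w; exact: quota_outcome_rounded.
Qed.

Let q_gt0 (x : k.+2.-tuple R) : simplex x -> forall i, 0 < q x i.
Proof. by move=> _ i; rewrite invr_gt0. Qed.

Let q_sum (x : k.+2.-tuple R) : simplex x -> \sum_i q x i = 1.
Proof. by move=> _; rewrite sumr_const card_ord -[LHS]mulr_natl divff. Qed.

Let q_cont i : seq_continuous (q^~ i).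
Proof. by move=> u t _; exact: cvg_cst. Qed.

Lemma quota_coordinate_cvg {d'} {T' : measurableType d'} (P' : probability T' R)
    (p' : {RV P' >-> k.+2.-tuple R}) (Ut : nat -> {RV P' >-> R}) i :
  same_law P p P' p' -> centered_uniforms p' Ut ->
  cvg_in_distribution P (fun N w => excess N (p w) (s N w) i) P' (quota_Y gamma p' Ut i).
Proof.
move=> pp' hUt f fc [M fM].
have mf : measurable_fun [set: R] f by exact: continuous_measurable_fun.
have E N : f \o (fun w => excess N (p w) (s N w) i) = (fun w => f (tnth (err N (p w) (s N w)) i)).
  by apply/funext => w /=; rewrite /err tnth_mktuple.
under eq_fun do rewrite E.
have mY : measurable_fun [set: T'] (quota_Y gamma p' Ut i).
  have mp' : measurable_fun [set: T'] p' by [].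
  have mi : measurable_fun [set: T'] (fun w => tnth (p' w) i) by exact: measurable_tnth_comp.
  apply: (@measurable_funD _ _ R).
    apply: (@measurable_funD _ _ R) => //; apply: (@measurable_funM _ _ R) => //.
    exact: (@measurable_funB _ _ R).
  by apply: (@measurable_funM _ _ R) => //; exact: (@measurable_sum _ _ R).
have fMc : seq_continuous (fun t : k.+2.-tuple R => f (tnth t i) + M).
  by move=> u t ut; apply: cvgD; [exact: (tnth_seq_continuous fc)|exact: cvg_cst].
have fM0 x : 0 <= f x + M.
  by have := fM x; rewrite ler_norml => /andP[h1 h2]; lra.
apply: (err_convergence p_simplex p_ac q_gt0 q_sum (@q_cont)
  s_rounded (M := M) (F := fun t => f (tnth t i))) => //.
- exact: tnth_seq_continuous.
- exact: (measurableT_comp mf mY).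
- by move=> w; exact: fM.
have mH : measurable_fun [set: R] (fun x => (f x + M)%:E).
  by apply/measurable_EFinP; exact: (@measurable_funD _ _ R).
have H0 x : (0 <= (f x + M)%:E)%E by rewrite lee_fin.
rewrite (quota_Y_law gamma i (simplex_same_law pp' p_simplex) hUt mH H0).
transitivity (\int[P']_w limit_mean q gamma 0 (fun t => f (tnth t i) + M)%R (p' w))%E.
  by apply: eq_integral => w _; rewrite limit_mean_zone.
apply/esym; apply: (integral_same_law (f := limit_mean q gamma 0 _) pp').
exact: measurable_limit_mean.
Qed.

Local Notation T2 := (k.+2.-tuple R * k.+2.-tuple R)%type.

Definition joint_law : probability T2 R := (distribution P p \x @zone_law R k.+1 gamma)%E.

Lemma quota_vector_cvg :
  cvg_in_distribution P (fun N w => \row_i excess N (p w) (s N w) i)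
    joint_law (fun z => row_of_tuple (quota_limit gamma z)).
Proof.
move=> f fc [M fM].
have E N : f \o (fun w => \row_i excess N (p w) (s N w) i) =
    (fun w => f (row_of_tuple (err N (p w) (s N w)))).
  apply/funext => w /=; congr f; apply/rowP => i.
  by rewrite !mxE /err tnth_mktuple.
under eq_fun do rewrite E.
pose F (t : k.+2.-tuple R) := f (row_of_tuple t).
have Fc : seq_continuous F by exact: row_of_tuple_seq_continuous.
have FMc : seq_continuous (fun t => F t + M).
  by move=> u t ut; apply: cvgD; [exact: Fc|exact: cvg_cst].
have FM0 t : 0 <= F t + M.
  by have := fM (row_of_tuple t); rewrite ler_norml => /andP[h1 h2]; rewrite /F; lra.
have mFq := measurableT_comp (seq_continuous_measurable FMc) (@measurable_quota_limit R k.+1 gamma).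
apply: (err_convergence p_simplex p_ac q_gt0 q_sum (@q_cont)
  s_rounded (M := M) (F := F)) => //.
- by move=> t; exact: fM.
- exact: (measurableT_comp (seq_continuous_measurable Fc) (@measurable_quota_limit R k.+1 gamma)).
- by move=> w; exact: fM.
have mG : measurable_fun [set: T2] (fun z => (F (quota_limit gamma z) + M)%:E).
  by apply/measurable_EFinP; exact: mFq.
have G0 z : (0 <= (F (quota_limit gamma z) + M)%:E)%E by rewrite lee_fin.
rewrite [LHS](fubini_tonelli1 (m1 := distribution P p) (m2 := @zone_law R k.+1 gamma) _ mG G0).
rewrite ge0_integral_distribution//; last 2 first.
- exact: (measurable_zone_integral gamma mG G0).
- by move=> x; apply: integral_ge0 => z _; exact: G0.
by apply: eq_integral => w _; rewrite [RHS](limit_mean_zone _ _ FMc FM0).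
Qed.

Lemma joint_law_rectangle (A B : set (k.+2.-tuple R)) : measurable A -> measurable B ->
  (joint_law (A `*` B) = distribution P p A * zone_law gamma B)%E.
Proof. by move=> mA mB; rewrite /joint_law [LHS]product_measure1E. Qed.

Lemma joint_law_fst (A : set (k.+2.-tuple R)) : measurable A ->
  joint_law (fst @^-1` A) = distribution P p A.
Proof.
move=> mA; rewrite (_ : _ @^-1` _ = A `*` setT); last by apply/seteqP; split=> z //= [].
by rewrite joint_law_rectangle// [X in (_ * X)%E]zone_law_setT mule1.
Qed.

Lemma joint_law_snd (B : set (k.+2.-tuple R)) : measurable B ->
  joint_law (snd @^-1` B) = zone_law gamma B.
Proof.
move=> mB; rewrite (_ : _ @^-1` _ = setT `*` B); last by apply/seteqP; split=> z //= [].
by rewrite joint_law_rectangle// [X in (X * _)%E]probability_setT mul1e.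
Qed.

Lemma joint_law_exchangeable : exchangeable joint_law (@snd (k.+2.-tuple R) (k.+2.-tuple R)).
Proof.
move=> pi A mA; rewrite (joint_law_snd mA) -(zone_law_permute gamma pi mA) -joint_law_snd//.
by rewrite -[X in measurable X]setTI; exact: measurable_permute.
Qed.

Lemma joint_law_independent : mutually_independent joint_law (fun b : bool =>
  if b then sigma_of (@snd (k.+2.-tuple R) (k.+2.-tuple R)) else sigma_of fst).
Proof.
move=> K A FA.
(* An index outside [K] is given the full event, so that one rectangle treats all subsets of [bool]
   at once. *)
have [B mB AB] : exists2 B, measurable B & (if true \in K then A true else setT) = snd @^-1` B.
  case: ifPn => [/FA[B mB <-]|_]; last by exists setT.
  by exists B => //; rewrite setTI.
have [C mC AC] : exists2 C, measurable C & (if false \in K then A false else setT) = fst @^-1` C.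
  case: ifPn => [/FA[C mC <-]|_]; last by exists setT.
  by exists C => //; rewrite setTI.
have -> : \bigcap_(i in [set` K]) A i = C `*` B.
  have -> : C `*` B = (fst @^-1` C) `&` (snd @^-1` B) by apply/seteqP; split=> z [].
  rewrite -AB -AC.
  apply/seteqP; split=> z /=.
    by move=> h; split; case: ifP => //; exact: h.
  by move=> [h1 h2] [] /= iK; [move: h2|move: h1]; rewrite iK.
have -> : (\prod_(i in K) joint_law (A i) =
    joint_law (fst @^-1` C) * joint_law (snd @^-1` B))%E.
  rewrite big_mkcond big_bool/= muleC -AB -AC.
  by congr (_ * _)%E; case: ifP => // _; rewrite probability_setT.
by rewrite joint_law_rectangle// joint_law_fst// joint_law_snd.
Qed.

Lemma quota_limit_law {d'} {T' : measurableType d'} (P' : probability T' R)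
    (p' : {RV P' >-> k.+2.-tuple R}) (Ut : nat -> {RV P' >-> R}) i :
  same_law P p P' p' -> centered_uniforms p' Ut ->
  same_law joint_law (fun z => tnth (quota_limit gamma z) i) P' (quota_Y gamma p' Ut i).
Proof.
move=> pp' hUt A mA.
pose H (x : R) : \bar R := (\1_A x : R)%:E.
have mH : measurable_fun [set: R] H by apply/measurable_EFinP; exact: measurable_indic.
have H0 x : (0 <= H x)%E by rewrite lee_fin indicE ler0n.
have mi : measurable_fun [set: T2] (fun z => tnth (quota_limit gamma z) i).
  by apply: measurable_tnth_comp; exact: measurable_quota_limit.
have mY : measurable_fun [set: T'] (quota_Y gamma p' Ut i).
  have mp' : measurable_fun [set: T'] p' by [].
  have mt : measurable_fun [set: T'] (fun w => tnth (p' w) i) by exact: measurable_tnth_comp.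
  apply: (@measurable_funD _ _ R).
    apply: (@measurable_funD _ _ R) => //; apply: (@measurable_funM _ _ R) => //.
    exact: (@measurable_funB _ _ R).
  by apply: (@measurable_funM _ _ R) => //; exact: (@measurable_sum _ _ R).
have prE d3 (T3 : measurableType d3) (P3 : probability T3 R) (X : T3 -> R) :
    measurable_fun [set: T3] X -> P3 (X @^-1` A) = (\int[P3]_w H (X w))%E.
  move=> mX; have mXA : measurable (X @^-1` A) by rewrite -[X in measurable X]setTI; exact: mX.
  transitivity (\int[P3]_w (\1_(X @^-1` A) w : R)%:E)%E => //.
  by rewrite integral_indic// setIT.
rewrite !prE// (quota_Y_law gamma i (simplex_same_law pp' p_simplex) hUt mH H0).
have mG := measurableT_comp mH mi.
rewrite [LHS](fubini_tonelli1 (m1 := distribution P p) (m2 := @zone_law R k.+1 gamma) _ mG (fun _ => H0 _)).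
have mF := measurable_zone_integral gamma mG (fun _ => H0 _).
rewrite ge0_integral_distribution//; last by move=> x; apply: integral_ge0 => z _; exact: H0.
exact: (integral_same_law pp' mF).
Qed.

End quota.

HB.instance Definition _ (R : realType) n (gamma : R) :=
  isMeasurableFun.Build _ _ _ _ (@quota_limit R n gamma) (@measurable_quota_limit R n gamma).

(* A limit in distribution only depends on laws, so the limit variables live on
   an arbitrary probability space carrying a copy [p'] of [p].  The seat vectors
   [s N] are arbitrary measurable selections among the outcomes of the method:
   this covers every random resolution of ties. *)
Theorem theorem6p1 (R : realType) (m : nat) (m_ge2 : (2 <= m)%N)
    (d : measure_display) (T : measurableType d) (P : probability T R)
    (p : {RV P >-> m.-tuple R})
    (p_simplex : {ae P, forall w, simplex (p w)})
    (p_ac : distribution P p `<< simplex_lebesgue (m := m)) :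
  (forall (beta : R) (s : nat -> T -> 'I_m -> int),
     (forall N, divisor_admissible m beta N ->
        measurable_seats (s N) /\
        {ae P, forall w, divisor_outcome beta N (p w) (s N w)}) ->
     (forall (d' : measure_display) (T' : measurableType d')
        (P' : probability T' R) (p' : {RV P' >-> m.-tuple R})
        (Ut : nat -> {RV P' >-> R}),
        same_law P p P' p' -> centered_uniforms p' Ut ->
        forall i : 'I_m,
          cvg_in_distribution P (fun N w => excess N (p w) (s N w) i)
            P' (divisor_Xbar beta p' Ut i)) /\
     (forall (d' : measure_display) (T' : measurableType d')
        (P' : probability T' R) (p' : {RV P' >-> m.-tuple R})
        (U : 'I_m -> {RV P' >-> R}) (J : T' -> 'I_m),
        same_law P p P' p' -> divisor_variables p' U J ->
        cvg_in_distribution P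
          (fun N w => \row_(i < m) excess N (p w) (s N w) i)
          P' (fun w => \row_(i < m) divisor_X beta p' U J i w)))
  /\
  (forall (gamma : R) (s : nat -> T -> 'I_m -> int),
     (forall N, quota_admissible gamma N ->
        measurable_seats (s N) /\
        {ae P, forall w, quota_outcome gamma N (p w) (s N w)}) ->
     (forall (d' : measure_display) (T' : measurableType d')
        (P' : probability T' R) (p' : {RV P' >-> m.-tuple R})
        (Ut : nat -> {RV P' >-> R}),
        same_law P p P' p' -> centered_uniforms p' Ut ->
        forall i : 'I_m,
          cvg_in_distribution P (fun N w => excess N (p w) (s N w) i)
            P' (quota_Y gamma p' Ut i)) /\
     (exists (d2 : measure_display) (T2 : measurableType d2)
        (P2 : probability T2 R) (p2 : {RV P2 >-> m.-tuple R})
        (Yb : {RV P2 >-> m.-tuple R}),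
        let Z := fun w =>
          [tuple tnth (Yb w) i - gamma * tnth (p2 w) i | i < m] in
        [/\ same_law P p P2 p2,
            cvg_in_distribution P
              (fun N w => \row_(i < m) excess N (p w) (s N w) i)
              P2 (fun w => row_of_tuple (Yb w)),
            exchangeable P2 Z,
            mutually_independent P2
              (fun b : bool => if b then sigma_of Z else sigma_of p2) &
            forall (d' : measure_display) (T' : measurableType d')
              (P' : probability T' R) (p' : {RV P' >-> m.-tuple R})
              (Ut : nat -> {RV P' >-> R}),
              same_law P p P' p' -> centered_uniforms p' Ut ->
              forall i : 'I_m,
                same_law P2 (fun w => tnth (Yb w) i) P' (quota_Y gamma p' Ut i)])).
Proof.
case: m m_ge2 p p_simplex p_ac => [|[|k]]// _ p p_simplex p_ac; split.
  move=> beta s s_outcome; split.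
    by move=> d' T' P' p' Ut pp' hUt i; exact: divisor_coordinate_cvg.
  by move=> d' T' P' p' U J pp' hU; exact: divisor_vector_cvg.
move=> gamma s s_outcome; split.
  by move=> d' T' P' p' Ut pp' hUt i; exact: quota_coordinate_cvg.
(* The limit vector lives on pairs of a proportion vector and an independent point of law
   [zone_law]; subtracting [gamma] times the first component leaves the second. *)
exists _, _, (joint_law p gamma).
have mfst : @fst (k.+2.-tuple R) (k.+2.-tuple R) \in mfun by rewrite inE; exact: measurable_fst.
exists (mfun_Sub mfst), (@quota_limit R k.+1 gamma : {RV _ >-> _}) => Z.
have -> : Z = snd.
  apply/funext => z; apply: eq_from_tnth => i.
  by rewrite /Z [LHS]tnth_mktuple [tnth (quota_limit _ _) _]tnth_mktuple addrK.
split.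
- by move=> A mA; rewrite -[RHS]/(joint_law p gamma (fst @^-1` A)) joint_law_fst.
- exact: quota_vector_cvg.
- exact: joint_law_exchangeable.
- exact: joint_law_independent.
- by move=> d' T' P' p' Ut pp' hUt i; exact: quota_limit_law.
Qed.
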